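(* Let $(b,\mathbf B,m,\mu)$ be an admissible parameter set satisfying Assumption C (both defined in the context), and let $(X,(\mathbb P_x)_{x\in\mathcal H^+})$ be the associated affine process on $\mathcal H^+$. For every $t>0$ and every $u=(u_1,u_2)\in iH\times\mathcal H^+$, with $(\Phi,\psi_1,\psi_2)$ the mild solution of the joint Riccati equations described in the context, the process $$M_s=\exp\Big(\tfrac12\int_0^s\langle X_r,\psi_1(t-r,u)^{\otimes2}\rangle\,dr\Big)\exp\big(-\Phi(t-s,u)-\langle X_s,\psi_2(t-s,u)\rangle\big),\qquad 0\le s\le t,$$ is a true martingale under $\mathbb P_x$ for every $x\in\mathcal H^+$.
   Context: **Spaces.** $V,H$ are separable real Hilbert spaces with $V\hookrightarrow H\hookrightarrow V^*$, where $V^*$ is the dual of $V$ with respect to the pivot space $H$. $\mathcal L(E,G)$, $\mathcal L_2(E,G)$ denote bounded and Hilbert--Schmidt operators. $\mathcal H$ is the real Hilbert space of self-adjoint operators in $\mathcal L_2(H,H)$ with $\langle A,C\rangle=\sum_n\langle Ae_n,Ce_n\rangle_H$ and norm $\|\cdot\|$; $\mathcal H^+\subset\mathcal H$ is the closed convex cone of positive operators. $\mathcal V=\mathcal L_2(V^*,H)\cap\mathcal L_2(H,V)$ with $\|x\|_{\mathcal V}^2=\|x\|_{\mathcal L_2(H,V)}^2+\|x\|_{\mathcal L_2(V^*,H)}^2$. $\chi(\xi)=\xi\mathbf 1_{\{\|\xi\|\le 1\}}$. $D(\mathbb R^+,\mathcal H^+)$ is the space of càdlàg paths $[0,\infty)\to\mathcal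 H^+$. Integrals without indicated domain are over $\mathcal H^+\setminus\{0\}$. **Admissible parameter set.** $(b,\mathbf B,m,\mu)$ is admissible if: (i) $m$ is a Borel measure on $\mathcal H^+\setminus\{0\}$ with $\int\|\xi\|^2m(d\xi)<\infty$, $\int|\langle\chi(\xi),h\rangle|m(d\xi)<\infty$ for all $h\in\mathcal H$, and there is $I_m\in\mathcal H$ with $\langle I_m,h\rangle=\int\langle\chi(\xi),h\rangle m(d\xi)$ for all $h\in\mathcal H$; (ii) $b\in\mathcal H$ and $\langle b,v\rangle-\int\langle\chi(\xi),v\rangle m(d\xi)\ge0$ for all $v\in\mathcal H^+$; (iii) $\mu$ is an $\mathcal H^+$-valued measure on $\mathcal B(\mathcal H^+\setminus\{0\})$ with $\mu(\mathcal H^+\setminus\{0\})\in\mathcal H^+$ such that $\int\langle\chi(\xi),u\rangle\|\xi\|^{-2}\langle x,\mu(d\xi)\rangle<\infty$ for all $u,x\in\mathcal H^+$ with $\langle u,x\rangle=0$; (iv) $\mathbf B\in\mathcal L(\mathcal V,\mathcal V^* )$ has the form $\mathbf B(x)=Bx+xB^*+\Gamma(x)$ ($\mathcal H$ identified with a subspace of $\mathcal V^*$ via $h\mapsto\langle h,\cdot\rangle$), where (a) $B$ is a self-adjoint non-positive operator on $H$, $B\in\mathcal L(V,V^* )$, with an orthonormal basis $(e_i)_{i\in\mathbb N}$ of $H$ such that $Be_i=-\lambda_ie_i$, $0\le\lambda_1\le\lambda_2\le\cdots\to\infty$, and domain $\{h:\sum_i\lambda_i^2|\langle h,e_i\rangle_H|^2<\infty\}$;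 (b) $\Gamma:\mathcal H\to\mathcal H$ is bounded linear, $\Gamma(\mathcal H^+)\subseteq\mathcal H^+$, and $\langle\Gamma(x),u\rangle-\int\langle\chi(\xi),u\rangle\|\xi\|^{-2}\langle\mu(d\xi),x\rangle\ge0$ for all $x,u\in\mathcal H^+$ with $\langle u,x\rangle=0$; (c) there are $\alpha_0,\alpha_1>0$, $\kappa\ge0$ with $\alpha_0\|u\|_V^2\le-2\langle Bu,u\rangle_{V^*,V}+\kappa\|u\|_H^2\le\alpha_1\|u\|_V^2$ for all $u\in V$; moreover $e_i\in V$ for all $i$, their linear span is dense in $V$, and $\sum_i(1+\lambda_i)|\langle u,e_i\rangle_H|^2$ is equivalent to $\|u\|_V^2$ on $V$. **Assumption C.** $b\in\mathcal V\cap\mathcal H$; $\Gamma$ maps $\mathcal V\cap\mathcal H$ boundedly into itself; $\int\|\xi\|_{\mathcal V}^2m(d\xi)<\infty$; and there is $C_{\mathcal V}<\infty$ with $\int\|\xi\|_{\mathcal V}^2\|\xi\|^{-2}\langle y,\mu(d\xi)\rangle\le C_{\mathcal V}(1+\|y\|_{\mathcal V}^2)$ for all $y\in\mathcal V\cap\mathcal H^+$. **Associated affine process.** With $(x\otimes y)h=\langle x,h\rangle_Hy$, put $\mathbf e_{i,i}=e_i\otimes e_i$, $\mathbf e_{i,j}=\frac1{\sqrt2}(e_i\otimes e_j+e_j\otimes e_i)$ for $i<j$ (an orthonormal basis of $\mathcal H$ for $i\le j$), $\lambda_{i,j}=\lambda_i+\lambda_j$, and let $\mathcal T(t)\mathbf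 e_{i,j}=e^{-\lambda_{i,j}t}\mathbf e_{i,j}$ define the $C_0$-semigroup $(\mathcal T(t))_{t\ge0}$ on $\mathcal H$. For $u\in\mathcal H^+$, $F(u)=\langle b,u\rangle-\int(e^{-\langle\xi,u\rangle}-1+\langle\chi(\xi),u\rangle)m(d\xi)$, $\hat R(u)=\Gamma^*(u)-\int(e^{-\langle\xi,u\rangle}-1+\langle\chi(\xi),u\rangle)\|\xi\|^{-2}\mu(d\xi)$, and $(\phi,\psi)$ is the unique mild solution: $\psi(t,u)=\mathcal T(t)u+\int_0^t\mathcal T(t-s)\hat R(\psi(s,u))ds$ (continuous in $t$, valued in $\mathcal H^+$), $\phi(t,u)=\int_0^tF(\psi(s,u))ds$. The associated affine process is the unique (in law) time-homogeneous Markov process $(X,(\mathbb P_x)_{x\in\mathcal H^+})$ with paths in $D(\mathbb R^+,\mathcal H^+)$, $\mathbb P_x(X_0=x)=1$, and $\mathbb E_{\mathbb P_x}[e^{-\langle X_t,u\rangle}]=e^{-\phi(t,u)-\langle x,\psi(t,u)\rangle}$ for all $t\ge0$, $u\in\mathcal H^+$; it exists whenever $(b,\mathbf B,m,\mu)$ is an admissible parameter set satisfying Assumption C. The filtration is the $\mathbb P_x$-augmented natural filtration of $X$. **Joint Riccati equations.** $(S(t))_{t\ge0}$ is a fixed strongly continuous semigroup on $H$, with adjoint semigroup $(S^*(t))_{t\ge0}$. $iH=\{ih:h\in H\}$ (purely imaginary elements of the complexification); $v^{\otimes2}=v\otimes v$, extended complex-bilinearly, so $(ih)^{\otimes2}=-h^{\otimes2}\in\mathcal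 H$. Let $\hat{\mathcal R}(h,v)=\hat R(v)-\frac12h\otimes h$ for $h\in iH$, $v\in\mathcal H^+$. For $u=(u_1,u_2)\in iH\times\mathcal H^+$ the mild solution $(\Phi,\psi_1,\psi_2)$ is the unique triple with $\psi_1(t,u)=S^*(t)u_1$, $\psi_2(\cdot,u)$ continuous into $\mathcal H^+$ and $\psi_2(t,u)=\mathcal T(t)u_2+\int_0^t\mathcal T(t-s)\hat{\mathcal R}(\psi_1(s,u),\psi_2(s,u))ds$, $\Phi(t,u)=\int_0^tF(\psi_2(s,u))ds$. *)

(* Defs.v *)
From HB Require Import structures.
From mathcomp Require Import all_boot all_order all_algebra.
From mathcomp Require Import all_classical all_reals all_analysis.
From mathcomp Require Import measurable_realfun.
From mathcomp Require Import ring lra.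

Set Implicit Arguments.
Unset Strict Implicit.
Unset Printing Implicit Defensive.

Import Order.TTheory GRing.Theory Num.Theory.
Import numFieldNormedType.Exports.

Local Open Scope classical_set_scope.
Local Open Scope ring_scope.

HB.mixin Record NormedModule_isInner (R : realType) V
    & NormedModule R V := {
  inner : V -> V -> R ;
  innerC : forall x y, inner x y = inner y x ;
  innerPl : forall a x y z, inner (a *: x + y) z = a * inner x z + inner y z ;
  innerxx : forall x, inner x x = `|x| ^+ 2 }.

#[short(type=innerType)]
HB.structure Definition InnerProduct (R : realType) :=
  { V of NormedModule R V & NormedModule_isInner R V }.

#[short(type=hilbertType)]
HB.structure Definition Hilbert (R : realType) :=
  { V of InnerProduct R V & CompleteNormedModule R V }.

Section cauchy_schwarz_form.
Context (R : realType) (V : lmodType R) (f : V -> V -> R).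
Hypothesis fC : forall x y, f x y = f y x.
Hypothesis fP : forall a x y z, f (a *: x + y) z = a * f x z + f y z.
Hypothesis f_ge0 : forall x, 0 <= f x x.

Lemma form_sqr a x b y :
  f (a *: x + b *: y) (a *: x + b *: y)
  = a ^+ 2 * f x x + 2 * a * b * f x y + b ^+ 2 * f y y.
Proof.
have f0 z : f 0 z = 0.
  have := fP 0 0 0 z; rewrite scaler0 addr0 mul0r add0r => h.
  by have := fP 1 0 0 z; rewrite scaler0 addr0 mul1r; lra.
have fZ c u v : f (c *: u) v = c * f u v.
  by rewrite -[c *: u]addr0 fP f0 addr0.
rewrite fP fZ (fC x) (fC y) !fP !fZ (fC y x); ring.
Qed.

Lemma form_cauchy_schwarz x y : f x y ^+ 2 <= f x x * f y y.
Proof.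
have := f_ge0 (f y y *: x + (- f x y) *: y); rewrite form_sqr => h1.
have := f_ge0 y; rewrite le_eqVlt => /orP[/eqP y0|y0].
  rewrite -y0 mulr0.
  have [->|p0] := eqVneq (f x y) 0; first by rewrite expr0n.
  have := f_ge0 (1 *: x + (- (f x x + 1) / (2 * f x y)) *: y).
  rewrite form_sqr -y0 mulr0 addr0.
  have -> : 1 ^+ 2 * f x x + 2 * 1 * (- (f x x + 1) / (2 * f x y)) * f x y = - 1.
    by field.
  by rewrite ler0N1.
suff : 0 <= f y y * (f x x * f y y - f x y ^+ 2).
  by rewrite pmulr_rge0// subr_ge0.
by apply: le_trans h1 _; rewrite le_eqVlt; apply/orP; left; apply/eqP; ring.
Qed.

Lemma form_triangle x y :
  Num.sqrt (f (x + y) (x + y)) <= Num.sqrt (f x x) + Num.sqrt (f y y).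
Proof.
rewrite -(ler_pXn2r (n := 2)) ?nnegrE ?addr_ge0 ?sqrtr_ge0//.
rewrite sqrrD !sqr_sqrtr//.
have -> : f (x + y) (x + y) = f x x + f x y *+ 2 + f y y.
  by have := form_sqr 1 x 1 y; rewrite !scale1r => ->; ring.
rewrite lerD2r lerD2l lerMn2r /=.
rewrite (le_trans (ler_norm _))// -sqrtr_sqr -sqrtrM//.
by rewrite ler_wsqrtr// form_cauchy_schwarz.
Qed.

End cauchy_schwarz_form.

HB.factory Record Lmodule_isInner (R : realType) V & GRing.Lmodule R V := {
  form : V -> V -> R ;
  formC : forall x y, form x y = form y x ;
  formPl : forall a x y z, form (a *: x + y) z = a * form x z + form y z ;
  form_ge0 : forall x, 0 <= form x x ;
  form_eq0 : forall x, form x x = 0 -> x = 0 }.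

HB.builders Context R V & Lmodule_isInner R V.

Let norm x := Num.sqrt (form x x).

Let normD x y : norm (x + y) <= norm x + norm y.
Proof. exact: (form_triangle formC formPl form_ge0). Qed.

Let normZ l x : norm (l *: x) = `|l| * norm x.
Proof.
rewrite /norm; have := form_sqr formC formPl l x 0 x.
by rewrite scale0r addr0 => ->; rewrite mulr0 mul0r expr0n/= mul0r !addr0
  sqrtrM ?sqr_ge0// sqrtr_sqr.
Qed.

Let norm0_eq0 x : norm x = 0 -> x = 0.
Proof.
move=> /eqP; rewrite /norm sqrtr_eq0 => h; apply: form_eq0.
by apply/eqP; rewrite eq_le h form_ge0.
Qed.

HB.instance Definition _ := Lmodule_isNormed.Build R V normD normZ norm0_eq0.

Let formxx x : form x x = `|x| ^+ 2.
Proof. by rewrite /Num.Def.normr/= /norm sqr_sqrtr// form_ge0. Qed.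

HB.instance Definition _ := NormedModule_isInner.Build R V formC formPl formxx.

HB.end.

Section inner_theory.
Context (R : realType) (V : innerType R).
Implicit Types x y z : V.

Lemma inner_ge0 x : 0 <= inner x x.
Proof. by rewrite innerxx sqr_ge0. Qed.

Lemma inner0l z : inner 0 z = 0.
Proof.
by have := innerPl 1 0 0 z; rewrite scaler0 addr0 mul1r; lra.
Qed.

Lemma inner0r z : inner z 0 = 0. Proof. by rewrite innerC inner0l. Qed.

Lemma innerDl x y z : inner (x + y) z = inner x z + inner y z.
Proof. by have := innerPl 1 x y z; rewrite scale1r mul1r. Qed.

Lemma innerZl a x z : inner (a *: x) z = a * inner x z.
Proof. by have := innerPl a x 0 z; rewrite addr0 inner0l addr0. Qed.

Lemma innerDr x y z : inner z (x + y) = inner z x + inner z y.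
Proof. by rewrite ![inner z _]innerC innerDl. Qed.

Lemma innerZr a x z : inner z (a *: x) = a * inner z x.
Proof. by rewrite ![inner z _]innerC innerZl. Qed.

Lemma innerBr x y z : inner z (x - y) = inner z x - inner z y.
Proof. by rewrite innerDr -scaleN1r innerZr mulN1r. Qed.

Lemma inner_sumr x (u : nat -> V) n :
  inner x (\sum_(0 <= i < n) u i) = \sum_(0 <= i < n) inner x (u i).
Proof.
elim: n => [|n ih]; first by rewrite !big_geq// inner0r.
by rewrite !big_nat_recr//= innerDr ih.
Qed.

Lemma cauchy_schwarz x y : `|inner x y| <= `|x| * `|y|.
Proof.
rewrite -(ler_pXn2r (n := 2)) ?nnegrE ?mulr_ge0//.
rewrite real_normK ?num_real// exprMn -!innerxx.
exact: (form_cauchy_schwarz (@innerC R V) (@innerPl R V) inner_ge0).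
Qed.

Lemma inner_continuous x : continuous (inner x).
Proof.
move=> y; apply/cvgrPdist_le => e e0; near=> z.
rewrite -innerBr (le_trans (cauchy_schwarz _ _))//.
rewrite (@le_trans _ _ ((`|x| + 1) * `|y - z|))//.
  by rewrite ler_wpM2r// lerDl.
have x1 : 0 < `|x| + 1 by rewrite ltr_wpDl.
rewrite -ler_pdivlMl// mulrC; near: z.
have : (fun z => z) @ y --> y by exact: cvg_id.
by move=> /cvgrPdist_le; apply; rewrite divr_gt0.
Unshelve. all: by end_near. Qed.

End inner_theory.

Definition separable (T : topologicalType) :=
  exists D : set T, countable D /\ dense D.

Definition lin_span (R : realType) (V : lmodType R) (u : nat -> V) : set V :=
  [set x | exists n (c : nat -> R), x = \sum_(0 <= i < n) c i *: u i].

Record onb (R : realType) (H : innerType R) := ONB {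
  basis :> nat -> H ;
  basis_orthonormal : forall i j, inner (basis i) (basis j) = (i == j)%:R ;
  basis_total : dense (lin_span basis) }.

Definition bounded_linear (R : realType) (V W : normedModType R) (A : V -> W) :=
  linear A /\ continuous A.

(* The squared Hilbert-Schmidt norm computed in the orthonormal basis [b]; for
   a bounded operator between Hilbert spaces it does not depend on [b]. *)
Definition hs_norm2 (R : realType) (E : innerType R) (G : normedModType R)
    (b : onb E) (A : E -> G) : \bar R :=
  \sum_(0 <= n <oo) (`|A (b n)| ^+ 2)%:E.

Section hs_norm2_theory.
Context (R : realType) (E : innerType R) (G : normedModType R) (b : onb E).
Implicit Type A : E -> G.

Lemma hs_norm2_fin A (M : R) :
  (forall n, \sum_(0 <= i < n) `|A (b i)| ^+ 2 <= M) -> (hs_norm2 b A < +oo)%E.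
Proof.
move=> AM; apply: (@le_lt_trans _ _ M%:E); last exact: ltry.
apply: lime_le; first by apply: is_cvg_nneseries => n _ _; rewrite lee_fin sqr_ge0.
by apply: nearW => n; rewrite sumEFin lee_fin.
Qed.

Lemma hs_norm2_cvg A : (hs_norm2 b A < +oo)%E ->
  cvgn (series (fun n => `|A (b n)| ^+ 2)).
Proof.
move=> Afin; apply: nondecreasing_is_cvgn.
  by apply: nondecreasing_series => n _ _; exact: sqr_ge0.
exists (fine (hs_norm2 b A)) => _ [n _ <-].
have A0 : (0 <= hs_norm2 b A)%E.
  by apply: nneseries_ge0 => i _ _; rewrite lee_fin sqr_ge0.
rewrite -lee_fin fineK ?ge0_fin_numE// /series/= -sumEFin.
by apply: nneseries_lim_ge => i _ _; rewrite lee_fin sqr_ge0.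
Qed.

Lemma hs_norm2_comb (A C : E -> G) (a : R) : (hs_norm2 b A < +oo)%E ->
  (hs_norm2 b C < +oo)%E -> (hs_norm2 b (fun x => (a *: A x + C x)%R) < +oo)%E.
Proof.
move=> /hs_norm2_cvg cA /hs_norm2_cvg cC.
have := is_cvg_seriesD (is_cvg_seriesZ (k := 2 * a ^+ 2) cA)
                       (is_cvg_seriesZ (k := 2) cC).
move=> /cvg_seq_bounded/bounded_fun_has_ubound[M AM].
apply: (@hs_norm2_fin _ M) => n; apply: le_trans (AM _ _); last by exists n.
rewrite /series/=; apply: ler_sum => i _.
have -> : (2 * a ^+ 2 *: (fun n => `|A (b n)| ^+ 2) + 2 *: (fun n => `|C (b n)| ^+ 2)) i
  = 2 * (`|a| * `|A (b i)|) ^+ 2 + 2 * `|C (b i)| ^+ 2.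
  by rewrite exprMn real_normK ?num_real// [in RHS]mulrA.
rewrite (@le_trans _ _ ((`|a| * `|A (b i)| + `|C (b i)|) ^+ 2))//.
  by rewrite ler_pXn2r ?nnegrE ?addr_ge0 ?mulr_ge0// -normrZ ler_normD.
have := sqr_ge0 (`|a| * `|A (b i)| - `|C (b i)|); nra.
Qed.

End hs_norm2_theory.

Section onb_theory.
Context (R : realType) (H : innerType R) (e : onb H).

Lemma bessel (x : H) n : \sum_(0 <= i < n) inner x (e i) ^+ 2 <= `|x| ^+ 2.
Proof.
pose p := \sum_(0 <= i < n) inner x (e i) *: e i.
have xp : inner x p = \sum_(0 <= i < n) inner x (e i) ^+ 2.
  by rewrite /p inner_sumr; apply: eq_bigr => i _; rewrite innerZr expr2.
have pp : inner p p = \sum_(0 <= i < n) inner x (e i) ^+ 2.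
  rewrite {2}/p inner_sumr; apply: eq_big_nat => i /andP[_ i_n].
  rewrite innerZr expr2; congr (_ * _).
  rewrite innerC /p inner_sumr (bigD1_seq i) ?iota_uniq ?mem_index_iota//=.
  rewrite innerZr basis_orthonormal eqxx mulr1 big1 ?addr0// => j ji.
  by rewrite innerZr basis_orthonormal eq_sym (negbTE ji) mulr0.
have := inner_ge0 (x - p).
rewrite innerBr [inner _ x]innerC [inner _ p]innerC !innerBr.
by rewrite (innerC p x) xp pp innerxx subrr subr0 subr_ge0.
Qed.

Lemma onb_eq0 (G : normedModType R) (A : H -> G) : bounded_linear A ->
  (forall n, A (e n) = 0) -> forall x, A x = 0.
Proof.
move=> [linA cA] Ae x.
have A0 : A 0 = 0 by have := linA (-1) 0 0; rewrite scaler0 add0r scaleN1r addNr.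
have AD u v : A (u + v) = A u + A v by rewrite -[u]scale1r linA !scale1r.
have As z : lin_span e z -> A z = 0.
  move=> [n [c ->]]; elim: n => [|n ih]; first by rewrite big_geq.
  rewrite big_nat_recr//= AD ih add0r.
  by rewrite -[_ *: _]addr0 linA Ae A0 scaler0 addr0.
apply/eqP; apply: contrapT => /negP Ax0.
have [||z [Az0 sz]] := @basis_total _ _ e (A @^-1` [set~ 0]).
- by exists x => /=; exact/eqP.
- apply: open_comp => [y _|]; first exact: cA.
  apply: closed_openC.
  exact/accessible_closed_set1/hausdorff_accessible/norm_hausdorff.
- by apply: Az0 => /=; exact: As.
Qed.

End onb_theory.

Definition is_hsop (R : realType) (H : innerType R) (e : onb H)
    (A : H -> H) : Prop :=
  [/\ bounded_linear A,
      forall x y, inner (A x) y = inner x (A y) &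
      (hs_norm2 e A < +oo)%E].

Definition hsop_pred (R : realType) (H : innerType R) (e : onb H) :
  {pred H -> H} := mem [set A | is_hsop e A].

Lemma hsop_predP (R : realType) (H : innerType R) (e : onb H) (A : H -> H) :
  reflect (is_hsop e A) (A \in hsop_pred e).
Proof. by apply: (iffP idP); rewrite inE. Qed.

(* The orthonormal basis only serves to express the inner product: neither the
   set of operators nor their inner product depends on it. *)
Record hsop (R : realType) (H : innerType R) (e : onb H) := HSOp {
  hsop_fun :> H -> H ;
  hsop_funP : hsop_fun \in hsop_pred e }.

Section hsop_instances.
Context (R : realType) (H : innerType R) (e : onb H).

HB.instance Definition _ := [isSub for @hsop_fun R H e].
HB.instance Definition _ := gen_eqMixin (hsop e).
HB.instance Definition _ := gen_choiceMixin (hsop e).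

Lemma hsop_submod_closed : submod_closed (hsop_pred e).
Proof.
split=> [|a A C /hsop_predP[[lA cA] sA hA] /hsop_predP[[lC cC] sC hC]];
  apply/hsop_predP; split.
- split; first by move=> k x y; change (0 = k *: 0 + 0 :> H); rewrite scaler0 addr0.
  exact: cst_continuous.
- by move=> x y; change (inner 0 y = inner x 0); rewrite inner0l inner0r.
- apply: (@hs_norm2_fin _ _ _ _ _ 0) => n.
  by rewrite big1// => i _; change (`|0 : H| ^+ 2 = 0); rewrite normr0 expr0n.
- split.
    move=> k x y; rewrite !fctE lA lC !scalerDr !scalerA (mulrC k) -!addrA.
    by congr (_ + _); rewrite addrCA.
  move=> x; apply: (@continuousD _ _ _ (a *: A) C); last exact: cC.
  by apply: (continuousZl_tmp (f := A)); exact: cA.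
- by move=> x y; rewrite !fctE innerDl innerDr innerZl innerZr sA sC.
- exact: hs_norm2_comb.
Qed.

HB.instance Definition _ :=
  GRing.isSubmodClosed.Build R (H -> H) (hsop_pred e) hsop_submod_closed.
HB.instance Definition _ := [SubChoice_isSubLmodule of hsop e by <:].

Definition hs_inner (A C : hsop e) : R :=
  limn (series (fun n => inner (A (e n)) (C (e n)))).

Lemma hsop_hs_norm2 (A : hsop e) : (hs_norm2 e A < +oo)%E.
Proof. by have /hsop_predP[] := hsop_funP A. Qed.

Lemma hsop_bounded_linear (A : hsop e) : bounded_linear A.
Proof. by have /hsop_predP[] := hsop_funP A. Qed.

Lemma hs_inner_cvg (A C : hsop e) :
  cvgn (series (fun n => inner (A (e n)) (C (e n)))).
Proof.
apply: normed_cvg; apply: (@series_le_cvg _ _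
  ((fun n => `|A (e n)| ^+ 2) + (fun n => `|C (e n)| ^+ 2))).
- by move=> n /=; exact: normr_ge0.
- by move=> n; rewrite fctE addr_ge0// sqr_ge0.
- move=> n; rewrite fctE (le_trans (cauchy_schwarz _ _))//.
  have := sqr_ge0 (`|A (e n)| - `|C (e n)|).
  have := sqr_ge0 (`|A (e n)|); have := sqr_ge0 (`|C (e n)|); nra.
- by apply: is_cvg_seriesD; apply: hs_norm2_cvg; exact: hsop_hs_norm2.
Qed.

Lemma hs_innerC A C : hs_inner A C = hs_inner C A.
Proof.
by rewrite /hs_inner; congr (limn (series _)); apply/funext => n; rewrite innerC.
Qed.

Lemma hs_innerPl a (A B C : hsop e) :
  hs_inner (a *: A + B) C = a * hs_inner A C + hs_inner B C.
Proof.
have -> : hs_inner (a *: A + B) C = limn (series (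
    a *: (fun n => inner (A (e n)) (C (e n)))
    + (fun n => inner (B (e n)) (C (e n))))).
  by congr (limn (series _)); apply/funext => n; exact: innerPl.
have cA := @hs_inner_cvg A C; have cB := @hs_inner_cvg B C.
have cZ := is_cvg_seriesZ (k := a) cA.
rewrite lim_seriesD; [|exact: cZ|exact: cB].
by rewrite lim_seriesZ; last exact: cA.
Qed.

Lemma hs_inner_partial (A : hsop e) n :
  \sum_(0 <= i < n) `|A (e i)| ^+ 2 <= hs_inner A A.
Proof.
have -> : \sum_(0 <= i < n) `|A (e i)| ^+ 2
    = series (fun n => inner (A (e n)) (A (e n))) n.
  by rewrite /series/=; apply: eq_bigr => i _; rewrite innerxx.
apply: nondecreasing_cvgn_le; last exact: hs_inner_cvg.
by apply: nondecreasing_series => i _ _; exact: inner_ge0.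
Qed.

Lemma hs_inner_ge0 A : 0 <= hs_inner A A.
Proof. by have := hs_inner_partial A 0; rewrite big_geq. Qed.

Lemma hs_inner_eq0 A : hs_inner A A = 0 -> A = 0.
Proof.
move=> A0; apply/val_inj/funext => x /=.
change (A x = 0); apply: (onb_eq0 (hsop_bounded_linear A)) => n.
have := hs_inner_partial A n.+1; rewrite A0 big_nat_recr//= => h.
have s0 : 0 <= \sum_(0 <= i < n) `|A (e i)| ^+ 2.
  by apply: sumr_ge0 => i _; exact: sqr_ge0.
apply/eqP; rewrite -normr_eq0 -sqrf_eq0 eq_le sqr_ge0 andbT.
by move: s0 h; lra.
Qed.

HB.instance Definition _ := Lmodule_isInner.Build R (hsop e)
  hs_innerC hs_innerPl hs_inner_ge0 hs_inner_eq0.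

End hsop_instances.

Definition tensor (R : realType) (H : innerType R) (x y : H) : H -> H :=
  fun h => inner x h *: y.

Section rank_one.
Context (R : realType) (H : innerType R) (e : onb H).
Implicit Types x y : H.

Lemma tensor_bounded_linear x y : bounded_linear (tensor x y).
Proof.
split=> [a u v|u]; first by rewrite /tensor innerDr innerZr scalerDl scalerA.
by apply: cvgZr_tmp; exact: inner_continuous.
Qed.

Lemma tensor_hs_norm2 x y : (hs_norm2 e (tensor x y) < +oo)%E.
Proof.
apply: (@hs_norm2_fin _ _ _ _ _ (`|x| ^+ 2 * `|y| ^+ 2)) => n.
under eq_bigr => i _ do rewrite normrZ exprMn real_normK ?num_real//.
by rewrite -mulr_suml ler_wpM2r ?sqr_ge0// bessel.
Qed.

Lemma is_hsop_tensor2 x : tensor x x \in hsop_pred e.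
Proof.
apply/hsop_predP; split; [exact: tensor_bounded_linear| |exact: tensor_hs_norm2].
by move=> u v; rewrite innerZl innerZr innerC (innerC x v) [RHS]mulrC (innerC u).
Qed.

Lemma is_hsop_symtensor x y :
  (fun h => tensor x y h + tensor y x h) \in hsop_pred e.
Proof.
have [lxy cxy] := tensor_bounded_linear x y.
have [lyx cyx] := tensor_bounded_linear y x.
apply/hsop_predP; split.
- split=> [a u v|u]; first by rewrite lxy lyx scalerDr addrACA.
  by apply: cvgD; [exact: cxy|exact: cyx].
- move=> u v; rewrite innerDl innerDr !innerZl !innerZr.
  rewrite (innerC u) (innerC u) (innerC x v) (innerC y v); ring.
- have := hs_norm2_comb 1 (tensor_hs_norm2 x y) (tensor_hs_norm2 y x).
  by congr (hs_norm2 _ _ < _)%E; apply/funext => h; rewrite scale1r.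
Qed.

Definition tensor2 x : hsop e := HSOp (is_hsop_tensor2 x).

Definition symtensor x y : hsop e := HSOp (is_hsop_symtensor x y).

(* e_{i,i} = e_i (x) e_i and, for i < j,
   e_{i,j} = (e_i (x) e_j + e_j (x) e_i) / sqrt 2. *)
Definition mode (i j : nat) : hsop e :=
  if i == j then tensor2 (e i) else (Num.sqrt 2)^-1 *: symtensor (e i) (e j).

(* The complexification of H is H * H, with (a, b) standing for a + i b, and
   v (x) v = (a (x) a - b (x) b) + i (a (x) b + b (x) a). *)
Definition ctensor2 (v : H * H) : hsop e * hsop e :=
  (tensor2 v.1 - tensor2 v.2, symtensor v.1 v.2).

Definition imaginary : set (H * H) := [set v | v.1 = 0].

End rank_one.

(* [Vd] is an isometric realization of the dual of [V] through [pairing], and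
   [H] is embedded in it by [demb] (H is the pivot space). *)
Record gelfand_triple (R : realType) (V H Vd : hilbertType R) := GelfandTriple {
  emb : V -> H ;
  pairing : Vd -> V -> R ;
  demb : H -> Vd ;
  separable_V : separable V ;
  separable_H : separable H ;
  emb_bounded_linear : bounded_linear emb ;
  emb_inj : injective emb ;
  emb_dense : dense (range emb) ;
  pairing_linear : forall v, scalar (pairing ^~ v) ;
  pairing_scalar : forall g, scalar (pairing g) ;
  pairing_continuous : forall g, continuous (pairing g) ;
  pairing_norm : forall g,
    `|g| = sup [set `|pairing g v| | v in [set v : V | `|v| <= 1]] ;
  pairing_surj : forall l : V -> R, scalar l -> continuous l ->
    exists g, pairing g = l ;
  demb_pairing : forall h v, pairing (demb h) v = inner h (emb v) }.

Section calV.
Context (R : realType) (V H Vd : hilbertType R) (G : gelfand_triple V H Vd).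
Context (e : onb H) (f : onb Vd).

Definition factor_HV (x : H -> H) (x1 : H -> V) : Prop :=
  bounded_linear x1 /\ forall h, emb G (x1 h) = x h.

Definition factor_VdH (x : H -> H) (x2 : Vd -> H) : Prop :=
  bounded_linear x2 /\ forall h, x2 (demb G h) = x h.

(* The squared norm of L_2(V*, H) /\ L_2(H, V), with value +oo outside that
   space. The factorizations are unique when they exist, so the infimum is over
   at most one number. *)
Definition calV_norm2 (x : hsop e) : \bar R :=
  ereal_inf [set r | exists x1 x2, [/\ factor_HV x x1, factor_VdH x x2 &
    r = (hs_norm2 e x1 + hs_norm2 f x2)%E]].

Definition calV : set (hsop e) := [set x | (calV_norm2 x < +oo)%E].

Definition calV_norm (x : hsop e) : R := Num.sqrt (fine (calV_norm2 x)).

End calV.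

Definition borel (T : ptopologicalType) : Type := g_sigma_algebraType (@open T).
HB.instance Definition _ (T : ptopologicalType) :=
  Measurable.copy (borel T) (g_sigma_algebraType (@open T)).

Section cone.
Context (R : realType) (H : innerType R) (e : onb H).

Definition Hplus : set (hsop e) := [set A | forall h, 0 <= inner (A h) h].

Definition Hplus0 : set (hsop e) := Hplus `\ 0.

Definition chi (xi : hsop e) : hsop e := if `|xi| <= 1 then xi else 0.

End cone.

Record vmeasure d (T : measurableType d) (R : realType) (E : innerType R) :=
  VMeasure {
  vm_fun :> set T -> E ;
  vm_fun0 : vm_fun set0 = 0 ;
  vm_sigma_additive : forall F : (set T)^nat, (forall i, measurable (F i)) ->
    trivIset setT F ->
    (fun n => \sum_(0 <= i < n) vm_fun (F i)) @ \oo
      --> vm_fun (\bigcup_n F n) }.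

Section vmeasure_integral.
Context d (T : measurableType d) (R : realType) (E : innerType R).
Context (mu : vmeasure T E).

Definition vm_coord (x : E) : set T -> \bar R := fun A => (inner x (mu A))%:E.

Section vm_coord_charge.
Variable x : E.

Let vm_coord0 : vm_coord x set0 = 0%E.
Proof. by rewrite /vm_coord vm_fun0 inner0r. Qed.

Let vm_coord_fin A : measurable A -> vm_coord x A \is a fin_num.
Proof. by []. Qed.

Let vm_coord_sigma_additive : semi_sigma_additive (vm_coord x).
Proof.
move=> F mF tF _; rewrite /vm_coord.
have -> : (fun n => (\sum_(0 <= i < n) (inner x (mu (F i)))%:E)%E)
    = EFin \o (inner x \o (fun n => \sum_(0 <= i < n) mu (F i))).
  by apply/funext => n /=; rewrite sumEFin inner_sumr.
apply: cvg_EFin; first exact: nearW.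
by apply: cvg_comp (vm_sigma_additive mF tF) _; exact: inner_continuous.
Qed.

HB.instance Definition _ := isCharge.Build d T R (vm_coord x)
  vm_coord0 vm_coord_fin vm_coord_sigma_additive.

End vm_coord_charge.

(* The integral of [g] over [D] with respect to the finite signed measure
   <x, mu(.)>, through its Jordan decomposition; the negative part vanishes
   when <x, mu(.)> is nonnegative. *)
Definition vint (D : set T) (g : T -> \bar R) (x : E) : \bar R :=
  let hd := cid (Hahn_decomposition (vm_coord x)) in
  let PN := projT2 (cid (projT2 hd)) in
  (\int[jordan_pos PN]_(xi in D) g xi - \int[jordan_neg PN]_(xi in D) g xi)%E.

End vmeasure_integral.

(* (b, B, m, mu) together with the operators from which the linear part B is
   built. [m] and [mu] are carried by [Hplus0]; [bigB x y] is the value of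
   the functional B(x) at y. The operator B of the linear part is represented
   both by [opH], defined on [dom_opH], and by its extension [opV] from V to
   V*; [eV i] is the i-th basis vector viewed in V. *)
Record params (R : realType) (V H Vd : hilbertType R)
    (G : gelfand_triple V H Vd) (e : onb H) := Params {
  par_b : hsop e ;
  bigB : hsop e -> hsop e -> R ;
  par_m : {measure set (borel (hsop e)) -> \bar R} ;
  par_mu : vmeasure (borel (hsop e)) (hsop e) ;
  lam : nat -> R ;
  opH : H -> H ;
  opV : V -> Vd ;
  eV : nat -> V ;
  Gam : hsop e -> hsop e }.

Section admissible.
Context (R : realType) (V H Vd : hilbertType R) (G : gelfand_triple V H Vd).
Context (e : onb H) (f : onb Vd) (p : params G e).

Local Notation b := (par_b p).
Local Notation m := (par_m p).
Local Notation mu := (par_mu p).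
Local Notation Hp := (@Hplus R H e).
Local Notation Hp0 := (@Hplus0 R H e).

Record admissible_m : Prop := AdmissibleM {
  m_carrier : m (~` Hp0) = 0%E ;
  m_moment2 : (\int[m]_(xi in Hp0) (`|xi| ^+ 2)%:E < +oo)%E ;
  m_chi : forall h : hsop e,
    (\int[m]_(xi in Hp0) `|inner (chi xi) h|%:E < +oo)%E ;
  m_mean : exists Im : hsop e, forall h,
    inner Im h = \int[m]_(xi in Hp0) inner (chi xi) h }.

Definition admissible_b : Prop := forall v, Hp v ->
  0 <= inner b v - \int[m]_(xi in Hp0) inner (chi xi) v.

(* int <chi(xi), u> |xi|^-2 <x, mu(dxi)> *)
Definition jump_mu (u x : hsop e) : \bar R :=
  vint mu Hp0 (fun xi => (inner (chi xi) u * `|xi| ^- 2)%:E) x.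

Record admissible_mu : Prop := AdmissibleMu {
  mu_carrier : mu (~` Hp0) = 0 ;
  mu_Hplus : forall A, measurable A -> Hp (mu A) ;
  mu_orth : forall u x, Hp u -> Hp x -> inner u x = 0 ->
    (jump_mu u x < +oo)%E }.

Definition dom_opH : set H :=
  [set h | (\sum_(0 <= i <oo) (lam p i ^+ 2 * inner h (e i) ^+ 2)%:E < +oo)%E].

Record admissible_op : Prop := AdmissibleOp {
  opH_linear : forall a x y, dom_opH x -> dom_opH y ->
    opH p (a *: x + y) = a *: opH p x + opH p y ;
  (* opH and its Hilbert space adjoint have the same graph *)
  opH_selfadjoint : forall y z,
    (forall x, dom_opH x -> inner (opH p x) y = inner x z)
    <-> dom_opH y /\ z = opH p y ;
  opH_nonpos : forall x, dom_opH x -> inner (opH p x) x <= 0 ;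
  opV_bounded_linear : bounded_linear (opV p) ;
  opV_opH : forall v, dom_opH (emb G v) -> opV p v = demb G (opH p (emb G v)) ;
  opH_eigen : forall i, opH p (e i) = - lam p i *: e i ;
  lam_ge0 : 0 <= lam p 0%N ;
  lam_nondecreasing : nondecreasing_seq (lam p) ;
  lam_dvg : lam p @ \oo --> +oo }.

Record admissible_Gam : Prop := AdmissibleGam {
  Gam_bounded_linear : bounded_linear (Gam p) ;
  Gam_Hplus : forall x, Hp x -> Hp (Gam p x) ;
  Gam_orth : forall x u, Hp x -> Hp u -> inner u x = 0 ->
    (0 <= (inner (Gam p x) u)%:E - jump_mu u x)%E }.

Record admissible_V : Prop := AdmissibleV {
  opV_coercive : exists a0 a1 kappa, [/\ 0 < a0, 0 < a1, 0 <= kappa &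
    forall u : V,
      a0 * `|u| ^+ 2 <= - 2 * pairing G (opV p u) u + kappa * `|emb G u| ^+ 2
      /\ - 2 * pairing G (opV p u) u + kappa * `|emb G u| ^+ 2 <= a1 * `|u| ^+ 2] ;
  eV_emb : forall i, emb G (eV p i) = e i ;
  eV_total : dense (lin_span (eV p)) ;
  V_norm_equiv : exists c1 c2, [/\ 0 < c1, 0 < c2 & forall u : V,
    let q := (\sum_(0 <= i <oo)
      ((1 + lam p i) * inner (emb G u) (e i) ^+ 2)%:E)%E in
    ((c1 * `|u| ^+ 2)%:E <= q)%E /\ (q <= (c2 * `|u| ^+ 2)%:E)%E] }.

(* B(x) = B x + x B* + Gam(x) as a bounded map from calV to its dual; since Gam
   acts on self-adjoint operators, x and y range over the self-adjoint ones. The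
   duality extends <A, C> = \sum_n <A e_n, C e_n>_H: for x = emb \o x1 and
   y = emb \o y1 the first term is paired in V* x V, and for x = x2 \o demb
   the operator x B* is x2 \o opV, defined on V, evaluated at the e_n. *)
Record admissible_B : Prop := AdmissibleB {
  bigB_linear : forall a x x' y, calV G f x -> calV G f x' -> calV G f y ->
    bigB p (a *: x + x') y = a * bigB p x y + bigB p x' y ;
  bigB_scalar : forall a x y y', calV G f x -> calV G f y -> calV G f y' ->
    bigB p x (a *: y + y') = a * bigB p x y + bigB p x y' ;
  bigB_bounded : exists C, forall x y, calV G f x -> calV G f y ->
    `|bigB p x y| <= C * calV_norm G f x * calV_norm G f y ;
  bigBE : forall (x y : hsop e) x1 x2 y1, calV G f x -> calV G f y ->
    factor_HV G x x1 -> factor_VdH G x x2 -> factor_HV G y y1 ->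
    bigB p x y =
      limn (series (fun n => pairing G (opV p (x1 (e n))) (y1 (e n))))
      + limn (series (fun n => inner (x2 (opV p (eV p n))) (y (e n))))
      + inner (Gam p x) y }.

Definition admissible : Prop :=
  [/\ admissible_m, admissible_b, admissible_mu &
   [/\ admissible_op, admissible_Gam, admissible_V & admissible_B]].

Record assumptionC : Prop := AssumptionC {
  b_calV : calV G f b ;
  Gam_calV : exists C, forall x, calV G f x ->
    calV G f (Gam p x) /\ calV_norm G f (Gam p x) <= C * calV_norm G f x ;
  m_calV : (\int[m]_(xi in Hp0) calV_norm2 G f xi < +oo)%E ;
  mu_calV : exists C : R, forall y, calV G f y -> Hp y ->
    (vint mu Hp0 (fun xi => calV_norm2 G f xi * (`|xi| ^- 2)%:E) y
     <= C%:E * (1 + calV_norm2 G f y))%E }.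

Definition jump_kernel (u xi : hsop e) : R :=
  expR (- inner xi u) - 1 + inner (chi xi) u.

Definition riccatiF (u : hsop e) : R :=
  inner b u - \int[m]_(xi in Hp0) jump_kernel u xi.

(* The H-valued integral against mu is defined weakly; <Gam^*(u), x> is
   <u, Gam(x)>. *)
Definition riccatiR (u : hsop e) : hsop e :=
  xget 0 [set r | forall x,
    (inner r x)%:E = ((inner u (Gam p x))%:E
      - vint mu Hp0 (fun xi => (jump_kernel u xi * `|xi| ^- 2)%:E) x)%E].

End admissible.

Definition C0_semigroup (R : realType) (E : normedModType R)
    (S : R -> E -> E) : Prop :=
  [/\ forall x, S 0 x = x,
      forall (s t : R) x, 0 <= s -> 0 <= t -> S (s + t) x = S s (S t x),
      forall t : R, 0 <= t -> bounded_linear (S t) &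
      forall x, {within `[0, +oo[, continuous (S ^~ x)}].

Definition mode_semigroup (R : realType) (H : innerType R) (e : onb H)
    (lam : nat -> R) (T : R -> hsop e -> hsop e) : Prop :=
  C0_semigroup T /\
  forall (t : R) i j, 0 <= t -> (i <= j)%N ->
    T t (mode e i j) = expR (- (lam i + lam j) * t) *: mode e i j.

Definition adjoint_family (R : realType) (H : innerType R)
    (S Sadj : R -> H -> H) : Prop :=
  forall (t : R) x y, 0 <= t -> inner (Sadj t x) y = inner x (S t y).

(* [r] is the Bochner integral of [g] over [D]; in a separable Hilbert space
   strong and weak measurability agree and the integral is determined by its
   inner products. *)
Definition is_bochner (R : realType) (E : innerType R) (D : set R)
    (g : R -> E) (r : E) : Prop :=
  [/\ measurable_fun D (g : R -> borel E),
      (\int[lebesgue_measure]_(s in D) `|g s|%:E < +oo)%E &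
      forall h, inner r h = \int[lebesgue_measure]_(s in D) inner (g s) h].

Definition mild_solution (R : realType) (H : innerType R) (e : onb H)
    (T : R -> hsop e -> hsop e) (N : R -> hsop e -> hsop e) (u : hsop e)
    (psi : R -> hsop e) : Prop :=
  [/\ {within `[0, +oo[, continuous psi},
      forall t : R, 0 <= t -> Hplus (psi t) &
      forall t : R, 0 <= t ->
        is_bochner `[0, t] (fun s => T (t - s) (N s (psi s))) (psi t - T t u)].

Section riccati.
Context (R : realType) (V H Vd : hilbertType R) (G : gelfand_triple V H Vd).
Context (e : onb H) (p : params G e) (T : R -> hsop e -> hsop e).

Definition riccati_solution (u : hsop e) (phi : R -> R) (psi : R -> hsop e) :
    Prop :=
  mild_solution T (fun=> riccatiR p) u psi /\
  forall t : R, 0 <= t ->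
    phi t = \int[lebesgue_measure]_(s in `[0, t]) riccatiF p (psi s).

Definition joint_riccatiR (h : H * H) (v : hsop e) : hsop e :=
  riccatiR p v - 2^-1 *: (ctensor2 e h).1.

Definition joint_riccati_solution (Sadj : R -> H -> H) (u : (H * H) * hsop e)
    (Phi : R -> R) (psi1 : R -> H * H) (psi2 : R -> hsop e) : Prop :=
  [/\ forall t : R, 0 <= t -> psi1 t = (Sadj t u.1.1, Sadj t u.1.2),
      mild_solution T (fun s v => joint_riccatiR (psi1 s) v) u.2 psi2 &
      forall t : R, 0 <= t ->
        Phi t = \int[lebesgue_measure]_(s in `[0, t]) riccatiF p (psi2 s)].

End riccati.

Definition cadlag (R : realType) (E : ptopologicalType) (x : R -> E) : Prop :=
  (forall t : R, 0 <= t -> x @ t^'+ --> x t) /\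
  (forall t : R, 0 < t -> cvg (x @ t^'-)).

Definition natural_filtration (R : realType) (E : ptopologicalType) (Om : Type)
    (X : R -> Om -> E) (s : R) : set (set Om) :=
  <<s [set A | exists (r : R) (B : set (borel E)),
         [/\ 0 <= r <= s, measurable B & A = X r @^-1` B]] >>.

Definition augmented_filtration d (Om : measurableType d) (R : realType)
    (P : probability Om R) (F : R -> set (set Om)) (s : R) : set (set Om) :=
  <<s F s `|` [set N | P.-negligible N] >>.

(* Martingales on [0, t]; the last clause says that M_s is the conditional
   expectation of M_s' given F_s. Sets of F_s may differ from measurable sets by
   P-negligible ones, which changes neither integral. *)
Definition martingale_on d (Om : measurableType d) (R : realType)
    (P : probability Om R) (F : R -> set (set Om)) (t : R)
    (M : R -> Om -> R) : Prop :=
  [/\ forall s : R, 0 <= s <= t -> forall B : set R, measurable B ->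
        F s (M s @^-1` B),
      forall s : R, 0 <= s <= t -> (\int[P]_w `|M s w|%:E < +oo)%E &
      forall s s' : R, 0 <= s -> s <= s' -> s' <= t -> forall A, F s A ->
        (\int[P]_(w in A) (M s' w)%:E = \int[P]_(w in A) (M s w)%:E)%E].

Record affine_process d (Om : measurableType d) (R : realType)
    (H : innerType R) (e : onb H)
    (phi : R -> hsop e -> R) (psi : R -> hsop e -> hsop e)
    (X : R -> Om -> hsop e) (P : hsop e -> probability Om R) : Prop :=
  AffineProcess {
  X_measurable : forall t : R, 0 <= t ->
    measurable_fun setT (X t : Om -> borel (hsop e)) ;
  X_Hplus : forall (t : R) w, 0 <= t -> Hplus (X t w) ;
  X_cadlag : forall w, cadlag (X ^~ w) ;
  X_start : forall x, Hplus x -> P x [set w | X 0 w = x] = 1%E ;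
  X_kernel : forall (t : R) (B : set (borel (hsop e))), 0 <= t -> measurable B ->
    measurable_fun (@Hplus R H e : set (borel (hsop e)))
      (fun x => P x (X t @^-1` B)) ;
  X_markov : forall x (s t : R) A (B : set (borel (hsop e))), Hplus x ->
    0 <= s -> 0 <= t -> natural_filtration X s A -> measurable B ->
    P x (A `&` X (s + t) @^-1` B)
      = (\int[P x]_(w in A) P (X s w) (X t @^-1` B))%E ;
  X_laplace : forall x (t : R) u, Hplus x -> 0 <= t -> Hplus u ->
    (\int[P x]_w (expR (- inner (X t w) u))%:E
      = (expR (- phi t u - inner x (psi t u)))%:E)%E }.

(* Main.v *)
Require Import Defs.
From HB Require Import structures.
From mathcomp Require Import all_boot all_order all_algebra.
From mathcomp Require Import all_classical all_reals all_analysis.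
From mathcomp Require Import measurable_realfun.
From mathcomp Require Import ring lra.

Set Implicit Arguments.
Unset Strict Implicit.
Unset Printing Implicit Defensive.

Import Order.TTheory GRing.Theory Num.Theory.
Import numFieldNormedType.Exports.

Local Open Scope classical_set_scope.
Local Open Scope ring_scope.

(* For u_1 in iH the operators -(psi_1(r) (x) psi_1(r)) =: g(r) are nonnegative,
   so M_s = exp(-1/2 int_0^s <X_r, g(t-r)> dr) exp(-Phi(t-s) - <X_s, psi_2(t-s)>)
   is bounded. On a grid s_0 < ... < s_n of [s, s'] with mesh h, the Markov property
   and the affine transform formula make
     D_k = M_s0 exp(- sum_{j<k} (<X_{s_j}, a_j> + beta_j))
           exp(-Phi(t-s_k) + Phi(t-s_0) - <X_{s_k}, w_k> + <X_{s_0}, w_0>),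
   w_k = psi_2(t-s_k), a_j = w_j - psi(h, w_{j+1}),
   beta_j = Phi(t-s_j) - Phi(t-s_{j+1}) - phi(h, w_{j+1}), an exact discrete
   martingale, and the Riccati equations give a_j = (h/2) g(t-s_j) + O(eps h),
   beta_j = O(eps h). As <X_{s_j}, a_j> may be negative, D_k is damped by
   exp(-2 eps h sum_{j<k} |X_{s_j}|); this keeps it bounded, and the resulting loss of
   expectation telescopes to a quantity that vanishes with the mesh, while D_n
   converges pathwise to M_{s'}. *)

(** * Hilbert space preliminaries *)

(** Two facts shape the argument. The only information on the law of X is its Markov property and
    its Laplace transform at one time, so the exponential of an integral functional must be built
    from one-time exponentials; this forces the grid. And psi_2 is only a mild solution, so it
    cannot be differentiated in time. In a_j both w_j and psi(h, w_{j+1}) start from w_{j+1} and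
    contain the same vector T(h) w_{j+1}: it cancels, and what is left is an integral over one step
    of locally Lipschitz functions, so the unbounded linear part never has to be evaluated. The
    factor 2 in the damping has a purpose. One copy offsets the possibly negative error in a_j; the
    other makes D_k at most C e^{-S_k}, where S_k = eps h sum_{j<k} |X_{s_j}|, and it is this decay
    that lets the losses of the single steps be summed. That the total loss vanishes follows by
    bounded convergence, since each càdlàg path is bounded on [0, t]. All signs come from one fact:
    two positive Hilbert-Schmidt operators have a nonnegative inner product. It is reduced to finite
    matrices. *)

Lemma cvgn_le_cst (R : realType) (f : nat -> R) (a b : R) :
  f @ \oo --> a -> (forall n, f n <= b) -> a <= b.
Proof. by move=> fa fb; apply: (cvgr_to_le fa); exact: nearW. Qed.

Lemma cvgn_ge_cst (R : realType) (f : nat -> R) (a b : R) :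
  f @ \oo --> a -> (forall n, b <= f n) -> b <= a.
Proof. by move=> fa fb; apply: (cvgr_to_ge fa); exact: nearW. Qed.

Section bounded_linear.
Context (R : realType) (V W : normedModType R).

Lemma bounded_linear_bound (A : V -> W) : bounded_linear A ->
  exists2 C, 0 < C & forall x, `|A x| <= C * `|x|.
Proof.
move=> [lA cA].
pose f : {linear V -> W} := HB.pack A (GRing.isLinear.Build _ _ _ _ A lA).
have /linear_boundedP/pinfty_ex_gt0[C C0 fC] :
  bounded_near f (nbhs (0 : V)) by apply/linear_bounded_continuous; exact: cA.
by exists C.
Qed.

Lemma bound_bounded_linear (A : V -> W) (C : R) : linear A ->
  (forall x, `|A x| <= C * `|x|) -> bounded_linear A.
Proof.
move=> lA AC; split=> //.
pose f : {linear V -> W} := HB.pack A (GRing.isLinear.Build _ _ _ _ A lA).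
apply: (@bounded_linear_continuous _ _ _ f); apply/linear_boundedP.
near=> r => x; apply: (le_trans (AC x)); exact: ler_wpM2r.
Unshelve. all: by end_near. Qed.

Lemma bounded_linear0 (A : V -> W) : bounded_linear A -> A 0 = 0.
Proof.
by move=> [lA _]; have := lA (-1) 0 0; rewrite scaler0 add0r scaleN1r addNr.
Qed.

Lemma bounded_linearB (A : V -> W) x y : bounded_linear A -> A (x - y) = A x - A y.
Proof.
by move=> [lA _]; rewrite addrC -scaleN1r lA scaleN1r addrC.
Qed.

End bounded_linear.

Section inner_more.
Context (R : realType) (V : innerType R).
Implicit Types x y z : V.

Lemma innerNl x y : inner (- x) y = - inner x y.
Proof. by rewrite -scaleN1r innerZl mulN1r. Qed.

Lemma innerNr x y : inner x (- y) = - inner x y.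
Proof. by rewrite innerC innerNl innerC. Qed.

Lemma innerBl x y z : inner (x - y) z = inner x z - inner y z.
Proof. by rewrite innerDl innerNl. Qed.

Lemma normD_sqr x y : `|x + y| ^+ 2 = `|x| ^+ 2 + 2 * inner x y + `|y| ^+ 2.
Proof.
by rewrite -!innerxx innerDl !innerDr (innerC y x); ring.
Qed.

Lemma inner_ext x y : (forall z, inner x z = inner y z) -> x = y.
Proof.
move=> xy; apply/eqP; rewrite -subr_eq0 -normr_eq0 -sqrf_eq0 -innerxx innerBl.
by rewrite xy subrr.
Qed.

Lemma norm_le_inner x (C : R) : 0 <= C ->
  (forall z, inner x z <= C * `|z|) -> `|x| <= C.
Proof.
move=> C0 /(_ x); rewrite innerxx expr2.
have [->|x0] := eqVneq x 0; first by rewrite normr0.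
by rewrite ler_pM2r// normr_gt0.
Qed.

Lemma inner_cvg (I : Type) (F : set_system I) {FF : Filter F}
    (a b : I -> V) (x y : V) :
  a @ F --> x -> b @ F --> y -> (fun i => inner (a i) (b i)) @ F --> inner x y.
Proof.
move=> ax by_.
have E i : inner (a i) (b i) =
    2^-1 * (`|a i + b i| ^+ 2 - `|a i| ^+ 2 - `|b i| ^+ 2).
  by rewrite normD_sqr; field.
have -> : (fun i => inner (a i) (b i)) =
  (fun i => 2^-1 * (`|a i + b i| ^+ 2 - `|a i| ^+ 2 - `|b i| ^+ 2)).
  exact/funext.
have -> : inner x y = 2^-1 * (`|x + y| ^+ 2 - `|x| ^+ 2 - `|y| ^+ 2).
  by rewrite normD_sqr; field.
have cvg2 (c : I -> V) z : c @ F --> z -> (fun i => `|c i| ^+ 2) @ F --> `|z| ^+ 2.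
  by move=> cz; rewrite !expr2; apply: cvgM; exact: cvg_norm.
apply: cvgM; first exact: cvg_cst.
by do 2 (apply: cvgB; last exact: cvg2); apply: cvg2; exact: cvgD.
Qed.

End inner_more.

(** * Riesz representation and closed subspaces *)

Section riesz.
Context (R : realType) (V : hilbertType R).

(** Direct method: a minimiser of J(x) = |x|^2 - 2 l(x) over the closed subspace [E] represents [l]
    there. A general [E] is allowed so that [l = inner x] yields the orthogonal projection. *)
Lemma riesz_closed (E : set V) (l : V -> R) (C : R) :
  E 0 -> (forall a x y, E x -> E y -> E (a *: x + y)) -> closed E ->
  scalar l -> (forall x, `|l x| <= C * `|x|) ->
  exists2 r, E r & forall y, E y -> inner r y = l y.
Proof.
move=> E0 Elin Ecl lin_l lC.
have l0 : l 0 = 0 by have := lin_l (-1) 0 0; rewrite scaler0 addr0; lra.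
have lD x y : l (x + y) = l x + l y by rewrite -[x]scale1r lin_l scale1r mul1r.
have lZ a x : l (a *: x) = a * l x by rewrite -[a *: x]addr0 lin_l l0 addr0.
have ED x y : E x -> E y -> E (x + y).
  by move=> Ex Ey; rewrite -[x]scale1r; exact: Elin.
have EZ a x : E x -> E (a *: x) by move=> Ex; rewrite -[_ *: _]addr0; exact: Elin.
pose J (x : V) : R := `|x| ^+ 2 - 2 * l x.
pose S := [set J x | x in E].
have Slb : lbound S (- C ^+ 2).
  move=> _ [x _ <-]; rewrite /J; have := lC x => /(le_trans (ler_norm _)).
  have := sqr_ge0 (`|x| - C); nra.
have Si : has_inf S by split; [exists (J 0); exists 0|exists (- C ^+ 2)].
set m := inf S.
have Jm x : E x -> m <= J x by move=> Ex; apply: ge_inf; [exact: Si.2|exists x].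
have /choice[x xP] : forall n : nat, exists x, E x /\ J x < m + n.+1%:R^-1.
  move=> n; have [_ [x Ex <-] xm] := @inf_adherent _ S n.+1%:R^-1 (ltac:(by [])) Si.
  by exists x.
(* Parallelogram identity at the midpoint: two near-minimisers of [J] are close, so the minimising
   sequence is Cauchy. *)
have par a b : E a -> E b ->
    `|a - b| ^+ 2 <= 2 * (J a - m) + 2 * (J b - m).
  move=> Ea Eb; have := Jm (2^-1 *: (a + b)) (EZ _ _ (ED _ _ Ea Eb)).
  rewrite /J lZ lD normrZ exprMn (normD_sqr a (- b)) normD_sqr innerNr normrN.
  by rewrite ger0_norm//; lra.
have xcau : cauchy (x @ \oo).
  apply/cauchyP => e e0.
  have e4 : 0 < e ^+ 2 / 4 by rewrite divr_gt0// exprn_gt0.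
  near \oo => n0; exists (x n0).
  suff : \forall n \near \oo, ball (x n0) e (x n) by [].
  near=> n.
  rewrite -ball_normE /ball_/=.
  rewrite -(ltr_pXn2r (n := 2)) ?nnegrE ?(ltW e0)//.
  apply: le_lt_trans (par _ _ (xP _).1 (xP _).1) _.
  have := (xP n).2; have := (xP n0).2.
  have : n.+1%:R^-1 < e ^+ 2 / 4.
    by near: n; exact: (near_infty_natSinv_lt (PosNum e4)).
  have : n0.+1%:R^-1 < e ^+ 2 / 4.
    by near: n0; exact: (near_infty_natSinv_lt (PosNum e4)).
  by move: (n.+1%:R^-1) (n0.+1%:R^-1) => p q; lra.
have /cvg_ex[r xr] : cvg (x @ \oo) by exact: cauchy_cvg.
have Er : E r.
  have nE : \forall n \near \oo, E (x n) by apply: nearW => n; exact: (xP n).1.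
  exact: (@closed_cvg _ _ \oo _ x E Ecl nE r xr).
have lcvg : (l \o x) @ \oo --> l r.
  apply/cvgrPdist_le => e e0; near=> n.
  have -> : l r - (l \o x) n = l (r - x n).
    by rewrite lD -[in RHS]scaleN1r lZ mulN1r.
  apply: le_trans (lC _) _.
  have C1 : 0 < `|C| + 1 by rewrite ltr_wpDl.
  apply: (@le_trans _ _ ((`|C| + 1) * `|r - x n|)).
    by rewrite ler_wpM2r// (le_trans (ler_norm _))// lerDl.
  rewrite -ler_pdivlMl//; near: n.
  by move/cvgrPdist_le : xr; apply; rewrite mulr_gt0// invr_gt0.
have Jcvg : (J \o x) @ \oo --> J r.
  apply: cvgB; last by apply: cvgM => //; exact: cvg_cst.
  by rewrite expr2; under eq_fun do rewrite expr2; apply: cvgM; exact: cvg_norm.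
have Jr : J r <= m.
  apply/ler_addgt0Pr => e e0.
  apply: (cvgr_to_le Jcvg).
  near=> n; have /ltW/le_trans := (xP n).2; apply; rewrite lerD2l.
  by apply/ltW; near: n; exact: (near_infty_natSinv_lt (PosNum e0)).
exists r => // y Ey.
set B := inner r y - l y; set A := `|y| ^+ 2.
have A0 : 0 <= A by rewrite sqr_ge0.
have A1 : 0 < A + 1 by rewrite ltr_wpDl.
(* Moving by s y changes [J] by 2 s B + s^2 A. The optimal s would be -B / A; the [+ 1] keeps the
   denominator positive when y = 0, and the step still forces B = 0. *)
have := Jm (r + (- B / (A + 1)) *: y) (ED _ _ Er (EZ _ _ Ey)).
move=> /(le_trans Jr); rewrite /J normD_sqr lD lZ innerZr normrZ exprMn.
rewrite real_normK ?num_real// -/A => h.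
have {}h : 0 <= B ^+ 2 * (A - 2 * (A + 1)) / (A + 1) ^+ 2.
  have -> : B ^+ 2 * (A - 2 * (A + 1)) / (A + 1) ^+ 2 =
    2 * (- B / (A + 1)) * (inner r y - l y) + (- B / (A + 1)) ^+ 2 * A.
    by rewrite -/B; field; rewrite gt_eqF.
  by lra.
have B0 : B ^+ 2 <= 0.
  rewrite leNgt; apply/negP => B0; move: h; apply/negP; rewrite -ltNge.
  rewrite pmulr_llt0 ?invr_gt0 ?exprn_gt0//.
  by rewrite pmulr_rlt0//; lra.
have /eqP : B ^+ 2 = 0 by apply/eqP; rewrite eq_le B0 sqr_ge0.
by rewrite sqrf_eq0 subr_eq0 => /eqP.
Unshelve. all: by end_near. Qed.

Lemma riesz (l : V -> R) (C : R) :
  scalar l -> (forall x, `|l x| <= C * `|x|) ->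
  exists r, forall y, inner r y = l y.
Proof.
move=> ll lC.
have [//|//||r _ rl] := @riesz_closed setT l C _ _ _ ll lC.
  exact: closedT.
by exists r => y; exact: rl.
Qed.

(** Subtracting from x its projection on [E] leaves a vector orthogonal to [E]. This is how strong
    continuity of the adjoint semigroup spreads from a subspace to the whole space. *)
Lemma closed_subspace_total (E : set V) :
  E 0 -> (forall a x y, E x -> E y -> E (a *: x + y)) -> closed E ->
  (forall z, (forall y, E y -> inner z y = 0) -> z = 0) -> E = setT.
Proof.
move=> E0 El Ec Et; rewrite -subTset => x _.
have [||r Er rx] := @riesz_closed E (inner x) `|x| E0 El Ec.
- by move=> a y z; rewrite innerDr innerZr.
- by move=> y; exact: cauchy_schwarz.
suff /eqP : x - r = 0 by rewrite subr_eq0 => /eqP ->.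
by apply: Et => y Ey; rewrite innerBl rx// subrr.
Qed.

End riesz.

(** * The cone of positive Hilbert-Schmidt operators *)

Section psd.
Context (R : realType).

(* Schur complement with respect to the last index. *)
Lemma psd_sum_ge0 (N : nat) (A C : nat -> nat -> R) :
  (forall i j, A i j = A j i) ->
  (forall c : nat -> R, 0 <= \sum_(i < N) \sum_(j < N) c i * c j * A i j) ->
  (forall c : nat -> R, 0 <= \sum_(i < N) \sum_(j < N) c i * c j * C i j) ->
  0 <= \sum_(i < N) \sum_(j < N) A i j * C i j.
Proof.
elim: N A => [|N ih] A sA pA pC; first by rewrite big_ord0.
have split_sum (F : nat -> nat -> R) : \sum_(i < N.+1) \sum_(j < N.+1) F i j =
    \sum_(i < N) \sum_(j < N) F i j + \sum_(i < N) F i N +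
    \sum_(j < N) F N j + F N N.
  rewrite big_ord_recr/= big_ord_recr/= -[RHS]addrA; congr (_ + _).
  by rewrite -big_split; apply: eq_bigr => i _; rewrite big_ord_recr.
pose ext (c : nat -> R) (s : R) i := if (i < N)%N then c i else s.
have extE c s (i : 'I_N) : ext c s i = c i by rewrite /ext ltn_ord.
have extN c s : ext c s N = s by rewrite /ext ltnn.
have qE c s : \sum_(i < N.+1) \sum_(j < N.+1) ext c s i * ext c s j * A i j =
    \sum_(i < N) \sum_(j < N) c i * c j * A i j +
    2 * s * \sum_(i < N) c i * A i N + s ^+ 2 * A N N.
  rewrite (split_sum (fun i j => ext c s i * ext c s j * A i j)) extN -expr2.
  congr (_ + _).
  rewrite -addrA; congr (_ + _).
    by apply: eq_bigr => i _; apply: eq_bigr => j _; rewrite !extE.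
  rewrite mulr_sumr -big_split/=; apply: eq_bigr => i _.
  by rewrite extE (sA N i); ring.
have pCN (c : nat -> R) : 0 <= \sum_(i < N) \sum_(j < N) c i * c j * C i j.
  have := pC (ext c 0).
  rewrite (split_sum (fun i j => ext c 0 i * ext c 0 j * C i j)) extN.
  congr (0 <= _).
  rewrite [X in _ + X + _]big1 ?[X in _ + X + _ + _]big1; last 2 first.
  - by move=> i _; rewrite mulr0 mul0r.
  - by move=> i _; rewrite !mul0r.
  rewrite !mul0r !addr0.
  by apply: eq_bigr => i _; apply: eq_bigr => j _; rewrite !extE.
have ANN : 0 <= A N N.
  have := pA (ext (fun=> 0) 1); rewrite qE !big1 => [|i _|i _]; last 2 first.
  - by rewrite mul0r.
  - by rewrite big1// => j _; rewrite !mul0r.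
  by rewrite mulr0 !add0r expr1n mul1r.
have [A0|A0] := eqVneq (A N N) 0.
  (* With a zero last diagonal entry the form is affine in the last coordinate; if [A i N] were
     nonzero, the coordinate chosen below would give the value -1. *)
  have AiN (i : 'I_N) : A i N = 0.
    apply/eqP; apply: contraT => AiN0.
    pose c (k : nat) : R := (k == i)%:R.
    have S1 : \sum_(k < N) c k * A k N = A i N.
      rewrite (bigD1 i)//= /c eqxx mul1r big1 ?addr0// => k ki.
      by rewrite (_ : (_ == _) = false) ?mul0r//; apply/negbTE.
    have := pA (ext c (- (\sum_(k < N) \sum_(j < N) c k * c j * A k j + 1)
                       / (2 * A i N))).
    rewrite qE S1 A0 mulr0 addr0.
    set q := (X in X + _).
    have -> : q + 2 * (- (q + 1) / (2 * A i N)) * A i N = - 1 by field.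
    by rewrite ler0N1.
  rewrite (split_sum (fun i j => A i j * C i j)) A0 mul0r addr0.
  rewrite [X in _ + X + _]big1 ?[X in _ + X]big1 ?addr0; last 2 first.
  - by move=> i _; rewrite sA AiN mul0r.
  - by move=> i _; rewrite AiN mul0r.
  apply: ih => // c; have := pA (ext c 0).
  by rewrite qE mulr0 mul0r expr0n mul0r !addr0.
have Apos : 0 < A N N by rewrite lt_neqAle eq_sym A0.
pose A' i j := A i j - A i N * A j N / A N N.
have := ih A' _ _ pCN.
have -> : \sum_(i < N.+1) \sum_(j < N.+1) A i j * C i j =
    \sum_(i < N) \sum_(j < N) A' i j * C i j +
    \sum_(i < N.+1) \sum_(j < N.+1) A i N * A j N * C i j / A N N.
  rewrite (split_sum (fun i j => A i j * C i j)).
  rewrite (split_sum (fun i j => A i N * A j N * C i j / A N N)).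
  rewrite !addrA; congr (_ + _ + _ + _).
  - rewrite -big_split/=; apply: eq_bigr => i _; rewrite -big_split/=.
    by apply: eq_bigr => j _; rewrite /A'; ring.
  - by apply: eq_bigr => i _; field.
  - by apply: eq_bigr => i _; rewrite (sA N i); field.
  - by field.
(* The Schur complement falls to the induction hypothesis; the rank-one remainder is the form of [C]
   at the last column of [A], divided by the pivot. *)
move=> h; apply: addr_ge0.
  apply: h => [i j|c]; first by rewrite /A' sA (mulrC (A i N)).
  (* The last coordinate that minimises the form of [A]; the minimum is the form of the Schur
     complement. *)
  pose s := - (\sum_(i < N) c i * A i N) / A N N.
  have := pA (ext c s); rewrite qE.
  congr (0 <= _).
  have -> : \sum_(i < N) \sum_(j < N) c i * c j * A' i j =
      \sum_(i < N) \sum_(j < N) c i * c j * A i j -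
      (\sum_(i < N) c i * A i N) ^+ 2 / A N N.
    rewrite expr2 mulr_suml mulr_suml -sumrB; apply: eq_bigr => i _.
    rewrite mulr_sumr mulr_suml -sumrB; apply: eq_bigr => j _.
    by rewrite /A'; ring.
  by rewrite /s; field.
have -> : \sum_(i < N.+1) \sum_(j < N.+1) A i N * A j N * C i j / A N N =
    (\sum_(i < N.+1) \sum_(j < N.+1) A i N * A j N * C i j) / A N N.
  by rewrite mulr_suml; apply: eq_bigr => i _; rewrite mulr_suml.
by rewrite divr_ge0//; exact: (pC (A ^~ N)).
Qed.

End psd.

Section parseval.
Context (R : realType) (H : innerType R) (e : onb H).

(** The approximant y lies in the span of the first N basis vectors, so the right side minus the
    left is exactly the sum over i < N of <x - y, e_i>^2. *)
Lemma best_approx (x : H) (n N : nat) (c : nat -> R) : (n <= N)%N ->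
  `|x| ^+ 2 - \sum_(0 <= i < N) inner x (e i) ^+ 2
  <= `|x - \sum_(0 <= i < n) c i *: e i| ^+ 2.
Proof.
move=> nN; set y := \sum_(0 <= i < n) _.
have ye i : inner y (e i) = if (i < n)%N then c i else 0.
  rewrite innerC /y inner_sumr; under eq_bigr do rewrite innerZr basis_orthonormal.
  case: ifPn => i_n.
    rewrite (bigD1_seq i) ?iota_uniq ?mem_index_iota//= eqxx mulr1 big1 ?addr0//.
    by move=> j; rewrite eq_sym => /negbTE ->; rewrite mulr0.
  rewrite big_nat big1// => j /andP[_ jn]; rewrite (_ : (i == j) = false) ?mulr0//.
  by apply: contraNF i_n => /eqP ->.
have : 0 <= \sum_(0 <= i < N) inner (x - y) (e i) ^+ 2.
  by apply: sumr_ge0 => i _; exact: sqr_ge0.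
have -> : \sum_(0 <= i < N) inner (x - y) (e i) ^+ 2 =
    \sum_(0 <= i < N) inner x (e i) ^+ 2 -
    2 * \sum_(0 <= i < N) inner x (e i) * inner y (e i) +
    \sum_(0 <= i < N) inner y (e i) ^+ 2.
  rewrite mulr_sumr -sumrB -big_split/=; apply: eq_bigr => i _.
  by rewrite innerBl; ring.
have h (F : nat -> R) : \sum_(0 <= i < N) F i * inner y (e i) =
    \sum_(0 <= i < n) F i * c i.
  rewrite (big_cat_nat (n := n))//= [X in _ + X]big_nat [X in _ + X]big1 ?addr0.
    by apply: eq_big_nat => i /andP[_ i_n]; rewrite ye i_n.
  by move=> i /andP[ni _]; rewrite ye ltnNge ni mulr0.
have -> : \sum_(0 <= i < N) inner x (e i) * inner y (e i) = inner x y.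
  rewrite h /y inner_sumr; apply: eq_bigr => i _; rewrite innerZr; ring.
have -> : \sum_(0 <= i < N) inner y (e i) ^+ 2 = `|y| ^+ 2.
  under eq_bigr do rewrite expr2.
  rewrite h -innerxx {3}/y inner_sumr; apply: eq_bigr => i _; rewrite innerZr; ring.
rewrite normD_sqr innerNr normrN; lra.
Qed.

Lemma parseval (x : H) :
  (fun n => \sum_(0 <= i < n) inner x (e i) ^+ 2) @ \oo --> `|x| ^+ 2.
Proof.
apply/cvgrPdist_le => eps eps0.
pose d := Num.sqrt eps; have d0 : 0 < d by rewrite sqrtr_gt0.
have [y [/= xy [n [c yE]]]] : ball x d `&` lin_span e !=set0.
  apply: basis_total; last exact: ball_open.
  by exists x; exact: ballxx.
near=> N.
rewrite ger0_norm; last by rewrite subr_ge0 bessel.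
apply: le_trans (@best_approx x n N c _) _.
  by near: N; exact: nbhs_infty_ge.
rewrite -yE -(sqr_sqrtr (ltW eps0)) ler_pXn2r ?nnegrE ?sqrtr_ge0//.
by move: xy; rewrite -ball_normE/= => /ltW.
Unshelve. all: by end_near. Qed.

End parseval.

Section cone_inner.
Context (R : realType) (H : innerType R) (e : onb H).
Implicit Types A C : hsop e.

Let ent A (i j : nat) := inner (A (e i)) (e j).
Let q N A := \sum_(0 <= i < N) \sum_(0 <= j < N) ent A i j ^+ 2.

Lemma hsop_sym A x y : inner (A x) y = inner x (A y).
Proof. by have /hsop_predP[_ sA _] := hsop_funP A. Qed.

(** Square truncations replace the row sums that define the norm because they are the finite
    matrices to which [psd_sum_ge0] applies. M rows with a small tail are fixed before the columns
    are exhausted by Parseval. *)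
Lemma hsop_entries_cvg A : (fun N => q N A) @ \oo --> `|A| ^+ 2.
Proof.
have normA : `|A| ^+ 2 = limn (series (fun n => inner (A (e n)) (A (e n)))).
  by rewrite -innerxx.
have cA : series (fun n => inner (A (e n)) (A (e n))) @ \oo --> `|A| ^+ 2.
  by rewrite normA; exact: hs_inner_cvg.
apply/cvgrPdist_le => eps eps0.
have eps2 : 0 < eps / 2 by rewrite divr_gt0.
have [M _ hM] : \forall M \near \oo,
    `| `|A| ^+ 2 - series (fun n => inner (A (e n)) (A (e n))) M| <= eps / 2.
  by move/cvgrPdist_le : cA; apply.
have {hM} := hM M (leqnn M).
have partial N : series (fun n => inner (A (e n)) (A (e n))) N <= `|A| ^+ 2.
  rewrite -innerxx; have := hs_inner_partial A N; apply: le_trans.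
  by rewrite /series/=; under eq_bigr do rewrite innerxx.
rewrite ger0_norm ?subr_ge0// => hM.
have qM : (fun N => \sum_(0 <= i < M) \sum_(0 <= j < N) ent A i j ^+ 2) @ \oo
    --> series (fun n => inner (A (e n)) (A (e n))) M.
  rewrite /series/=.
  elim: M {hM} => [|M ih].
    by under eq_fun do rewrite big_geq//; rewrite big_geq//; exact: cvg_cst.
  under eq_fun do rewrite big_nat_recr//=; rewrite big_nat_recr//=.
  by apply: cvgD => //; rewrite innerxx; exact: parseval.
near=> N.
have MN : (M <= N)%N by near: N; exact: nbhs_infty_ge.
have qle : q N A <= `|A| ^+ 2.
  apply: le_trans (partial N); rewrite /series/=.
  by apply: ler_sum => i _; rewrite innerxx; exact: bessel.
rewrite ger0_norm ?subr_ge0//.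
have : `|series (fun n => inner (A (e n)) (A (e n))) M -
    \sum_(0 <= i < M) \sum_(0 <= j < N) ent A i j ^+ 2| <= eps / 2.
  by near: N; move/cvgrPdist_le : qM; apply.
move=> /(le_trans (ler_norm _)).
have : \sum_(0 <= i < M) \sum_(0 <= j < N) ent A i j ^+ 2 <= q N A.
  rewrite /q (big_cat_nat (n := M) (p := N))//= lerDl sumr_ge0// => i _.
  by rewrite sumr_ge0// => j _; exact: sqr_ge0.
lra.
Unshelve. all: by end_near. Qed.

Lemma hs_inner_entries_cvg A C :
  (fun N => \sum_(0 <= i < N) \sum_(0 <= j < N) ent A i j * ent C i j) @ \oo
  --> inner A C.
Proof.
have -> : (fun N => \sum_(0 <= i < N) \sum_(0 <= j < N) ent A i j * ent C i j) =
    (fun N => 4^-1 * (q N (A + C) - q N (A - C))).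
  apply/funext => N; rewrite /q -sumrB mulr_sumr; apply: eq_bigr => i _.
  rewrite -sumrB mulr_sumr; apply: eq_bigr => j _.
  rewrite /ent; change ((A + C) (e i)) with (A (e i) + C (e i)).
  change ((A - C) (e i)) with (A (e i) - C (e i)).
  by rewrite innerDl innerBl; field.
have -> : inner A C = 4^-1 * (`|A + C| ^+ 2 - `|A - C| ^+ 2).
  by rewrite !normD_sqr innerNr normrN; field.
apply: cvgM; first exact: cvg_cst.
by apply: cvgB; exact: hsop_entries_cvg.
Qed.

(** Compressions of positive operators to the first N basis vectors are positive matrices, whose
    entrywise pairing is nonnegative; the limit in N gives the claim. The signs of <X_r, g>, <X_s,
    psi_2> and <xi, u> below all rest on it. *)
Lemma Hplus_inner_ge0 A C : Hplus A -> Hplus C -> 0 <= inner A C.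
Proof.
move=> pA pC.
apply: (cvgn_ge_cst (@hs_inner_entries_cvg A C)) => N.
rewrite big_mkord; under eq_bigr do rewrite big_mkord.
have psd B : Hplus B -> forall c : nat -> R,
    0 <= \sum_(i < N) \sum_(j < N) c i * c j * ent B i j.
  move=> pB c; have := pB (\sum_(0 <= j < N) c j *: e j).
  rewrite inner_sumr big_mkord; congr (0 <= _); apply: eq_bigr => i _.
  rewrite innerZr hsop_sym innerC inner_sumr big_mkord mulr_sumr.
  apply: eq_bigr => j _; rewrite innerZr /ent mulrA; ring.
apply: (psd_sum_ge0 (A := ent A) (C := ent C)); [|exact: psd|exact: psd].
by move=> i j; rewrite /ent hsop_sym innerC.
Qed.

Lemma Hplus_tensor2 y : Hplus (tensor2 e y).
Proof.
by move=> h; change (0 <= inner (inner y h *: y) h); rewrite innerZl -expr2 sqr_ge0.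
Qed.

Lemma Hplus_zero : Hplus (0 : hsop e).
Proof. by move=> h; change (0 <= inner 0 h); rewrite inner0l. Qed.

Lemma hsop_partial_le A n : \sum_(0 <= i < n) `|A (e i)| ^+ 2 <= `|A| ^+ 2.
Proof. by rewrite -innerxx; exact: hs_inner_partial. Qed.

Lemma hs_norm_le_bound A (M : R) : 0 <= M ->
  (forall n, \sum_(0 <= i < n) `|A (e i)| ^+ 2 <= M ^+ 2) -> `|A| <= M.
Proof.
move=> M0 AM; rewrite -(ler_pXn2r (n := 2)) ?nnegrE// -innerxx.
apply: (cvgn_le_cst (@hs_inner_cvg _ _ e A A)) => n.
by rewrite /series/=; under eq_bigr do rewrite innerxx; exact: AM.
Qed.

Lemma hsop_norm_le A x : `|A x| <= `|A| * `|x|.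
Proof.
rewrite -(ler_pXn2r (n := 2)) ?nnegrE ?mulr_ge0// exprMn.
apply: (cvgn_le_cst (@parseval _ _ e (A x))) => n.
apply: le_trans (ler_wpM2r (sqr_ge0 _) (hsop_partial_le A n)).
rewrite mulr_suml; apply: ler_sum => i _.
rewrite hsop_sym -exprMn -(real_normK (num_real (inner _ _))).
by rewrite ler_pXn2r ?nnegrE ?mulr_ge0// mulrC cauchy_schwarz.
Qed.

(** This makes h -> h (x) h continuous in Hilbert-Schmidt norm, so that strong continuity of the
    adjoint semigroup becomes norm continuity of the source term g. *)
Lemma tensor2_dist_le y z :
  `|tensor2 e y - tensor2 e z| <= `|y - z| * (`|y| + `|z|).
Proof.
apply: hs_norm_le_bound; first by rewrite mulr_ge0// addr_ge0.
move=> n.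
(* The difference is split as (y - z) (x) y + z (x) (y - z). *)
have E i : (tensor2 e y - tensor2 e z) (e i) =
    inner (y - z) (e i) *: y + inner z (e i) *: (y - z).
  change (inner y (e i) *: y - inner z (e i) *: z =
    inner (y - z) (e i) *: y + inner z (e i) *: (y - z)).
  by rewrite innerBl scalerBl scalerBr addrA subrK.
under eq_bigr do rewrite E normD_sqr !normrZ innerZl innerZr !exprMn
  !real_normK ?num_real//.
set a := `|y - z|; set s := inner y (y - z).
rewrite (_ : \sum_(0 <= i < n) _ =
    (\sum_(0 <= i < n) inner (y - z) (e i) ^+ 2) * `|y| ^+ 2 +
    2 * (\sum_(0 <= i < n) inner (y - z) (e i) * inner z (e i)) * s +
    (\sum_(0 <= i < n) inner z (e i) ^+ 2) * a ^+ 2); last first.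
  rewrite mulr_sumr !mulr_suml -!big_split/=; apply: eq_bigr => i _; ring.
have a0 : 0 <= a by exact: normr_ge0.
set P := \sum_(0 <= i < n) inner (y - z) (e i) ^+ 2.
set Q := \sum_(0 <= i < n) inner z (e i) ^+ 2.
set W := \sum_(0 <= i < n) _.
have P0 : 0 <= P by apply: sumr_ge0 => i _; exact: sqr_ge0.
have Q0 : 0 <= Q by apply: sumr_ge0 => i _; exact: sqr_ge0.
have Pa : P <= a ^+ 2 by exact: bessel.
have Qz : Q <= `|z| ^+ 2 by exact: bessel.
have WPQ : W ^+ 2 <= P * Q.
  have h (t : R) : 0 <= P * t ^+ 2 + 2 * W * t + Q.
    have -> : P * t ^+ 2 + 2 * W * t + Q =
      \sum_(0 <= i < n) (inner (y - z) (e i) * t + inner z (e i)) ^+ 2.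
      rewrite mulr_sumr !mulr_suml -!big_split/=; apply: eq_bigr => i _; ring.
    by apply: sumr_ge0 => i _; exact: sqr_ge0.
  have [P00|P00] := eqVneq P 0.
    rewrite P00 mul0r; have := h (- (Q + 1) / (2 * W)); rewrite P00 mul0r add0r.
    have [->|W0] := eqVneq W 0; first by rewrite expr0n.
    have -> : 2 * W * (- (Q + 1) / (2 * W)) + Q = - 1 by field.
    by rewrite ler0N1.
  have Ppos : 0 < P by rewrite lt_neqAle eq_sym P00.
  have := h (- W / P); have -> : P * (- W / P) ^+ 2 + 2 * W * (- W / P) + Q =
    (P * Q - W ^+ 2) / P by field.
  by rewrite pmulr_lge0 ?invr_gt0// subr_ge0.
have WW : `|W| <= a * `|z|.
  rewrite -(ler_pXn2r (n := 2)) ?nnegrE ?mulr_ge0//.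
  have -> : `|W| ^+ 2 = W ^+ 2 by exact: real_normK (num_real W).
  rewrite exprMn; by apply: (le_trans WPQ); apply: ler_pM.
have sa : `|s| <= `|y| * a by exact: cauchy_schwarz.
have WS : W * s <= (a * `|z|) * (`|y| * a).
  apply: le_trans (ler_norm _) _; rewrite normrM.
  by apply: ler_pM.
have h1 : P * `|y| ^+ 2 <= a ^+ 2 * `|y| ^+ 2 by rewrite ler_wpM2r// sqr_ge0.
have h2 : Q * a ^+ 2 <= `|z| ^+ 2 * a ^+ 2 by rewrite ler_wpM2r// sqr_ge0.
have -> : (a * (`|y| + `|z|)) ^+ 2 = a ^+ 2 * `|y| ^+ 2 +
   2 * ((a * `|z|) * (`|y| * a)) + `|z| ^+ 2 * a ^+ 2 by ring.
lra.
Qed.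

Lemma tensor2_cvg (I : Type) (F : set_system I) {FF : Filter F} (a : I -> H) y :
  a @ F --> y -> (fun i => tensor2 e (a i)) @ F --> tensor2 e y.
Proof.
move=> ay; apply/cvgrPdist_le => eps eps0.
have K0 : 0 < 2 * `|y| + 1 by rewrite ltr_wpDl// mulr_ge0.
near=> i.
apply: le_trans (tensor2_dist_le _ _) _.
have h1 : `|y - a i| <= 1 by near: i; move/cvgrPdist_le : ay; apply.
have h2 : `|y - a i| <= eps / (2 * `|y| + 1).
  by near: i; move/cvgrPdist_le : ay; apply; rewrite divr_gt0.
have h3 : `|a i| <= `|y| + 1.
  rewrite -[a i](subKr y) (le_trans (ler_normB _ _))// lerD2l//.
apply: (@le_trans _ _ (eps / (2 * `|y| + 1) * (2 * `|y| + 1))).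
  by apply: ler_pM => //; lra.
by rewrite divfK// gt_eqF.
Unshelve. all: by end_near. Qed.

End cone_inner.

Section hsop_complete.
Context (R : realType) (H : hilbertType R) (e : onb H).

(** The limit is taken pointwise and then shown to be a symmetric Hilbert-Schmidt operator.
    Completeness makes [hsop e] a [hilbertType], which Riesz representation and Banach-Steinhaus on
    this space require. *)
Let hsop_cauchy_cvg (F : set_system (hsop e)) : ProperFilter F ->
  cauchy F -> cvg F.
Proof.
move=> FF /cauchy_ballP Fc.
have Fc' (eps : R) : 0 < eps ->
    \forall A \near F, \forall C \near F, `|A - C| < eps.
  move=> eps0; have := Fc eps eps0.
  case=> -[P Q] /= [FP FQ] PQ.
  apply: filterS FP => A PA; apply: filterS FQ => C QC.
  have : ball A eps C by apply: (PQ (A, C)).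
  by rewrite -ball_normE.
have evc (x : H) : cvg ((fun A : hsop e => A x) @ F).
  apply: cauchy_cvg; apply/cauchy_exP => eps eps0.
  have K0 : 0 < `|x| + 1 by rewrite ltr_wpDl.
  have [A hA] := filter_ex (Fc' _ (divr_gt0 eps0 K0)).
  exists (A x); suff : \forall C \near F, ball (A x) eps ((C : hsop e) x) by [].
  near=> C.
  rewrite -ball_normE/=.
  have := hsop_norm_le (A - C) x; change ((A - C) x) with (A x - C x).
  move=> /le_lt_trans; apply.
  have : `|A - C| < eps / (`|x| + 1) by near: C.
  rewrite ltr_pdivlMr// => /(le_lt_trans _); apply.
  by rewrite ler_wpM2l// lerDl.
pose L x := lim ((fun A : hsop e => A x) @ F).
have Lc x : (fun A : hsop e => A x) @ F --> L x by exact: evc.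
have Llin : linear L.
  move=> a x y; apply: (cvg_unique _ (Lc _)) => //.
  have -> : (fun A : hsop e => A (a *: x + y)) = (fun A : hsop e => a *: A x + A y).
    by apply/funext => A; have [lA _] := hsop_bounded_linear A; rewrite lA.
  apply: cvgD; last exact: Lc.
  by apply: cvgZl_tmp; exact: Lc.
have Lsym x y : inner (L x) y = inner x (L y).
  have h1 : (fun A : hsop e => inner (A x) y) @ F --> inner (L x) y.
    by apply: inner_cvg; [exact: Lc|exact: cvg_cst].
  have h2 : (fun A : hsop e => inner (A x) y) @ F --> inner x (L y).
    under eq_fun do rewrite hsop_sym.
    by apply: inner_cvg; [exact: cvg_cst|exact: Lc].
  exact: (cvg_unique _ h1 h2).
(* Fatou on partial sums: the Cauchy bound survives the limit in [C] for each n. It yields both that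
   [L] is Hilbert-Schmidt and the convergence in norm. *)
have tail (A : hsop e) eps n : (\forall C \near F, `|A - C| < eps) ->
    \sum_(0 <= i < n) `|A (e i) - L (e i)| ^+ 2 <= eps ^+ 2.
  move=> hA.
  have eps0 : 0 <= eps by have [C /ltW] := filter_ex hA; apply: le_trans.
  have c : (fun C : hsop e => \sum_(0 <= i < n) `|A (e i) - C (e i)| ^+ 2) @ F -->
      \sum_(0 <= i < n) `|A (e i) - L (e i)| ^+ 2.
    elim: n => [|n ih].
      by under eq_fun do rewrite big_geq//; rewrite big_geq//; exact: cvg_cst.
    under eq_fun do rewrite big_nat_recr//=; rewrite big_nat_recr//=.
    apply: cvgD => //; rewrite expr2; under eq_fun do rewrite expr2.
    by apply: cvgM; apply: cvg_norm; apply: cvgB; [exact: cvg_cst|exact: Lc|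
      exact: cvg_cst|exact: Lc].
  apply: (cvgr_to_le c); near=> C.
  have AC : `|A - C| < eps by near: C.
  apply: le_trans (hsop_partial_le (A - C) n) _.
  by rewrite ler_pXn2r ?nnegrE// ltW.
have [A0 hA0] := filter_ex (Fc' 1 ltr01).
have bL n : \sum_(0 <= i < n) `|L (e i)| ^+ 2 <= 2 * `|A0| ^+ 2 + 2.
  apply: (@le_trans _ _ (\sum_(0 <= i < n)
      (2 * `|A0 (e i)| ^+ 2 + 2 * `|A0 (e i) - L (e i)| ^+ 2))).
    apply: ler_sum => i _.
    have := sqr_ge0 (`|2 *: A0 (e i) - L (e i)|).
    rewrite !normD_sqr !innerNr !normrN innerZl normrZ exprMn normr_nat; lra.
  rewrite big_split/= -!mulr_sumr lerD//.
    by rewrite ler_wpM2l// hsop_partial_le.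
  have := tail A0 1 n hA0; rewrite expr1n => h; lra.
have LbL : bounded_linear L.
  apply: (@bound_bounded_linear _ _ _ _ (`|A0| + 1)) => // x.
  have [K hK] : exists K, K = `|x| by exists `|x|.
  apply/ler_addgt0Pr => eps eps0.
  have [C [CA Cx]] : exists C : hsop e, `|A0 - C| < 1 /\ `|L x - C x| <= eps.
    have : \forall C \near F, `|A0 - C| < 1 /\ `|L x - C x| <= eps.
      by apply: filterI => //; move/cvgrPdist_le : (Lc x); apply.
    by move=> /filter_ex.
  rewrite -[L x](subrK (C x)) addrC (le_trans (ler_normD _ _))// addrC.
  rewrite addrC lerD//.
  apply: le_trans (hsop_norm_le C x) _; rewrite ler_wpM2r//.
  rewrite -[C](subKr A0) (le_trans (ler_normB _ _))// lerD2l; exact: ltW.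
have LH : L \in hsop_pred e.
  by apply/hsop_predP; split => //; exact: (hs_norm2_fin bL).
apply/cvg_ex; exists (HSOp LH); apply/cvgrPdist_le => eps eps0.
have := Fc' eps eps0; apply: filterS => A hA.
rewrite distrC; apply: hs_norm_le_bound; first exact: ltW.
by move=> n; exact: tail.
Unshelve. all: by end_near. Qed.

HB.instance Definition _ := Uniform_isComplete.Build (hsop e) hsop_cauchy_cvg.

End hsop_complete.

(** * Interval integrals and strongly continuous semigroups *)

Section interval_integral.
Context (R : realType).
Local Notation mu := (@lebesgue_measure R).
Implicit Types (f : R -> R) (a b c : R).

Lemma lebesgue_itvcc a b : a <= b -> mu `[a, b] = (b - a)%:E.
Proof.
rewrite le_eqVlt => /predU1P[->|ab].
  by rewrite subrr set_itv1 lebesgue_measure_set1.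
by rewrite lebesgue_measure_itv/= lte_fin ab EFinN EFinB.
Qed.

Lemma itv_bounded_integrable f a b K : measurable_fun `[a, b] f ->
  (forall x : R, a <= x <= b -> `|f x| <= K) -> mu.-integrable `[a, b] (EFin \o f).
Proof.
move=> mf fK; apply: measurable_bounded_integrable => //.
  by rewrite /= lebesgue_measure_itv/=; case: ifPn => // _; rewrite -EFinD ltry.
exists K; split; first exact: num_real.
move=> M KM x /=; rewrite in_itv/= => /fK/le_trans; apply; exact: ltW.
Qed.

Lemma continuous_integrable f a b : continuous f ->
  mu.-integrable `[a, b] (EFin \o f).
Proof.
move=> cf; apply: continuous_compact_integrable; first exact: segment_compact.
exact: continuous_subspaceT.
Qed.

Lemma Rintegral_chasles f a b c : a <= b -> b <= c ->
  mu.-integrable `[a, c] (EFin \o f) ->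
  \int[mu]_(x in `[a, c]) f x =
  \int[mu]_(x in `[a, b]) f x + \int[mu]_(x in `[b, c]) f x.
Proof.
move=> ab bc fi.
have E : `[a, c]%classic = `[a, b]%classic `|` `]b, c]%classic :> set R.
  apply/seteqP; split=> x /=; rewrite !in_itv/=; last by move=> [|]; lra.
  by move=> /andP[ax xc]; have [xb|bx] := leP x b; [left|right]; lra.
have fi2 : mu.-integrable `]b, c] (EFin \o f).
  by apply: integrableS fi => //; rewrite E; exact: subsetUr.
rewrite -(Rintegral_itv_obnd_cbnd fi2) {1}E Rintegral_setU -?E//.
apply/disj_setPS => x /= []; rewrite !in_itv/=; lra.
Qed.

Lemma Rintegral_dist f a b y eps : a <= b ->
  mu.-integrable `[a, b] (EFin \o f) ->
  (forall x : R, a <= x <= b -> `|f x - y| <= eps) ->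
  `|\int[mu]_(x in `[a, b]) f x - (b - a) * y| <= eps * (b - a).
Proof.
move=> ab fi fy.
have ci (k : R) : mu.-integrable `[a, b] (EFin \o fun=> k).
  by apply: continuous_integrable; exact: cst_continuous.
have cE (k : R) : \int[mu]_(x in `[a, b]) k = k * (b - a).
  by rewrite Rintegral_cst//= lebesgue_itvcc.
rewrite mulrC -cE -RintegralB//.
apply: le_trans (le_normr_Rintegral _ _) _ => //; first exact: (integrableB _ fi (ci y)).
rewrite -cE; apply: le_Rintegral => //.
  exact/integrable_norm/(integrableB _ fi (ci y)).
Qed.

Lemma Rintegral_bound f a b K : a <= b ->
  mu.-integrable `[a, b] (EFin \o f) ->
  (forall x : R, a <= x <= b -> `|f x| <= K) ->
  `|\int[mu]_(x in `[a, b]) f x| <= K * (b - a).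
Proof.
move=> ab fi fK; have := @Rintegral_dist f a b 0 K ab fi.
by rewrite mulr0 subr0; apply=> x /fK; rewrite subr0.
Qed.

Lemma Rintegral_shift f a b r : continuous f ->
  \int[mu]_(x in `[a, b]) f (x + r) = \int[mu]_(x in `[a + r, b + r]) f x.
Proof.
move=> cf; rewrite /Rintegral; congr fine.
have mr : measurable_fun setT (fun x : R => x + r).
  by apply: continuous_measurable_fun => x; apply: cvgD; [exact: cvg_id|exact: cvg_cst].
have pre c d : (fun x : R => x + r) @^-1` `[c + r, d + r] = `[c, d]%classic.
  by apply/seteqP; split=> x /=; rewrite !in_itv/= !lerD2r.
pose sh : R -> measurableTypeR R := fun x => x + r.
transitivity (\int[pushforward mu sh]_(x in `[(a + r)%R, (b + r)%R]) (f x)%:E)%E.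
  rewrite integral_pushforward//= ?pre//.
    by apply/measurable_EFinP; exact: (continuous_measurable_fun cf).
  apply: (continuous_integrable (f := fun x => f (x + r))) => x.
  apply: (continuous_comp (f := fun x : R => x + r)); last exact: cf.
  by apply: cvgD; [exact: cvg_id|exact: cvg_cst].
apply: eq_measure_integral => A mA _; apply/esym/lebesgue_measure_unique => //.
move=> _ [[c d] _ <-] /=; rewrite /pushforward/=.
rewrite (_ : _ @^-1` _ = `]c - r, d - r]%classic); last first.
  by apply/seteqP; split=> x /=; rewrite !in_itv/= ltrBlDr lerBrDr.
rewrite !lebesgue_measure_itv/= !lte_fin ltrD2r.
by case: ifP => // _; rewrite -!EFinD; congr EFin; ring.
Qed.

End interval_integral.

Section uniform.
Context (R : realType).

(** Functions given on [0, +oo[ are extended to the left by their value at 0, so that later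
    arguments handle plain continuity on R instead of the subspace topology. *)
Lemma clamp_continuous (V : topologicalType) (f : R -> V) :
  {within `[0, +oo[, continuous f} -> continuous (fun x : R => f (Num.max 0 x)).
Proof.
move=> /subspace_continuousP cf x.
have c : (Num.max 0 : R -> R) @ x --> within `[0, +oo[ (nbhs (Num.max 0 x)).
  have : (Num.max 0 : R -> R) @ x --> Num.max 0 x.
    by apply: (@continuous_max R R (fun=> 0) id); [exact: cst_continuous|exact: cvg_id].
  move=> h A /h hA; apply: (@filterS _ (nbhs x) _ _ _ _ hA) => y /=; apply.
  by rewrite /= in_itv/= andbT le_max lexx.
apply: cvg_trans (cf (Num.max 0 x) _); last first.
  by rewrite /= in_itv/= andbT le_max lexx.
by move=> A /= /c.
Qed.

Lemma continuous_bounded (V : normedModType R) (c : R -> V) (a b : R) :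
  continuous c -> exists2 K, 0 <= K & forall x : R, a <= x <= b -> `|c x| <= K.
Proof.
move=> cc; have /compact_bounded[M [_ hM]] :
    compact (c @` `[a, b]).
  apply: continuous_compact; last exact: segment_compact.
  exact: continuous_subspaceT.
exists (`|M| + 1); first by rewrite addr_ge0.
move=> x xab; apply: hM; first by rewrite ltr_pwDr// ler_norm.
by exists x => //=; rewrite in_itv.
Qed.

(* The uniform continuity of c and the strong continuity at 0 of T, uniform on
   the compact range of c, in a single statement. *)
Lemma unif_orbit (V : normedModType R) (T : R -> V -> V) (c : R -> V)
    (a b K d0 eps : R) : 0 < K -> 0 < d0 ->
  (forall (r : R) x y, 0 <= r <= d0 -> `|T r x - T r y| <= K * `|x - y|) ->
  (forall y (e : R), 0 < e -> exists2 d : R, 0 < d &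
     forall r : R, 0 <= r <= d -> `|T r y - y| <= e) ->
  continuous c -> 0 < eps ->
  exists2 d : R, 0 < d & forall x y r : R, a <= x <= b -> `|x - y| <= d ->
    0 <= r <= d -> `|T r (c x) - c y| <= eps.
Proof.
move=> K0 d00 TK T0 cc eps0.
pose P (d x : R) := forall y r : R, `|x - y| <= d -> 0 <= r <= d ->
   `|T r (c x) - c y| <= eps.
have : \forall d \near 0^'+, `[a, b]%classic `<=` P d.
  have /compact_near_coveringP := @segment_compact R a b; apply => x _.
  pose e := eps / (K + 2).
  have e0 : 0 < e by rewrite divr_gt0// addr_gt0.
  have /cvgrPdist_le/(_ _ e0)/nbhs_ballP[eta /= eta0 hc] := cc x.
  have [dT dT0 hT] := T0 (c x) e e0.
  have eta2 : 0 < eta / 2 by rewrite divr_gt0.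
  near=> z d => y r /= zy /andP[r0 rd].
  have xz : `|x - z| < eta / 2.
    near: z; exact: (nbhsx_ballx x (eta / 2) eta2).
  have d1 : d < eta / 2 by near: d; exact: nbhs_right_lt.
  have d2 : d <= dT by near: d; exact: nbhs_right_le.
  have d3 : d <= d0 by near: d; exact: nbhs_right_le.
  have hz : `|c x - c z| <= e.
    by apply: hc; rewrite /ball/=; apply: lt_le_trans xz _; lra.
  have hy : `|c x - c y| <= e.
    apply: hc; rewrite /ball/= -(subrK z x) -addrA.
    by apply: le_lt_trans (ler_normD _ _) _; lra.
  have h1 : `|T r (c z) - T r (c x)| <= K * e.
    apply: le_trans (TK _ _ _ _) _; first by lra.
    by rewrite ler_pM2l// distrC.
  have h2 : `|T r (c x) - c x| <= e by apply: hT; lra.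
  have -> : T r (c z) - c y = (T r (c z) - T r (c x)) + (T r (c x) - c x) + (c x - c y).
    by rewrite !addrA !subrK.
  apply: le_trans (ler_normD _ _) _; apply: le_trans (lerD (ler_normD _ _) (lexx _)) _.
  have -> : eps = K * e + e + e by rewrite /e; field; lra.
  lra.
move=> h; near (0 : R)^'+ => d.
exists d => // x y r xab xy rd.
have hd : `[a, b]%classic `<=` P d by near: d.
by apply: hd => //=; rewrite in_itv.
Unshelve. all: by end_near. Qed.

Lemma unif_continuous (V : normedModType R) (c : R -> V) (a b eps : R) :
  continuous c -> 0 < eps ->
  exists2 d : R, 0 < d & forall x y : R, a <= x <= b -> `|x - y| <= d ->
    `|c x - c y| <= eps.
Proof.
move=> cc eps0.
have [||d d0 h] := @unif_orbit V (fun _ x => x) c a b 1 1 eps ltr01 ltr01 _ _ cc eps0.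
- by move=> *; rewrite mul1r.
- by move=> y e0 e00; exists 1 => // r _; rewrite subrr normr0 ltW.
- by exists d => // x y xab xy; apply: (h x y 0) => //; rewrite lexx ltW.
Qed.

End uniform.

Section semigroups.
Context (R : realType).

(** Orbits are continuous, hence bounded on [0, t]; Banach-Steinhaus makes the bound uniform on the
    unit ball, and scaling extends it. *)
Lemma semigroup_bounded (V : completeNormedModType R) (T : R -> V -> V) (t : R) :
  C0_semigroup T -> exists2 K, 1 <= K &
    forall (r : R) x, 0 <= r <= t -> `|T r x| <= K * `|x|.
Proof.
move=> [_ _ lT cT].
pose F := [set T r | r in `[0, t]].
have [||M hM] := @Banach_Steinhauss R V V F _ _ 1.
- move=> f [r /=]; rewrite in_itv/= => /andP[r0 _] <-{f}.
  have [C C0 TC] := bounded_linear_bound (lT r r0).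
  split; last by have [] := lT r r0.
  move=> k; exists (C * k) => x xk; apply: (le_trans (TC x)).
  by rewrite ler_pM2l.
- move=> x; have [M M0 hM] := continuous_bounded 0 t (clamp_continuous (cT x)).
  exists M => f [r /=]; rewrite in_itv/= => /andP[r0 rt] <-{f}.
  by have := hM r; rewrite (max_idPr r0); apply; rewrite r0.
- exists (`|M| + 1); first by rewrite lerDr.
  move=> r x r0t.
  have [->|x0] := eqVneq x 0.
    by rewrite (bounded_linear0 (lT r _)) ?normr0 ?mulr0//; case/andP: r0t.
  have nx : 0 < `|x| by rewrite normr_gt0.
  have [lin _] : bounded_linear (T r) by apply: lT; case/andP: r0t.
  have TZ a y : T r (a *: y) = a *: T r y.
    rewrite -[a *: y]addr0 lin (bounded_linear0 (lT r _)) ?addr0//.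
    by case/andP: r0t.
  have := hM (T r) _ (`|x|^-1 *: x) _.
  rewrite TZ !normrZ gtr0_norm ?invr_gt0// mulVf ?gt_eqF// ler_pdivrMl//.
  move=> h; apply: le_trans (h _ _) _ => //; first by exists r => //=; rewrite in_itv.
  by rewrite mulrC ler_wpM2r// (le_trans (ler_norm _))// lerDl.
Qed.

Lemma semigroup_cvg0 (V : normedModType R) (T : R -> V -> V) (y : V) (e : R) :
  C0_semigroup T -> 0 < e ->
  exists2 d : R, 0 < d & forall r : R, 0 <= r <= d -> `|T r y - y| <= e.
Proof.
move=> [T0 _ _ cT] e0.
have /cvgrPdist_le/(_ _ e0)/nbhs_ballP[eta /= eta0 h] := @clamp_continuous R _ _ (cT y) 0.
exists (eta / 2); first by rewrite divr_gt0.
move=> r /andP[r0 re]; have := h r; rewrite maxxx T0 (max_idPr r0) distrC; apply.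
by rewrite /ball/= sub0r normrN ger0_norm//; lra.
Qed.

Section adjoint.
Context (H : hilbertType R) (S Sadj : R -> H -> H).
Hypotheses (S_semigroup : C0_semigroup S) (S_adjoint : adjoint_family S Sadj).

Let adjP (r : R) x y : 0 <= r -> inner (Sadj r x) y = inner x (S r y).
Proof. by move=> r0; exact: S_adjoint. Qed.

Lemma adjoint_bounded (t : R) : exists2 K, 1 <= K &
  forall (r : R) x, 0 <= r <= t -> `|Sadj r x| <= K * `|x|.
Proof.
have [K K1 hK] := semigroup_bounded t S_semigroup.
have K0 : 0 <= K by apply: le_trans K1.
exists K => // r x rt; apply: norm_le_inner; first by rewrite mulr_ge0.
move=> z; rewrite adjP; last by case/andP: rt.
apply: le_trans (ler_norm _) _; apply: le_trans (cauchy_schwarz _ _) _.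
by rewrite (mulrC K) -mulrA ler_wpM2l// hK.
Qed.

Lemma adjoint_linear (r : R) : 0 <= r -> linear (Sadj r).
Proof.
move=> r0 a x y; apply: inner_ext => z.
by rewrite adjP// !innerDl !innerZl !adjP.
Qed.

Lemma adjoint_semigroup (r s : R) x : 0 <= r -> 0 <= s ->
  Sadj (r + s) x = Sadj r (Sadj s x).
Proof.
move=> r0 s0; apply: inner_ext => z; have [_ SD _ _] := S_semigroup.
by rewrite !adjP ?addr_ge0// addrC SD.
Qed.

(* The averages of an orbit are strongly continuous at 0, and they span a dense
   subspace. *)
Lemma adjoint_cvg0 x (e : R) : 0 < e ->
  exists2 d : R, 0 < d & forall r : R, 0 <= r <= d -> `|Sadj r x - x| <= e.
Proof.
move: x e.
(* The vectors at which the claim holds. They form a closed subspace, and it remains to see that its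
   orthogonal complement is trivial. *)
pose E := [set x | forall e : R, 0 < e -> exists2 d : R, 0 < d &
  forall r : R, 0 <= r <= d -> `|Sadj r x - x| <= e].
suff ET : E = setT.
  by move=> x; have : E x by rewrite ET.
have [S0 SD lS cS] := S_semigroup.
have [K K1 hK] := adjoint_bounded 2.
have K0 : 0 < K by apply: lt_le_trans K1.
have adjB (r : R) a b : 0 <= r -> Sadj r (a - b) = Sadj r a - Sadj r b.
  move=> r0; rewrite addrC -scaleN1r adjoint_linear// scaleN1r addrC//.
apply: closed_subspace_total.
- move=> e e0; exists 1 => // r /andP[r0 _].
  have -> : Sadj r 0 = 0 by apply: inner_ext => z; rewrite adjP// !inner0l.
  by rewrite subrr normr0 ltW.
- move=> a x y Ex Ey e e0.
  have a1 : 0 < 2 * (`|a| + 1) by rewrite mulr_gt0// ltr_wpDl.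
  have [d1 d10 h1] := Ex (e / (2 * (`|a| + 1))) (divr_gt0 e0 a1).
  have [d2 d20 h2] := Ey (e / 2) (divr_gt0 e0 (ltr0Sn R 1)).
  exists (Num.min d1 d2); first by rewrite lt_min d10.
  move=> r /andP[r0]; rewrite le_min => /andP[r1 r2].
  rewrite adjoint_linear// opprD addrACA -scalerBr.
  apply: le_trans (ler_normD _ _) _; rewrite normrZ.
  have := h2 r; rewrite r0 r2 => /(_ erefl) g2.
  have := h1 r; rewrite r0 r1 => /(_ erefl) g1.
  have : `|a| * `|Sadj r x - x| <= `|a| * (e / (2 * (`|a| + 1))).
    by rewrite ler_wpM2l.
  have : `|a| * (e / (2 * (`|a| + 1))) <= e / 2.
    have -> : e / (2 * (`|a| + 1)) = e / 2 / (`|a| + 1).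
      by field; rewrite gt_eqF// ltr_wpDl.
    by rewrite mulrA ler_pdivrMr ?ltr_wpDl//; have := normr_ge0 a; nra.
  lra.
- rewrite closure_id; apply/seteqP; split; first exact: subset_closure.
  move=> x clx e e0.
  have K2 : 0 < 2 * (K + 1) by lra.
  have [x' [Ex' xx']] : E `&` ball x (e / (2 * (K + 1))) !=set0.
    by apply: clx; exact: (nbhsx_ballx x _ (divr_gt0 e0 K2)).
  have {}xx' : `|x - x'| <= e / (2 * (K + 1)).
    by move: xx'; rewrite -ball_normE/= => /ltW.
  have [d d0 hd] := Ex' (e / 2) (divr_gt0 e0 (ltr0Sn R 1)).
  exists (Num.min d 2); first by rewrite lt_min d0/=.
  move=> r /andP[r0]; rewrite le_min => /andP[rd r2].
  have -> : Sadj r x - x = Sadj r (x - x') + (Sadj r x' - x') + (x' - x).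
    by rewrite adjB// !addrA !subrK.
  apply: le_trans (ler_normD _ _) _; apply: le_trans (lerD (ler_normD _ _) (lexx _)) _.
  have := hK r (x - x'); rewrite r0 r2 => /(_ erefl) h1.
  have := hd r; rewrite r0 rd => /(_ erefl) h2.
  rewrite (distrC x').
  have : (K + 1) * `|x - x'| <= e / 2.
    by rewrite mulrC -ler_pdivlMr ?addr_gt0// -mulrA -invfM.
  lra.
- move=> z zE; apply/eqP; apply: contraT => z0.
  (* For z orthogonal to [E], the functional [l] below integrates <z, S(s) w> over [0, ep]; its
     representer y is the weak integral of the adjoint orbit of z. *)
  pose f w s := inner z (S (Num.max 0 s) w).
  have cf w : continuous (f w).
    move=> s; apply: inner_cvg; first exact: cvg_cst.
    exact: (clamp_continuous (cS w)).
  have [L L1 hL] := semigroup_bounded 2 S_semigroup.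
  have fb w (s : R) : 0 <= s <= 2 -> `|f w s| <= L * `|z| * `|w|.
    move=> s02; apply: le_trans (cauchy_schwarz _ _) _.
    rewrite (mulrC L) -mulrA ler_wpM2l// (max_idPr _) ?hL//; lra.
  have zz : 0 < `|z| ^+ 2 / 2 by rewrite divr_gt0// exprn_gt0// normr_gt0.
  have /cvgrPdist_le/(_ _ zz)/nbhs_ballP[eta /= eta0 heta] := cf z 0.
  (* On [0, ep] the value <z, S(s) z> stays within |z|^2 / 2 of |z|^2; [ep <= 1] keeps ep + r inside
     [0, 2], where the bound [L] is available. *)
  pose ep := Num.min 1 (eta / 2).
  have ep0 : 0 < ep by rewrite lt_min ltr01 divr_gt0.
  have ep1 : ep <= 1 by rewrite ge_min lexx.
  have epe : ep < eta by rewrite gt_min; apply/orP; right; lra.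
  pose l w := \int[lebesgue_measure]_(s in `[0, ep]) f w s.
  have ll : scalar l.
    move=> a w w'; rewrite /l -RintegralZl//; last exact: continuous_integrable.
    rewrite -RintegralD//; last exact: continuous_integrable.
      apply: eq_Rintegral => s _; rewrite /f.
      have [lin _] : bounded_linear (S (Num.max 0 s)) by apply: lS; rewrite le_max lexx.
      by rewrite lin innerDr innerZr.
    apply: continuous_integrable => s.
    by apply: cvgM; [exact: cvg_cst|exact: cf].
  have lb w : `|l w| <= (L * `|z| * ep) * `|w|.
    rewrite mulrAC -[X in _ * X]subr0; apply: Rintegral_bound; first exact: ltW.
      exact: continuous_integrable.
    by move=> s /andP[s0 se]; apply: fb; lra.
  have [y yl] := riesz ll lb.
  (* Applying [Sadj r] to y shifts the window of integration to [r, ep + r]; the change consists of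
     two integrals over intervals of length r. *)
  have Ey : E y.
    move=> e e0.
    have Q0 : 0 < 2 * (L * `|z| + 1) by rewrite mulr_gt0// ltr_wpDl// mulr_ge0//; lra.
    exists (Num.min (e / (2 * (L * `|z| + 1))) ep).
      by rewrite lt_min ep0 divr_gt0.
    move=> r /andP[r0]; rewrite le_min => /andP[re rep].
    apply: norm_le_inner; first exact: ltW.
    move=> w; rewrite innerBl adjP// !yl.
    have -> : l (S r w) = \int[lebesgue_measure]_(s in `[0, ep]) f w (s + r).
      apply: eq_Rintegral => s; rewrite inE/= in_itv/= => /andP[s0 _].
      by rewrite /f !(max_idPr _) ?addr_ge0// SD.
    rewrite Rintegral_shift// add0r /l.
    have fi a b : lebesgue_measure.-integrable `[a, b] (EFin \o f w).
      exact: continuous_integrable.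
    have r0ep : r <= ep + r by rewrite lerDr ltW.
    have ep0r : ep <= ep + r by rewrite lerDl.
    have h1 := Rintegral_chasles r0 r0ep (fi 0 (ep + r)).
    have h2 := Rintegral_chasles (ltW ep0) ep0r (fi 0 (ep + r)).
    rewrite (_ : _ - _ = \int[lebesgue_measure]_(s in `[ep, ep + r]) f w s -
       \int[lebesgue_measure]_(s in `[0, r]) f w s); last by lra.
    have g2 : `|\int[lebesgue_measure]_(s in `[0, r]) f w s| <=
        L * `|z| * `|w| * (r - 0).
      by apply: Rintegral_bound => // s ?; apply: fb; lra.
    have g1 : `|\int[lebesgue_measure]_(s in `[ep, ep + r]) f w s| <=
        L * `|z| * `|w| * (ep + r - ep).
      by apply: Rintegral_bound => // s ?; apply: fb; lra.
    apply: le_trans (ler_norm _) _; apply: le_trans (ler_normB _ _) _.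
    apply: le_trans (lerD g1 g2) _.
    rewrite subr0 (addrC ep) addrK -mulr2n -mulr_natl.
    have : r * (2 * (L * `|z| + 1)) <= e by rewrite -ler_pdivlMr.
    have := normr_ge0 w; have := normr_ge0 z; nra.
  (* Thus l(z) = 0, yet l(z) is within half of ep |z|^2 of ep |z|^2: a contradiction with z being
     nonzero. *)
  have := zE y Ey; rewrite innerC yl => lz.
  have : `|l z - (ep - 0) * `|z| ^+ 2| <= `|z| ^+ 2 / 2 * (ep - 0).
    apply: Rintegral_dist => [||s /andP[s0 se]]; first exact: ltW.
      exact: continuous_integrable.
    rewrite distrC; have := heta s; rewrite /f maxxx S0 innerxx; apply.
    by rewrite /ball/= sub0r normrN ger0_norm//; lra.
  rewrite lz subr0 sub0r normrN.
  rewrite ger0_norm ?mulr_ge0 ?(ltW ep0)// ?sqr_ge0//.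
  nra.
Qed.

(** [Sadj s] transports continuity at 0 to time s, with a modulus uniform for s in a bounded
    interval. Taking the smaller of two times as base then covers left and right limits together. *)
Lemma adjoint_continuous x : continuous (fun s : R => Sadj (Num.max 0 s) x).
Proof.
have key (t e : R) : 0 < e -> exists2 d : R, 0 < d & forall s r : R, 0 <= s <= t ->
    0 <= r <= d -> `|Sadj (s + r) x - Sadj s x| <= e.
  move=> e0; have [K K1 hK] := adjoint_bounded t.
  have K0 : 0 < K by apply: lt_le_trans K1.
  have [d d0 hd] := @adjoint_cvg0 x (e / K) (divr_gt0 e0 K0).
  exists d => // s r /[dup] st /andP[s0 _] /[dup] rd /andP[r0 _].
  rewrite adjoint_semigroup// -[Sadj s x]scale1r -[in X in X - _](scale1r (Sadj s _)).
  rewrite -scalerBr scale1r.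
  have -> : Sadj s (Sadj r x) - Sadj s x = Sadj s (Sadj r x - x).
    by rewrite addrC -scaleN1r -adjoint_linear// scaleN1r addrC.
  by apply: le_trans (hK _ _ st) _; rewrite mulrC -ler_pdivlMr// hd.
move=> s; apply/cvgrPdist_le => e e0.
have [d d0 hd] := key (Num.max 0 s + 1) e e0.
pose d' := Num.min d 1.
have d'0 : 0 < d' by rewrite lt_min d0 ltr01.
near=> r.
have rs : `|s - r| < d' by near: r; exact: (nbhsx_ballx s d' d'0).
have : `|Num.max 0 s - Num.max 0 r| < d'.
  by move: rs; rewrite !maxEle; do 2 case: ifPn; rewrite -?ltNge; move=> ? ?;
    rewrite !ltr_norml; lra.
have s0 : 0 <= Num.max 0 s by rewrite le_max lexx.
have r0 : 0 <= Num.max 0 r by rewrite le_max lexx.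
move: (Num.max 0 s) (Num.max 0 r) s0 r0 hd => a b a0 b0 hd.
rewrite lt_min => /andP[abd ab1].
have [ab|ba] := leP a b.
  rewrite -(subrKC a b) distrC; apply: hd; first by lra.
  by rewrite subr_ge0 ab/= -(ger0_norm (x := b - a)) ?subr_ge0// distrC ltW.
rewrite -{1}(subrKC b a); apply: hd.
  by move: ab1; rewrite ltr_norml; lra.
by rewrite subr_ge0 (ltW ba)/= -(gtr0_norm (x := a - b)) ?subr_gt0// ltW.
Unshelve. all: by end_near. Qed.

End adjoint.

End semigroups.

(** * Vector measures and the functions F and R *)

Section finite_measure_integral.
Context d (T : measurableType d) (R : realType).
Implicit Types (p n : {finite_measure set T -> \bar R}) (D : set T) (g : T -> R).

Lemma finite_bounded_integrable p D g K : measurable D -> measurable_fun D g ->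
  (forall x, D x -> `|g x| <= K) -> p.-integrable D (EFin \o g).
Proof.
move=> mD mg gK; apply: measurable_bounded_integrable => //.
  by rewrite ltey_eq fin_num_measure.
exists K; split; first exact: num_real.
by move=> M KM x /= /gK/le_trans; apply; exact: ltW.
Qed.

Lemma finite_integral_bound p D g K : measurable D -> measurable_fun D g ->
  0 <= K -> (forall x, D x -> `|g x| <= K) ->
  `|\int[p]_(x in D) g x| <= K * fine (p setT).
Proof.
move=> mD mg K0 gK.
have gi := finite_bounded_integrable p mD mg gK.
rewrite -lee_fin EFin_normr_Rintegral// EFinM fineK ?fin_num_measure//.
apply: le_trans (le_abse_integral _ mD (measurable_int _ gi)) _.
apply: (@le_trans _ _ (K%:E * p D)%E).
  apply: integral_le_bound => //; first exact: measurable_int gi.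
  by apply: aeW => x /gK; rewrite lee_fin.
by rewrite lee_wpmul2l ?lee_fin// le_measure ?inE//.
Qed.

Lemma Rintegral_mscale p D g K (k : {nonneg R}) : measurable D ->
  measurable_fun D g -> (forall x, D x -> `|g x| <= K) ->
  \int[mscale k p]_(x in D) g x = k%:num * \int[p]_(x in D) g x.
Proof.
move=> mD mg gK; have gi := finite_bounded_integrable p mD mg gK.
have [mE _] := integrableP _ _ _ gi.
rewrite /Rintegral integralE !ge0_integral_mscale//;
  [|exact: measurable_funeneg|exact: measurable_funepos].
rewrite -muleBr//; last first.
  by apply: fin_num_adde_defr; exact: integrable_pos_fin_num gi.
rewrite -[in X in fine (_ * X)%E]integralE fineM//.
exact: integrable_fin_num.
Qed.

End finite_measure_integral.

Section vint_theory.
Context d (T : measurableType d) (R : realType) (E : innerType R).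
Context (mu : vmeasure T E).

(** The Hahn sets are chosen anew for each x, so later arguments only see two finite measures p and
    n. Their total masses are values of plus or minus <x, mu> on the Hahn sets, hence at most |x|
    times a bound on |mu|. *)
Lemma vint_jordan (x : E) : exists p n : {finite_measure set T -> \bar R},
  [/\ forall A, measurable A -> inner x (mu A) = fine (p A) - fine (n A),
      forall D (g : T -> R) K, measurable D -> measurable_fun D g ->
        (forall y, D y -> `|g y| <= K) -> vint mu D (EFin \o g) x =
        (\int[p]_(xi in D) g xi - \int[n]_(xi in D) g xi)%:E,
      exists2 A, measurable A & fine (p setT) = inner x (mu A) &
      exists2 A, measurable A & fine (n setT) = - inner x (mu A)].
Proof.
pose hd := cid (Hahn_decomposition (vm_coord mu x)).
pose PN := projT2 (cid (projT2 hd)).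
exists (jordan_pos PN), (jordan_neg PN); split => //.
- move=> A mA; have := jordan_decomp PN mA.
  rewrite /cadd/= /cscale/= EFinN mulN1e => /(congr1 fine).
  rewrite fineB ?fin_num_measure//.
- move=> D g K mD mg gK; rewrite EFinB /Rintegral !fineK//;
    exact/integrable_fin_num/(finite_bounded_integrable _ mD mg gK).
- have [[mP _] _ _ _] := PN; exists (projT1 hd) => //.
  have E0 : jordan_pos PN setT = (inner x (mu (projT1 hd)))%:E.
    rewrite jordan_posE cjordan_posE /crestr0 mem_set//.
    by rewrite /crestr/= setTI.
  exact: (congr1 fine E0).
- have [_ [mN _] _ _] := PN; exists (projT1 (cid (projT2 hd))) => //.
  have E0 : jordan_neg PN setT = (- inner x (mu (projT1 (cid (projT2 hd)))))%:E.
    rewrite jordan_negE cjordan_negE /crestr0 mem_set//.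
    by rewrite /crestr/= setTI.
  exact: (congr1 fine E0).
Qed.

Lemma vint_fin_num D (g : T -> R) K x : measurable D -> measurable_fun D g ->
  (forall y, D y -> `|g y| <= K) -> vint mu D (EFin \o g) x \is a fin_num.
Proof.
move=> mD mg gK; have [p [n [_ vE _ _]]] := vint_jordan x.
by rewrite (vE _ _ _ mD mg gK).
Qed.

Lemma vint_bound (M : R) D (g : T -> R) K x :
  (forall A, measurable A -> `|mu A| <= M) ->
  measurable D -> measurable_fun D g ->
  0 <= K -> (forall y, D y -> `|g y| <= K) ->
  `|fine (vint mu D (EFin \o g) x)| <= 2 * K * M * `|x|.
Proof.
move=> muM mD mg K0 gK; have [p [n [_ vE [A mA pA] [B mB nB]]]] := vint_jordan x.
rewrite (vE _ _ _ mD mg gK)/=.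
apply: le_trans (ler_normB _ _) _.
have := finite_integral_bound p mD mg K0 gK.
have := finite_integral_bound n mD mg K0 gK.
rewrite pA nB => h1 h2.
have h3 : inner x (mu A) <= `|x| * M.
  apply: le_trans (ler_norm _) _; apply: le_trans (cauchy_schwarz _ _) _.
  by rewrite ler_wpM2l// muM.
have h4 : - inner x (mu B) <= `|x| * M.
  rewrite -innerNl; apply: le_trans (ler_norm _) _.
  by apply: le_trans (cauchy_schwarz _ _) _; rewrite normrN ler_wpM2l// muM.
have := ler_wpM2l K0 h3; have := ler_wpM2l K0 h4; lra.
Qed.

Lemma vintB D (g h : T -> R) K x : measurable D ->
  measurable_fun D g -> measurable_fun D h ->
  (forall y, D y -> `|g y| <= K) -> (forall y, D y -> `|h y| <= K) ->
  fine (vint mu D (EFin \o g) x) - fine (vint mu D (EFin \o h) x) =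
  fine (vint mu D (EFin \o (fun y => g y - h y)) x).
Proof.
move=> mD mg mh gK hK; have [p [n [_ vE _ _]]] := vint_jordan x.
have ghK y : D y -> `|g y - h y| <= K + K.
  by move=> Dy; apply: le_trans (ler_normB _ _) _; apply: lerD; [exact: gK|exact: hK].
have mgh : measurable_fun D (fun y => g y - h y) by exact: measurable_funB.
rewrite (vE _ _ _ mD mg gK) (vE _ _ _ mD mh hK) (vE _ _ _ mD mgh ghK)/=.
have Fg (q : {finite_measure set T -> \bar R}) := finite_bounded_integrable q mD mg gK.
have Fh (q : {finite_measure set T -> \bar R}) := finite_bounded_integrable q mD mh hK.
rewrite (RintegralB mD (Fg p) (Fh p)) (RintegralB mD (Fg n) (Fh n)).
by ring.
Qed.

(** The Hahn decompositions for x, y and a x + y are unrelated. Carrying all negative parts to the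
    other side turns linearity into the equality of two sums of positive finite measures, which is
    checked on sets. *)
Lemma vint_scalar D (g : T -> R) K : measurable D -> measurable_fun D g ->
  (forall y, D y -> `|g y| <= K) ->
  scalar (fun x => fine (vint mu D (EFin \o g) x)).
Proof.
move=> mD mg gK a x y.
have [pz [nz [zE zv _ _]]] := vint_jordan (a *: x + y).
have [px [nx [xE xv _ _]]] := vint_jordan x.
have [py [ny [yE yv _ _]]] := vint_jordan y.
have F (q : {finite_measure set T -> \bar R}) := finite_bounded_integrable q mD mg gK.
rewrite (zv _ _ _ mD mg gK) (xv _ _ _ mD mg gK) (yv _ _ _ mD mg gK)/=.
(* A negative [a] exchanges the positive and negative parts of x. *)
have [p' [n' [E1 E2]]] : exists p' n' : {finite_measure set T -> \bar R},
    (forall A, a * (fine (px A) - fine (nx A)) = `|a| * (fine (p' A) - fine (n' A))) /\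
    a * (\int[px]_(z in D) g z - \int[nx]_(z in D) g z) =
    `|a| * (\int[p']_(z in D) g z - \int[n']_(z in D) g z).
  have [a0|a0] := leP 0 a; first by exists px, nx; rewrite ger0_norm.
  by exists nx, px; rewrite ltr0_norm//; split => [A|]; ring.
rewrite E2.
pose k : {nonneg R} := NngNum (normr_ge0 a).
have msum (q1 q2 q3 : {finite_measure set T -> \bar R}) :
    (\int[measure_add (measure_add q1 (mscale k q2)) q3]_(z in D) (g z)%:E =
    (\int[q1]_(z in D) g z + `|a| * \int[q2]_(z in D) g z +
      \int[q3]_(z in D) g z)%:E)%E.
  have kF : (mscale k q2).-integrable D (EFin \o g).
    exact: (finite_bounded_integrable (mscale k q2) mD mg gK).
  have I12 : (measure_add q1 (mscale k q2)).-integrable D (EFin \o g).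
    apply/integrableP; split; first exact: measurable_int (F q1).
    rewrite ge0_integral_measure_add//; last first.
      by apply: measurableT_comp => //; exact: measurable_int (F q1).
    by rewrite lte_add_pinfty//; [case/integrableP : (F q1)|case/integrableP : kF].
  rewrite integral_measure_add//; try exact: F; try exact: measurable_int (F q1).
  rewrite integral_measure_add//; try exact: F; try exact: measurable_int (F q1).
  have FE (q : {finite_measure set T -> \bar R}) :
      (\int[q]_(z in D) (g z)%:E)%E = (Rintegral q D g)%:E.
    by rewrite /Rintegral fineK//; exact: integrable_fin_num (F q).
  by rewrite (FE q1) (FE (mscale k q2)) (FE q3) (Rintegral_mscale q2 k mD mg gK).
have : (\int[measure_add (measure_add pz (mscale k n')) ny]_(z in D) (g z)%:E =
        \int[measure_add (measure_add nz (mscale k p')) py]_(z in D) (g z)%:E)%E.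
  apply: eq_measure_integral => A mA _.
  have mE (q1 q2 q3 : {finite_measure set T -> \bar R}) :
      (measure_add (measure_add q1 (mscale k q2)) q3 A =
       q1 A + `|a|%:E * q2 A + q3 A)%E.
    etransitivity; first exact: measure_addE.
    congr (_ + _)%E; exact: measure_addE.
  etransitivity; first exact: mE.
  apply/esym; etransitivity; first exact: mE.
  have fq (q : {finite_measure set T -> \bar R}) : q A = (fine (q A))%:E.
    by rewrite fineK// fin_num_measure.
  rewrite (fq pz) (fq n') (fq ny) (fq nz) (fq p') (fq py) -!EFinM -!EFinD.
  congr EFin.
  have := zE A mA; rewrite innerDl innerZl (xE A mA) (yE A mA) E1; lra.
rewrite !msum => -[]; lra.
Qed.

End vint_theory.

Section vmeasure_cone.
Context (R : realType) (H : hilbertType R) (e : onb H).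
Context d (T : measurableType d) (mu : vmeasure T (hsop e)).
Hypothesis mu_ge0 : forall A, measurable A -> Hplus (mu A).

Lemma vm_setU (A B : set T) : measurable A -> measurable B -> A `&` B = set0 ->
  mu (A `|` B) = mu A + mu B.
Proof.
move=> mA mB AB0.
have mF i : measurable (bigcup2 A B i) by move: i => [|[|i]] //=; exact: measurable0.
have tF : trivIset setT (bigcup2 A B) by rewrite -trivIset_bigcup2.
have := @vm_sigma_additive _ _ _ _ mu (bigcup2 A B) mF tF.
rewrite bigcup2E => h.
have h' : (fun n => \sum_(0 <= i < n) mu (bigcup2 A B i)) @ \oo --> mu A + mu B.
  apply: cvg_near_cst; exists 2%N => // n /= n2.
  rewrite (big_cat_nat (n := 2))//= [X in _ + X]big_nat [X in _ + X]big1.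
    by rewrite addr0 big_nat_recr//= big_nat1.
  by move=> [|[|i]]//= _; exact: vm_fun0.
exact: (@cvg_unique _ (@norm_hausdorff R (hsop e)) _ _ _ _ h h').
Qed.

(** The values at [A] and at its complement both lie in the cone, so their inner product is
    nonnegative and adding the second cannot decrease the norm. This bounds all coordinates of [mu]
    at once. *)
Lemma vmeasure_norm_le A : measurable A -> `|mu A| <= `|mu setT|.
Proof.
move=> mA; have mCA : measurable (~` A) by exact: measurableC.
rewrite -(setUv A) vm_setU//; last exact: setICr.
rewrite -(ler_pXn2r (n := 2)) ?nnegrE// normD_sqr.
have := Hplus_inner_ge0 (mu_ge0 mA) (mu_ge0 mCA).
have := sqr_ge0 `|mu (~` A)|; lra.
Qed.

End vmeasure_cone.

(** * Measurability and Lipschitz bounds of the jump kernel *)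

Section borel.
Context (R : realType) (E : innerType R).

Lemma borel_continuous_measurable (T : ptopologicalType) (f : T -> R) :
  continuous f -> measurable_fun setT (f : borel T -> R).
Proof.
move=> /continuousP cf; apply: (measurability _ (RGenOpens.measurableE R)).
move=> _ [_ [a [b ->] <-]]; rewrite setTI.
by apply: sub_sigma_algebra; apply: cf; exact: interval_open.
Qed.

Lemma borel_inner_measurable u :
  measurable_fun setT ((fun xi => inner xi u) : borel E -> R).
Proof.
apply: borel_continuous_measurable => x.
by apply: inner_cvg; [exact: cvg_id|exact: cvg_cst].
Qed.

Lemma borel_norm_measurable : measurable_fun setT ((fun xi => `|xi|) : borel E -> R).
Proof. by apply: borel_continuous_measurable => x; exact: norm_continuous. Qed.

End borel.

Section jump.
Context (R : realType) (H : hilbertType R) (e : onb H).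
Local Notation Hp := (@Hplus R H e).
Local Notation Hp0 := (@Hplus0 R H e).

Lemma hsop_eval_continuous (h : H) : continuous (fun A : hsop e => A h).
Proof.
have [||_ //] := @bound_bounded_linear R (hsop e) H (fun A => A h) `|h|.
- by move=> a A C.
- by move=> A; rewrite mulrC hsop_norm_le.
Qed.

Lemma Hplus_closed : closed Hp.
Proof.
have -> : Hp = \bigcap_(h in setT) (fun A : hsop e => inner (A h) h) @^-1` [set x | 0 <= x].
  by apply/seteqP; split => [A pA h _|A pA h]; [exact: pA|exact: (pA h I)].
apply: closed_bigI => h _; apply: closed_comp => [A _|]; last exact: closed_ge.
by have c := @hsop_eval_continuous h A; exact: (inner_cvg c (cvg_cst h)).
Qed.

Lemma borel_closed_measurable (A : set (hsop e)) : closed A ->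
  measurable (A : set (borel (hsop e))).
Proof.
move=> cA; rewrite -(setCK A); apply: measurableC.
by apply: sub_sigma_algebra; exact: closed_openC.
Qed.

Lemma Hplus0_measurable : measurable (Hp0 : set (borel (hsop e))).
Proof.
apply: measurableD; first exact: borel_closed_measurable Hplus_closed.
apply: borel_closed_measurable.
exact/accessible_closed_set1/hausdorff_accessible/norm_hausdorff.
Qed.

Lemma jump_kernel_measurable (u : hsop e) :
  measurable_fun setT ((jump_kernel u) : borel (hsop e) -> R).
Proof.
have mi := borel_inner_measurable u.
apply: measurable_funD.
  apply: measurable_funB => //; apply: measurableT_comp => //.
  exact: measurableT_comp.
rewrite (_ : (fun _ => _) = fun xi : borel (hsop e) =>
  if `|xi : hsop e| <= 1 then inner xi u else 0).
  apply: measurable_fun_ifT => //.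
  apply: measurable_fun_ler => //; exact: borel_norm_measurable.
by apply/funext => xi; rewrite /chi; case: ifP => // _; rewrite inner0l.
Qed.

(** For r >= 0 the functions e^{-r} and e^{-r} - 1 + r have derivatives of size at most 1 and r.
    These mean value bounds are obtained from 1 + r <= e^r. *)
Let scalar_kernel (a b : R) : 0 <= a -> 0 <= b ->
  `|expR (- a) - expR (- b)| <= `|a - b| /\
  `|(expR (- a) - 1 + a) - (expR (- b) - 1 + b)| <= Num.max a b * `|a - b|.
Proof.
wlog ba : a b / b <= a.
  move=> h a0 b0; have [ba|ab] := orP (le_total b a); first exact: (h a b ba a0 b0).
  by have := h b a ab b0 a0; rewrite distrC (distrC b) (distrC (_ + b)) maxC.
move=> a0 b0; rewrite (max_idPl ba) (ger0_norm (x := a - b)) ?subr_ge0//.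
have e1 : 1 - (a - b) <= expR (- (a - b)) by rewrite expR_ge1Dx.
have e2 : 1 - a <= expR (- a) by rewrite expR_ge1Dx.
have e3 : 1 + (a - b) <= expR (a - b) by rewrite expR_ge1Dx.
have ea : expR (- a) = expR (- b) * expR (- (a - b)).
  by rewrite -expRD; congr expR; ring.
have eb : expR (- b) = expR (- a) * expR (a - b).
  by rewrite -expRD; congr expR; ring.
have b1 : expR (- b) <= 1 by rewrite -[leRHS]expR0 ler_expR; lra.
have pa := expR_gt0 (- a); have pb := expR_gt0 (- b).
have h1 : expR (- b) - expR (- a) <= a - b.
  rewrite ea; nra.
have h2 : expR (- a) <= expR (- b) by rewrite ler_expR; lra.
have h3 : (1 - a) * (a - b) <= expR (- b) - expR (- a).
  rewrite eb; nra.
split; first by rewrite distrC ger0_norm//; lra.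
by rewrite ger0_norm; [nra|lra].
Qed.

(** For |xi| <= 1 compensation makes the kernel quadratic; beyond, a linear bound suffices since
    |xi| <= |xi|^2. The factor |xi|^2 is integrable for m and cancels the weight |xi|^{-2} that goes
    with mu. *)
Lemma jump_kernel_lipschitz (u v xi : hsop e) K : Hp u -> Hp v -> Hp xi ->
  `|u| <= K -> `|v| <= K ->
  `|jump_kernel u xi - jump_kernel v xi| <= (1 + K) * `|xi| ^+ 2 * `|u - v|.
Proof.
move=> pu pv pxi uK vK.
have a0 := Hplus_inner_ge0 pxi pu; have b0 := Hplus_inner_ge0 pxi pv.
have [h1 h2] := scalar_kernel a0 b0.
have ab : `|inner xi u - inner xi v| <= `|xi| * `|u - v|.
  by rewrite -innerBr; exact: cauchy_schwarz.
have K0 : 0 <= K by apply: le_trans uK.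
have nx := normr_ge0 xi; have nuv := normr_ge0 (u - v).
rewrite /jump_kernel /chi; case: ifPn => [x1|].
  apply: le_trans h2 _.
  have m : Num.max (inner xi u) (inner xi v) <= `|xi| * K.
    rewrite ge_max; apply/andP; split; apply: le_trans (ler_norm _) _;
      apply: le_trans (cauchy_schwarz _ _) _; exact: ler_wpM2l.
  have m0 : 0 <= Num.max (inner xi u) (inner xi v) by rewrite le_max a0.
  apply: (@le_trans _ _ ((`|xi| * K) * (`|xi| * `|u - v|))).
    by apply: ler_pM.
  have : 0 <= `|xi| ^+ 2 * `|u - v| by rewrite mulr_ge0// sqr_ge0.
  lra.
rewrite -ltNge => x1; rewrite !inner0l !addr0.
rewrite (_ : _ - _ - _ = expR (- inner xi u) - expR (- inner xi v)); last by ring.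
apply: le_trans h1 _; apply: le_trans ab _.
have : `|xi| * `|u - v| <= `|xi| ^+ 2 * `|u - v|.
  by rewrite ler_wpM2r// expr2 ler_peMl// ltW.
have : 0 <= K * (`|xi| ^+ 2 * `|u - v|) by rewrite !mulr_ge0// sqr_ge0.
lra.
Qed.

Lemma jump_kernel_bound (u xi : hsop e) K : Hp u -> Hp xi -> `|u| <= K ->
  `|jump_kernel u xi| <= (1 + K) * `|xi| ^+ 2 * K.
Proof.
move=> pu pxi uK; have K0 : 0 <= K by apply: le_trans uK.
have := @jump_kernel_lipschitz u 0 xi K pu (Hplus_zero e) pxi uK.
rewrite normr0 subr0 => /(_ K0).
have -> : jump_kernel 0 xi = 0.
  by rewrite /jump_kernel !inner0r oppr0 expR0 subrr addr0.
rewrite subr0 => /le_trans; apply.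
by rewrite ler_wpM2l// mulr_ge0 ?sqr_ge0// addr_ge0.
Qed.

End jump.

Section riccati_functions.
Context (R : realType) (V H Vd : hilbertType R) (G : gelfand_triple V H Vd).
Context (e : onb H) (f : onb Vd) (p : params G e).
Hypothesis p_admissible : admissible f p.

Local Notation m := (par_m p).
Local Notation mu := (par_mu p).
Local Notation Hp := (@Hplus R H e).
Local Notation Hp0 := (@Hplus0 R H e : set (borel (hsop e))).

Let mu_ge0 A : measurable A -> Hp (mu A).
Proof. by have [_ _ [_ muH _] _] := p_admissible; exact: muH. Qed.

Let k (u xi : hsop e) : R := jump_kernel u xi * `|xi| ^- 2.

Let k_measurable u : measurable_fun Hp0 (k u : borel (hsop e) -> R).
Proof.
(* Away from 0, |xi|^{-2} is exp(-ln |xi|^2), a composition of measurable maps. *)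
apply: (eq_measurable_fun (fun xi : borel (hsop e) =>
    jump_kernel u xi * expR (- ln (`|xi : hsop e| ^+ 2)))).
  move=> xi; rewrite inE => -[_ /eqP xi0].
  by rewrite expRN lnK// posrE exprn_gt0// normr_gt0.
apply: measurable_funTS; apply: measurable_funM; first exact: jump_kernel_measurable.
apply: measurableT_comp => //; apply: measurableT_comp => //.
apply: measurableT_comp => //.
by apply: measurable_funX; exact: borel_norm_measurable.
Qed.

Let k_lipschitz u v xi K : Hp u -> Hp v -> Hp0 xi -> `|u| <= K -> `|v| <= K ->
  `|k u xi - k v xi| <= (1 + K) * `|u - v|.
Proof.
move=> pu pv [pxi /eqP xi0] uK vK; rewrite -mulrBl normrM.
have x0 : 0 < `|xi| ^+ 2 by rewrite exprn_gt0// normr_gt0.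
rewrite [`|_ ^- 2|]gtr0_norm ?invr_gt0// ler_pdivrMr//.
by rewrite mulrAC; exact: jump_kernel_lipschitz.
Qed.

Let k_bound u xi K : Hp u -> Hp0 xi -> `|u| <= K -> `|k u xi| <= (1 + K) * K.
Proof.
move=> pu [pxi /eqP xi0] uK; rewrite normrM.
have x0 : 0 < `|xi| ^+ 2 by rewrite exprn_gt0// normr_gt0.
rewrite [`|_ ^- 2|]gtr0_norm ?invr_gt0// ler_pdivrMr//.
by rewrite mulrAC; exact: jump_kernel_bound.
Qed.

(** [riccatiR] is picked by [xget], so its defining identity is available only once some solution
    exists. Riesz supplies one: the jump integral is linear and bounded in the test vector. *)
Lemma riccatiRE u x : Hp u ->
  inner (riccatiR p u) x = inner u (Gam p x) - fine (vint mu Hp0 (EFin \o k u) x).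
Proof.
move=> pu.
have [_ _ _ [_ [bG _ _] _ _]] := p_admissible.
have [C C0 GC] := bounded_linear_bound bG.
have mD := @Hplus0_measurable R H e.
have kb xi : Hp0 xi -> `|k u xi| <= (1 + `|u|) * `|u|.
  by move=> h; exact: k_bound.
have muM A : measurable A -> `|mu A| <= `|mu setT| by exact: vmeasure_norm_le.
have [W [WE W_lin Wb]] : exists W : hsop e -> R, [/\
    forall x, (W x)%:E = vint mu Hp0 (EFin \o k u) x, scalar W &
    forall x, `|W x| <= 2 * ((1 + `|u|) * `|u|) * `|mu setT| * `|x|].
  exists (fun x => fine (vint mu Hp0 (EFin \o k u) x)); split => [y||y].
  - by rewrite fineK//; exact: (vint_fin_num mu y mD (k_measurable u) kb).
  - exact: vint_scalar mD (k_measurable u) kb.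
  - apply: (vint_bound _ muM mD (k_measurable u)) => //.
rewrite -WE/=.
pose l x := inner u (Gam p x) - W x.
have [||r rl] := @riesz R (hsop e) l
   (`|u| * C + 2 * ((1 + `|u|) * `|u|) * `|mu setT|).
- move=> a y z; rewrite /l; have [lG _] := bG.
  by rewrite W_lin lG innerDr innerZr; ring.
- move=> y; rewrite /l mulrDl; apply: le_trans (ler_normB _ _) _; apply: lerD => //.
  apply: le_trans (cauchy_schwarz _ _) _; rewrite -mulrA.
  by apply: ler_wpM2l => //; exact: GC.
have : exists r : hsop e, [set r : hsop e | forall x,
    (inner r x)%:E = ((inner u (Gam p x))%:E
      - vint mu Hp0 (fun xi => (jump_kernel u xi * `|xi| ^- 2)%:E) x)%E] r.
  by exists r => y; rewrite rl /l EFinB WE.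
move=> /(xgetPex 0) /(_ x); rewrite -WE -EFinB => h.
exact: EFin_inj h.
Qed.

Lemma riccatiR_lipschitz K : 0 <= K -> exists2 L, 0 <= L &
  forall u v, Hp u -> Hp v -> `|u| <= K -> `|v| <= K ->
  `|riccatiR p u - riccatiR p v| <= L * `|u - v|.
Proof.
move=> K0; have [_ _ _ [_ [bG _ _] _ _]] := p_admissible.
have [C C0 GC] := bounded_linear_bound bG.
have mD := @Hplus0_measurable R H e.
have muM A : measurable A -> `|mu A| <= `|mu setT| by exact: vmeasure_norm_le.
exists (C + 2 * (1 + K) * `|mu setT|).
  by rewrite addr_ge0 ?(ltW C0)// !mulr_ge0// addr_ge0.
move=> u v pu pv uK vK.
apply: norm_le_inner.
  by rewrite !(mulr_ge0, addr_ge0)// ltW.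
move=> x.
have ku xi : Hp0 xi -> `|k u xi| <= (1 + K) * K by move=> h; exact: k_bound.
have kv xi : Hp0 xi -> `|k v xi| <= (1 + K) * K by move=> h; exact: k_bound.
have E := vintB mu x mD (k_measurable u) (k_measurable v) ku kv.
have kuv xi : Hp0 xi -> `|k u xi - k v xi| <= (1 + K) * `|u - v|.
  by move=> h; exact: k_lipschitz.
have Kuv : 0 <= (1 + K) * `|u - v| by rewrite mulr_ge0// addr_ge0.
have [wu wuE] : exists w, w = fine (vint mu Hp0 (EFin \o k u) x) by eexists.
have [wv wvE] : exists w, w = fine (vint mu Hp0 (EFin \o k v) x) by eexists.
have h : `|wu - wv| <= 2 * ((1 + K) * `|u - v|) * `|mu setT| * `|x|.
  rewrite wuE wvE E.
  apply: (@vint_bound _ _ _ _ mu `|mu setT| Hp0 (fun y => k u y - k v y)) => //.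
  exact: (measurable_funB (k_measurable u) (k_measurable v)).
suff main ru rv : inner ru x = inner u (Gam p x) - wu ->
    inner rv x = inner v (Gam p x) - wv ->
    inner (ru - rv) x <= (C + 2 * (1 + K) * `|mu setT|) * `|u - v| * `|x|.
  by apply: main; [rewrite wuE|rewrite wvE]; exact: riccatiRE.
rewrite innerBl => -> ->.
have -> : inner u (Gam p x) - wu - (inner v (Gam p x) - wv) =
  inner (u - v) (Gam p x) - (wu - wv) by rewrite innerBl; ring.
apply: le_trans (ler_norm _) _; apply: le_trans (ler_normB _ _) _.
apply: le_trans (lerD (cauchy_schwarz _ _) h) _.
have : `|u - v| * `|Gam p x| <= `|u - v| * (C * `|x|) by apply: ler_wpM2l.
move: {h} (`|mu setT|) (`|u - v|) (`|x|) (`|Gam p x|) => M d n g hg.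
have -> : (C + 2 * (1 + K) * M) * d * n = d * (C * n) + 2 * ((1 + K) * d) * M * n.
  by ring.
by rewrite lerD2r.
Qed.

Lemma riccatiF_lipschitz K : 0 <= K -> exists2 L, 0 <= L &
  forall u v, Hp u -> Hp v -> `|u| <= K -> `|v| <= K ->
  `|riccatiF p u - riccatiF p v| <= L * `|u - v|.
Proof.
move=> K0; have [[_ m2 _ _] _ _ _] := p_admissible.
have mD := @Hplus0_measurable R H e.
have mn : measurable_fun Hp0 ((fun xi => `|xi| ^+ 2) : borel (hsop e) -> R).
  by apply: measurable_funTS; apply: measurable_funX; exact: borel_norm_measurable.
have ni : m.-integrable Hp0 (fun xi => (`|xi : hsop e| ^+ 2)%:E).
  apply/integrableP; split; first exact/measurable_EFinP.
  rewrite (le_lt_trans _ m2)//.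
  under eq_integral do rewrite /= ger0_norm ?sqr_ge0//; exact: lexx.
have cni (c : R) : m.-integrable Hp0 (fun xi => (c * `|xi : hsop e| ^+ 2)%:E).
  exact: (integrableZl mD c ni).
have ji u : Hp u -> m.-integrable Hp0 (EFin \o jump_kernel u).
  move=> pu; apply: (le_integrable _ _ _ (cni ((1 + `|u|) * `|u|))) => //.
    by apply/measurable_EFinP; apply: measurable_funTS; exact: jump_kernel_measurable.
  move=> xi [pxi _]; rewrite /= lee_fin; apply: (le_trans _ (ler_norm _)).
  by rewrite mulrAC; exact: jump_kernel_bound.
exists (`|par_b p| + (1 + K) * \int[m]_(xi in Hp0) (`|xi : hsop e| ^+ 2)).
  rewrite addr_ge0// mulr_ge0 ?addr_ge0//.
  by apply: Rintegral_ge0 => xi _; exact: sqr_ge0.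
move=> u v pu pv uK vK.
rewrite /riccatiF (_ : _ - _ - (_ - _) = inner (par_b p) (u - v) -
  \int[m]_(xi in Hp0) (jump_kernel u xi - jump_kernel v xi)); last first.
  by rewrite (RintegralB mD (ji u pu) (ji v pv)) innerBr; ring.
apply: le_trans (ler_normB _ _) _; rewrite mulrDl; apply: lerD.
  exact: cauchy_schwarz.
have jd : m.-integrable Hp0 (EFin \o (fun xi => jump_kernel u xi - jump_kernel v xi)).
  exact: (integrableB mD (ji u pu) (ji v pv)).
apply: le_trans (le_normr_Rintegral mD jd) _.
rewrite mulrAC -(RintegralZl _ mD ni).
apply: le_Rintegral => //; [exact: integrable_norm jd|exact: cni|].
move=> xi [pxi _]; rewrite mulrAC; exact: jump_kernel_lipschitz.
Qed.

End riccati_functions.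

(** * Mild solutions over one time step *)

Section bochner.
Context (R : realType) (E : hilbertType R).
Local Notation leb := (@lebesgue_measure R).

Lemma bochner_inner_integrable (D : set R) (g : R -> E) (r x : E) :
  measurable D -> is_bochner D g r ->
  leb.-integrable D (fun s => (inner (g s) x)%:E).
Proof.
move=> mD [mg gi _].
have mnorm : measurable_fun D (fun s => `|g s|).
  exact: (measurableT_comp (@borel_norm_measurable R E) mg).
have ni : leb.-integrable D (fun s => `|g s|%:E).
  apply/integrableP; split; first exact/measurable_EFinP.
  rewrite (le_lt_trans _ gi)//.
  by under eq_integral do rewrite /= ger0_norm//; exact: lexx.
have ni2 : leb.-integrable D (fun s => (`|x| * `|g s|)%:E).
  by have := @integrableZl _ _ R leb D mD `|x| _ ni.
apply: (le_integrable _ _ _ ni2) => //.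
  apply/measurable_EFinP.
  exact: (measurableT_comp (@borel_inner_measurable R E x) mg).
move=> s _; rewrite /= lee_fin (ger0_norm (mulr_ge0 _ _))// mulrC.
exact: cauchy_schwarz.
Qed.

Lemma bochner_dist (a b : R) (g : R -> E) (r y : E) (eps : R) : a <= b ->
  0 <= eps -> is_bochner `[a, b] g r ->
  (forall s : R, a <= s <= b -> `|g s - y| <= eps) ->
  `|r - (b - a) *: y| <= eps * (b - a).
Proof.
move=> ab e0 hr gy; apply: norm_le_inner; first by rewrite mulr_ge0// subr_ge0.
move=> x; have ix := bochner_inner_integrable x (measurable_itv _) hr.
have [_ _ rE] := hr; rewrite innerBl innerZl rE.
apply: le_trans (ler_norm _) _; rewrite mulrAC.
apply: Rintegral_dist => // s sab; rewrite -innerBl.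
by apply: le_trans (cauchy_schwarz _ _) _; rewrite ler_wpM2r// gy.
Qed.

Lemma bochner_bound (a b : R) (g : R -> E) (r : E) (K : R) : a <= b ->
  0 <= K -> is_bochner `[a, b] g r ->
  (forall s : R, a <= s <= b -> `|g s| <= K) -> `|r| <= K * (b - a).
Proof.
move=> ab K0 hr gK; have := @bochner_dist a b g r 0 K ab K0 hr.
by rewrite scaler0 subr0; apply=> s /gK; rewrite subr0.
Qed.

(** Applying [T h] to the integral over [0, tau] reproduces the first part of the integral over
    [0, tau + h], so only the last step is left. Bochner integrals are tested weakly here, hence
    [T h] is moved onto the test vector, where x' plays the role of its adjoint image. *)
Lemma mild_increment (T : R -> E -> E) (n : R -> E) (tau h : R) (r1 r2 y : E)
    (eps : R) : C0_semigroup T -> 0 <= tau -> 0 <= h -> 0 <= eps ->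
  is_bochner `[0, tau + h] (fun s => T (tau + h - s) (n s)) r1 ->
  is_bochner `[0, tau] (fun s => T (tau - s) (n s)) r2 ->
  (forall s : R, tau <= s <= tau + h -> `|T (tau + h - s) (n s) - y| <= eps) ->
  `|r1 - T h r2 - h *: y| <= eps * h.
Proof.
move=> [_ TD lT _] tau0 h0 e0 b1 b2 hy.
apply: norm_le_inner; first exact: mulr_ge0.
move=> x; have [C C0 TC] := bounded_linear_bound (lT h h0).
have [||x' x'E] := @riesz R E (fun z => inner (T h z) x) (C * `|x|).
- by move=> a u v; have [lin _] := lT h h0; rewrite lin innerDl innerZl.
- move=> z; apply: le_trans (cauchy_schwarz _ _) _.
  by rewrite mulrAC ler_wpM2r.
have [_ _ E1] := b1; have [_ _ E2] := b2.
rewrite !innerBl innerZl E1 -(x'E r2) innerC E2.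
have -> : \int[leb]_(s in `[0, tau]) inner (T (tau - s) (n s)) x' =
          \int[leb]_(s in `[0, tau]) inner (T (tau + h - s) (n s)) x.
  apply: eq_Rintegral => s; rewrite inE/= in_itv/= => /andP[s0 st].
  by rewrite innerC x'E -TD ?subr_ge0//; congr (inner (T _ _) _); ring.
have i1 := bochner_inner_integrable x (measurable_itv _) b1.
have th : tau <= tau + h by rewrite lerDl.
rewrite (Rintegral_chasles tau0 th i1).
set A := (\int[leb]_(s in `[0, tau]) _); rewrite (addrC A) addrK {A}.
apply: le_trans (ler_norm _) _.
have := @Rintegral_dist R (fun s => inner (T (tau + h - s) (n s)) x) tau (tau + h)
  (inner y x) (eps * `|x|) th.
rewrite (addrC tau) addrK mulrAC (addrC h); apply.
  apply: integrableS i1 => //.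
  by move=> s; rewrite /= !in_itv/= => /andP[ts ->]; rewrite (le_trans tau0 ts).
move=> s hs; rewrite -innerBl; apply: le_trans (cauchy_schwarz _ _) _.
by rewrite ler_wpM2r// hy.
Qed.

End bochner.

Section loclip.
Context (R : realType) (E W : normedModType R) (C : set E).

Definition loc_lipschitz (N : E -> W) := forall K : R, 0 <= K -> exists2 L : R,
  0 <= L & forall u v, C u -> C v -> `|u| <= K -> `|v| <= K ->
  `|N u - N v| <= L * `|u - v|.

Lemma loc_lipschitz_continuous (N : E -> W) (c : R -> E) : loc_lipschitz N ->
  (forall s, C (c s)) -> continuous c -> continuous (N \o c).
Proof.
move=> NL Cc cc s; apply/cvgrPdist_le => eps eps0 /=.
have [|L L0 hL] := NL (`|c s| + 1); first by rewrite addr_ge0.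
have L1 : 0 < L + 1 by rewrite ltr_wpDl.
near=> r.
have h1 : `|c s - c r| <= 1.
  by near: r; have /cvgrPdist_le := cc s; apply.
have h2 : `|c s - c r| <= eps / (L + 1).
  by near: r; have /cvgrPdist_le := cc s; apply; rewrite divr_gt0.
apply: le_trans (hL _ _ (Cc s) (Cc r) _ _) _.
- by rewrite lerDl.
- by rewrite -[c r](subKr (c s)) (le_trans (ler_normB _ _))// lerD2l.
- apply: (@le_trans _ _ (L * (eps / (L + 1)))); first exact: ler_wpM2l.
  by rewrite mulrA ler_pdivrMr// mulrC ler_pM2l// lerDl.
Unshelve. all: by end_near. Qed.

End loclip.

(** Bootstrap: the bound 1 up to s improves to 1/2 at s, and uniform continuity allows a gain of at
    most 1/2 over a length eta, so the bound 1 propagates in finitely many steps. *)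
Lemma continuous_step_induction (R : realType) (q : R -> R) (b : R) :
  continuous q -> 0 <= b -> q 0 <= 1 ->
  (forall s : R, 0 <= s <= b -> (forall r : R, 0 <= r <= s -> q r <= 1) -> q s <= 2^-1) ->
  forall s : R, 0 <= s <= b -> q s <= 1.
Proof.
move=> cq b0 q0 hq.
have [eta eta0 heta] := @unif_continuous R R q 0 b 2^-1 cq (ltac:(by rewrite invr_gt0)).
have step n : forall s : R, 0 <= s <= b -> s <= n%:R * eta -> q s <= 1.
  elim: n => [|n ih] s /andP[s0 sb] sn.
    by rewrite (_ : s = 0)//; apply/eqP; rewrite eq_le s0 -(mul0r eta) sn.
  have [sn'|ns] := leP s (n%:R * eta); first by apply: ih => //; rewrite s0.
  pose s' := n%:R * eta.
  have s'0 : 0 <= s' by rewrite mulr_ge0// ltW.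
  have hs' : q s' <= 2^-1.
    apply: hq => [|r /andP[r0 rs]]; first by rewrite s'0 (le_trans (ltW ns)).
    by apply: ih => //; rewrite r0 (le_trans rs)// (le_trans (ltW ns)).
  have : `|q s - q s'| <= 2^-1.
    apply: heta; first by rewrite s0.
    rewrite gtr0_norm ?subr_gt0//.
    by move: sn; rewrite /s' -natr1 mulrDl mul1r lerBlDl.
  by move=> /(le_trans (ler_norm _)); lra.
move=> s s0b; apply: (step (Num.truncn (s / eta)).+1) => //.
by rewrite -ler_pdivrMr// ltW// truncnS_gt.
Qed.

Section riccati_step.
Context (R : realType) (E : hilbertType R) (C : set E).
Context (T : R -> E -> E) (N : E -> E) (F : E -> R).
Hypotheses (T_semigroup : C0_semigroup T) (C0 : C 0).
Hypotheses (N_lip : loc_lipschitz C N) (F_lip : loc_lipschitz C (F : E -> R^o)).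
Context (psi : R -> E -> E) (phi : R -> E -> R).
Hypothesis psi_cont : forall w, C w -> {within `[0, +oo[, continuous (psi ^~ w)}.
Hypothesis psi_C : forall w (s : R), C w -> 0 <= s -> C (psi s w).
Hypothesis psi_mild : forall w (s : R), C w -> 0 <= s ->
  is_bochner `[0, s] (fun r => T (s - r) (N (psi r w))) (psi s w - T s w).
Hypothesis phiE : forall w (s : R), C w -> 0 <= s ->
  phi s w = \int[lebesgue_measure]_(r in `[0, s]) F (psi r w).
Context (t : R) (g c : R -> E) (Phi : R -> R).
Hypothesis g_cont : continuous g.
Hypothesis c_cont : {within `[0, +oo[, continuous c}.
Hypothesis c_C : forall s : R, 0 <= s -> C (c s).
Hypothesis c_mild : forall s : R, 0 <= s ->
  is_bochner `[0, s] (fun r => T (s - r) (N (c r) + 2^-1 *: g r)) (c s - T s (c 0)).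
Hypothesis PhiE : forall s : R, 0 <= s ->
  Phi s = \int[lebesgue_measure]_(r in `[0, s]) F (c r).

Let cl (f : R -> E) (s : R) := f (Num.max 0 s).
Let clE f (s : R) : 0 <= s -> cl f s = f s.
Proof. by move=> s0; rewrite /cl (max_idPr s0). Qed.
Let cC s : C (cl c s). Proof. by apply: c_C; rewrite le_max lexx. Qed.
Let cc : continuous (cl c). Proof. exact: clamp_continuous. Qed.

Let psi0 w : C w -> psi 0 w = w.
Proof.
move=> Cw; have [TE _ _ _] := T_semigroup.
pose h r := T (0 - r) (N (psi r w)).
have h0 : is_bochner `[0, 0] h (psi 0 w - T 0 w) := psi_mild Cw (lexx 0).
have := @bochner_dist R E 0 0 h (psi 0 w - T 0 w) (h 0) 0 (lexx _) (lexx _) h0.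
rewrite subr0 scale0r subr0 mulr0 TE normr_le0 subr_eq0 => /(_ _)/eqP -> // s.
by rewrite -eq_le => /eqP <-; rewrite subrr normr0.
Qed.

Let T_bound : exists2 M : R, 1 <= M & forall (r : R) x, 0 <= r <= 1 -> `|T r x| <= M * `|x|.
Proof. exact: semigroup_bounded. Qed.

Let T_orbit (f : R -> E) (eps : R) : continuous f -> 0 < eps ->
  exists2 d : R, 0 < d & forall x y r : R, 0 <= x <= t -> `|x - y| <= d ->
    0 <= r <= d -> `|T r (f x) - f y| <= eps.
Proof.
have [M M1 TM] := T_bound.
move=> cf eps0; apply: (@unif_orbit R E T f 0 t M 1 eps) => //.
- by apply: lt_le_trans M1.
- move=> r x y /[dup] r01 /andP[r0 _].
  have [_ _ lT _] := T_semigroup.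
  by rewrite -(bounded_linearB _ _ (lT r r0)) TM.
- by move=> y e0 e00; exact: semigroup_cvg0.
Qed.

(** [N] is only locally Lipschitz, so the flow is first confined to distance 1 from its start by the
    bootstrap; there [N] is bounded and the mild equation is a small perturbation of the orbit under
    [T]. Compactness of the curve [c] on [0, t] gives uniformity in tau. *)
Let psi_near (eps : R) : 0 < eps -> exists2 d : R, 0 < d &
  forall tau s : R, 0 <= tau <= t -> 0 <= s <= d -> `|psi s (c tau) - c tau| <= eps.
Proof.
move=> eps0.
have [M M1 TM] := T_bound.
have M0 : 0 < M by apply: lt_le_trans M1.
have [K K0 cK] := continuous_bounded 0 t cc.
have [|L L0 NL] := N_lip (K := K + 1); first by rewrite addr_ge0.
pose B := `|N 0| + L * (K + 1).
have B0 : 0 <= B by rewrite addr_ge0// mulr_ge0// addr_ge0.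
have NB v : C v -> `|v| <= K + 1 -> `|N v| <= B.
  move=> Cv vK; rewrite -[N v](subrKC (N 0)) (le_trans (ler_normD _ _))// lerD2l.
  apply: le_trans (NL _ _ Cv C0 vK _) _; first by rewrite normr0 addr_ge0.
  by rewrite subr0 ler_wpM2l.
pose ep := Num.min eps 1.
have ep0 : 0 < ep by rewrite lt_min eps0 ltr01.
have [ep1 ep2] : ep <= 1 /\ ep <= eps by rewrite !ge_min !lexx orbT.
have ep4 : 0 < ep / 4 by rewrite divr_gt0.
have [d1 d10 hd1] := T_orbit cc ep4.
have MB : 0 < 4 * (M * B + 1) by rewrite mulr_gt0// ltr_wpDl// mulr_ge0// ltW.
(* The orbit and the integral term cost at most ep / 4 each, so the displacement stays below ep / 2
   <= 1 / 2, as the bootstrap asks. *)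
pose d := Num.min (Num.min 1 d1) (ep / (4 * (M * B + 1))).
have d0 : 0 < d by rewrite !lt_min ltr01 d10 divr_gt0.
exists d => // tau s taut sd.
have w0 : 0 <= tau by case/andP: taut.
set w := c tau; have Cw : C w by exact: c_C.
have wK : `|w| <= K by have := cK _ taut; rewrite clE.
pose q r := `|cl (psi^~ w) r - w|.
have cq : continuous q.
  move=> r; apply: cvg_norm; apply: cvgB; last exact: cvg_cst.
  exact: (clamp_continuous (psi_cont Cw)).
have key (r : R) : 0 <= r <= d -> (forall r' : R, 0 <= r' <= r -> q r' <= 1) ->
    q r <= ep / 2.
  move=> /andP[r0]; rewrite !le_min => /andP[/andP[r1 rd1] rep] hr.
  rewrite /q clE//.
  have -> : psi r w - w = (psi r w - T r w) + (T r w - w) by rewrite addrA subrK.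
  apply: le_trans (ler_normD _ _) _.
  have h1 : `|T r w - w| <= ep / 4.
    have := hd1 tau tau r taut; rewrite clE// subrr normr0 r0 rd1 => -> //.
    exact: ltW.
  have h2 : `|psi r w - T r w| <= M * B * (r - 0).
    apply: bochner_bound (psi_mild Cw r0) _ => //; first by rewrite mulr_ge0// ltW.
    move=> r' /andP[r'0 r'r].
    apply: le_trans (TM _ _ _) _; first by lra.
    rewrite ler_pM2l//; apply: NB; first exact: psi_C.
    have := hr r'; rewrite r'0 r'r /q clE// => /(_ erefl) h.
    by rewrite -[psi r' w](subrKC w) (le_trans (ler_normD _ _))// lerD.
  have : r * (4 * (M * B + 1)) <= ep by rewrite -ler_pdivlMr.
  have : 0 <= M * B by rewrite mulr_ge0// ltW.
  move: (M * B) h1 h2 => MB' h1 h2; nra.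
have qle r : 0 <= r <= d -> q r <= 1.
  apply: (continuous_step_induction cq (ltW d0)).
    by rewrite /q clE// psi0// subrr normr0.
  by move=> s0 hs0 hs1; apply: le_trans (key _ hs0 hs1) _; lra.
have : q s <= ep / 2.
  apply: key => // r /andP[r0 rs]; apply: qle.
  by rewrite r0 (le_trans rs)//; case/andP: sd.
by rewrite /q clE; [lra|case/andP: sd].
Qed.

(** T(h) c(tau) is common to both mild equations and cancels; the remaining integrands are nearly
    constant over the step and differ by g / 2. The source is taken at tau + h because, for tau = t
    - s_{j+1}, this is the time t - s_j at which it is paired with X_{s_j}. *)
Lemma riccati_step (eps : R) : 0 < eps -> exists2 d : R, 0 < d &
  forall tau h : R, 0 <= tau -> 0 <= h <= d -> tau + h <= t ->
  `|c (tau + h) - psi h (c tau) - (2^-1 * h) *: g (tau + h)| <= eps * h /\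
  `|Phi (tau + h) - Phi tau - phi h (c tau)| <= eps * h.
Proof.
move=> eps0.
have [K K0 cK] := continuous_bounded 0 t cc.
have [|L L0 NL] := N_lip (K := K + 1); first by rewrite addr_ge0.
have [|LF LF0 FL] := F_lip (K := K + 1); first by rewrite addr_ge0.
have [M M1 TM] := T_bound.
have M0 : 0 < M by apply: lt_le_trans M1.
have cN : continuous (N \o cl c) by exact: (loc_lipschitz_continuous N_lip).
have cF : continuous (F \o cl c).
  exact: (@loc_lipschitz_continuous R E R^o C F (cl c) F_lip).
pose n s := N (cl c s) + 2^-1 *: g s.
have cn : continuous n.
  move=> s; apply: cvgD; first exact: cN.
  by apply: cvgZl_tmp; exact: g_cont.
have e4 : 0 < eps / 4 by rewrite divr_gt0.
have e8 : 0 < eps / 8 by rewrite divr_gt0.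
have [d1 d10 h1] := T_orbit cn e4.
have [d2 d20 h2] := T_orbit cN e8.
have [d3 d30 h3] := unif_continuous 0 t cF e4.
have [d4 d40 h4] := unif_continuous 0 t cN e4.
(* The displacement allowed to the flow: 1 keeps it in the ball of radius K + 1, the other two
   bounds make M * L * ee <= eps / 8 and LF * ee <= eps / 4. *)
pose ee := Num.min 1 (Num.min (eps / (8 * (M * L + 1))) (eps / (4 * (LF + 1)))).
have ML : 0 < 8 * (M * L + 1) by rewrite mulr_gt0// ltr_wpDl// mulr_ge0// ltW.
have LF4 : 0 < 4 * (LF + 1) by rewrite mulr_gt0// ltr_wpDl.
have ee0 : 0 < ee by rewrite !lt_min ltr01 !divr_gt0.
have ee1 : ee <= 1 by rewrite ge_min lexx.
have ee2 : ee * (8 * (M * L + 1)) <= eps.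
  by rewrite -ler_pdivlMr// !ge_min lexx orbT.
have ee3 : ee * (4 * (LF + 1)) <= eps.
  by rewrite -ler_pdivlMr// !ge_min lexx !orbT.
have [d5 d50 h5] := psi_near ee0.
pose d := Num.min 1 (Num.min (Num.min d1 d2) (Num.min d3 (Num.min d4 d5))).
exists d; first by rewrite !lt_min ltr01 d10 d20 d30 d40 d50.
move=> tau h tau0 /andP[hh0]; rewrite !le_min.
move=> /and4P[hh1 /andP[hd1 hd2] hd3 /andP[hd4 hd5]] tht.
have taut : 0 <= tau <= t by rewrite tau0 (le_trans _ tht)// lerDl.
have th0 : 0 <= tau + h by rewrite addr_ge0.
have thtt : 0 <= tau + h <= t by rewrite th0.
set w := c tau; have Cw : C w by exact: c_C.
have wK : `|w| <= K by have := cK _ taut; rewrite clE.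
have near_w (s : R) : 0 <= s <= h -> `|psi s w - w| <= ee.
  by move=> /andP[s0 sh]; apply: h5 => //; rewrite s0 (le_trans sh).
have psiK (s : R) : 0 <= s <= h -> `|psi s w| <= K + 1.
  move=> sh; rewrite -[psi s w](subrKC w) (le_trans (ler_normD _ _))// lerD//.
  exact: le_trans (near_w _ sh) _.
split.
- have A1 : `|(c (tau + h) - T (tau + h) (c 0)) - T h (c tau - T tau (c 0))
       - h *: n (tau + h)| <= eps / 4 * h.
    apply: (mild_increment T_semigroup tau0 hh0 (ltW e4) (c_mild th0) (c_mild tau0)).
    move=> s /andP[ts sth].
    have -> : N (c s) + 2^-1 *: g s = n s.
      by rewrite /n clE// (le_trans tau0).
    apply: h1; first by lra.
      by rewrite distrC ger0_norm ?subr_ge0//; lra.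
    by lra.
  have [_ TD lT _] := T_semigroup.
  have E1 : (c (tau + h) - T (tau + h) (c 0)) - T h (c tau - T tau (c 0)) =
      c (tau + h) - T h w.
    rewrite (bounded_linearB _ _ (lT h hh0)) -TD// (addrC h) opprB addrA.
    by rewrite subrK.
  rewrite {}E1 in A1.
  have A2 : `|psi h w - T h w - (h - 0) *: N w| <= eps / 4 * (h - 0).
    apply: bochner_dist (psi_mild Cw hh0) _ => //; first exact: ltW.
    move=> s /andP[s0 sh].
    have hs0 : 0 <= h - s by rewrite subr_ge0.
    have -> : T (h - s) (N (psi s w)) - N w =
        T (h - s) (N (psi s w) - N w) + (T (h - s) (N w) - N w).
      by rewrite (bounded_linearB _ _ (lT _ hs0)) addrA subrK.
    apply: le_trans (ler_normD _ _) _.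
    have B1 : `|T (h - s) (N w) - N w| <= eps / 8.
      have := h2 tau tau (h - s) taut.
      by rewrite /= clE// subrr normr0; apply; [exact: ltW|lra].
    have B2 : `|T (h - s) (N (psi s w) - N w)| <= M * (L * ee).
      apply: le_trans (TM _ _ _) _; first by lra.
      rewrite ler_pM2l//.
      have sh' : 0 <= s <= h by rewrite s0.
      apply: le_trans (NL _ _ (psi_C Cw s0) Cw (psiK _ sh') _) _; first by lra.
      by rewrite ler_wpM2l// near_w.
    have : 0 <= M * L by rewrite mulr_ge0// ltW.
    move: ee2 B2; rewrite (mulrA M L ee); move: (M * L) => ML' ? ? ?; lra.
  rewrite subr0 in A2.
  have A3 : `|N (c (tau + h)) - N w| <= eps / 4.
    have := h4 (tau + h) tau thtt; rewrite /= !clE//; apply.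
    by rewrite addrC addKr ger0_norm.
  (* [A1], [A2] and [A3] cost eps h / 4 each; the last one moves [N] from c(tau + h) back to
     c(tau). *)
  have -> : c (tau + h) - psi h w - (2^-1 * h) *: g (tau + h) =
     (c (tau + h) - T h w - h *: n (tau + h)) - (psi h w - T h w - h *: N w)
      + h *: (N (c (tau + h)) - N w).
    apply: inner_ext => v; rewrite /n clE//.
    by rewrite !(innerBl, innerDl, innerZl); ring.
  apply: le_trans (ler_normD _ _) _.
  apply: le_trans (lerD (ler_normB _ _) (lexx _)) _.
  rewrite normrZ (ger0_norm hh0).
  have := ler_wpM2l hh0 A3; have := mulr_ge0 (ltW eps0) hh0; lra.
- have iF a b : lebesgue_measure.-integrable `[a, b] (EFin \o (F \o cl c)).
    exact: continuous_integrable.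
  have PhiE' (s : R) : 0 <= s ->
      Phi s = \int[lebesgue_measure]_(r in `[0, s]) (F \o cl c) r.
    move=> s0; rewrite PhiE//; apply: eq_Rintegral => r.
    by rewrite inE/= in_itv/= => /andP[r0 _]; rewrite clE.
  rewrite !PhiE'//.
  have th : tau <= tau + h by rewrite lerDl.
  rewrite (Rintegral_chasles tau0 th (iF 0 (tau + h))).
  set A := (\int[lebesgue_measure]_(x in `[0, tau]) _); rewrite (addrC A) addrK {A}.
  have C1 := @Rintegral_dist R (F \o cl c) tau (tau + h) (F w) (eps / 4) th (iF _ _).
  have {}C1 : `|\int[lebesgue_measure]_(x in `[tau, tau + h]) (F \o cl c) x -
     (tau + h - tau) * F w| <= eps / 4 * (tau + h - tau).
    apply: C1 => s /andP[s1 s2]; have := h3 s tau.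
    rewrite /= (clE c tau0); apply; first by lra.
    by rewrite ger0_norm ?subr_ge0//; lra.
  have C2 : `|phi h w - (h - 0) * F w| <= eps / 4 * (h - 0).
    rewrite phiE//.
    have -> : \int[lebesgue_measure]_(r in `[0, h]) F (psi r w) =
        \int[lebesgue_measure]_(r in `[0, h]) (F \o cl (psi^~ w)) r.
      apply: eq_Rintegral => r.
      by rewrite inE/= in_itv/= => /andP[r0 _]; rewrite clE.
    apply: Rintegral_dist => //.
      apply: continuous_integrable.
      apply: (@loc_lipschitz_continuous R E R^o C F (cl (psi^~ w)) F_lip).
        by move=> s; apply: psi_C => //; rewrite le_max lexx.
      exact: (clamp_continuous (psi_cont Cw)).
    move=> s sh; rewrite /= clE; last by case/andP: sh.
    apply: le_trans (FL _ _ _ Cw (psiK _ sh) _) _; [|by lra|].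
      by apply: psi_C => //; case/andP: sh.
    apply: (@le_trans _ _ (LF * ee)); first by rewrite ler_wpM2l// near_w.
    nra.
  rewrite subr0 in C2; rewrite (addrC tau) addrK in C1.
  rewrite (addrC h tau) in C1.
  move: C1 C2; rewrite !ler_norml; lra.
Qed.

End riccati_step.

(** * Riemann sums along cadlag paths *)

Lemma Rintegral_sum d (T : measurableType d) (R : realType)
    (mu : {measure set T -> \bar R}) (D : set T) (f : nat -> T -> R) n :
  measurable D -> (forall i, mu.-integrable D (EFin \o f i)) ->
  mu.-integrable D (EFin \o (fun x => \sum_(0 <= i < n) f i x)) /\
  \int[mu]_(x in D) (\sum_(0 <= i < n) f i x) =
  \sum_(0 <= i < n) \int[mu]_(x in D) f i x.
Proof.
move=> mD fi; elim: n => [|n [ih1 ih2]].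
  rewrite big_geq//; split.
    rewrite (_ : _ \o _ = fun=> 0%E); first exact: integrable0.
    by apply/funext => x /=; rewrite big_geq.
  rewrite (eq_Rintegral _ (g := fun=> 0)) => [|x _]; last by rewrite big_geq.
  by rewrite Rintegral_cst// mul0r.
have E x : \sum_(0 <= i < n.+1) f i x = \sum_(0 <= i < n) f i x + f n x.
  by rewrite big_nat_recr.
split.
  rewrite (_ : _ \o _ = EFin \o (fun x => \sum_(0 <= i < n) f i x + f n x)).
    exact: (integrableD mD ih1 (fi n)).
  by apply/funext => x /=; rewrite E.
rewrite (eq_Rintegral _ (g := fun x => \sum_(0 <= i < n) f i x + f n x)); last first.
  by move=> x _; exact: E.
by rewrite RintegralD// ih2 big_nat_recr.
Qed.

Lemma bounded_convergence d (T : measurableType d) (R : realType)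
    (mu : {measure set T -> \bar R}) (D : set T) (f : nat -> T -> R) (g : T -> R)
    (K : R) : measurable D -> (mu D < +oo)%E ->
  (forall n, measurable_fun D (f n)) -> measurable_fun D g ->
  (forall x, D x -> f ^~ x @ \oo --> g x) ->
  (forall n x, D x -> `|f n x| <= K) ->
  (fun n => \int[mu]_(x in D) f n x) @ \oo --> \int[mu]_(x in D) g x.
Proof.
move=> mD Dfin mf mg fg fK.
have Ki : mu.-integrable D (fun=> K%:E).
  apply: (measurable_bounded_integrable (mu := mu)) => //.
  exists `|K|; split; first exact: num_real.
  by move=> M KM r _ /=; exact: ltW.
have fi n : mu.-integrable D (EFin \o f n).
  apply: (le_integrable mD _ _ Ki); first exact/measurable_EFinP.
  by move=> x Dx; rewrite /= lee_fin (le_trans (fK n x Dx))// ler_norm.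
have [gi _ h] : [/\ mu.-integrable D (EFin \o g),
   [sequence \int[mu]_(x in D) `|(EFin \o f n) x - (EFin \o g) x|]_n @ \oo --> 0 &
   [sequence \int[mu]_(x in D) (EFin \o f n) x]_n @ \oo -->
     \int[mu]_(x in D) (EFin \o g) x]%E.
  apply: (@dominated_convergence _ _ R mu D mD _ _ (fun=> K%:E)) => //.
  - by move=> n; exact/measurable_EFinP.
  - exact/measurable_EFinP.
  - by apply: aeW => x Dx; apply: cvg_EFin; [exact: nearW|exact: fg].
  - by apply: aeW => x n Dx; rewrite /= lee_fin fK.
rewrite /Rintegral; apply: fine_cvg; rewrite fineK ?integrable_fin_num//.
Qed.

Section cadlag.
Context (R : realType).

(** Right continuity and the left limit bound the path near each point, and compactness of [0, t]
    makes the bound uniform. At r0 <= 0 the left side is vacuous. *)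
Lemma cadlag_bounded (E : normedModType R) (x : R -> E) (t : R) : cadlag x ->
  exists2 K, 0 <= K & forall r : R, 0 <= r <= t -> `|x r| <= K.
Proof.
move=> [xr xl].
pose P (K r : R) := 0 <= r -> `|x r| <= K.
have : \forall K \near +oo, `[0, t]%classic `<=` P K.
  have /compact_near_coveringP := @segment_compact R 0 t; apply => r0 /=.
  rewrite in_itv/= => /andP[r00 _].
  have hR : \forall r \near r0, r0 < r -> `|x r| <= `|x r0| + 1.
    have /cvgrPdist_le/(_ 1 ltr01) := xr r0 r00.
    rewrite near_withinE; apply: filterS => r hr /hr hr1.
    by rewrite -[x r](subKr (x r0)) (le_trans (ler_normB _ _))// lerD2l.
  have [K hL] : exists K, \forall r \near r0, r < r0 -> 0 <= r -> `|x r| <= K.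
    have [r0p|r0n] := ltP 0 r0.
      have /cvg_ex[l xl0] := xl r0 r0p.
      exists (`|l| + 1).
      have : \forall r \near r0, r < r0 -> `|x r| <= `|l| + 1.
        have /cvgrPdist_le/(_ 1 ltr01) := xl0.
        rewrite near_withinE; apply: filterS => r hr /hr hr1.
        by rewrite -[x r](subKr l) (le_trans (ler_normB _ _))// lerD2l.
      by apply: filterS => r hr rr0 _; exact: hr.
    exists 0; near=> r => rr0 r0'.
    by have := lt_le_trans rr0 r0n; rewrite ltNge r0'.
  near=> r M; rewrite /P/= => r0'.
  have [rr|rr|<-] := ltgtP r0 r.
  - apply: (@le_trans _ _ (`|x r0| + 1)); last by near: M; exact: nbhs_pinfty_ge.
    by move: rr; near: r.
  - apply: (@le_trans _ _ K); last by near: M; apply: nbhs_pinfty_ge; exact: num_real.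
    by move: rr r0'; near: r.
  - apply: (@le_trans _ _ (`|x r0| + 1)); last by near: M; exact: nbhs_pinfty_ge.
    by rewrite lerDl.
move=> h; near +oo_R => K.
have hK : `[0, t]%classic `<=` P K by near: K.
exists K; first by near: K; exact: nbhs_pinfty_ge.
by move=> r /andP[r0 rt]; apply: hK => //=; rewrite in_itv/= r0.
Unshelve. all: by end_near. Qed.

Section riemann.
Context (f : R -> R) (a b K : R).
Hypotheses (ab : a < b) (fK : forall r, a <= r <= b -> `|f r| <= K).
Hypothesis f_right : forall r, a <= r < b -> forall eps : R, 0 < eps ->
  exists2 d : R, 0 < d & forall s : R, r <= s < r + d -> `|f s - f r| <= eps.
Local Notation leb := (@lebesgue_measure R).

Let h n := (b - a) / n.+1%:R.
Let s n j := a + j%:R * h n.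
Let step n r := \sum_(0 <= j < n.+1) f (s n j.+1) * \1_(`]s n j, s n j.+1]) r.

Let h0 n : 0 < h n. Proof. by rewrite divr_gt0// subr_gt0. Qed.
Let sE n : s n n.+1 = b.
Proof. by rewrite /s /h mulrC divfK ?pnatr_eq0// addrC subrK. Qed.
Let s_le n i j : (i <= j)%N -> s n i <= s n j.
Proof. by move=> ij; rewrite lerD2l ler_pM2r// ler_nat. Qed.
Let sS n j : s n j.+1 = s n j + h n.
Proof. by rewrite /s -natr1 mulrDl mul1r addrA. Qed.
Let s0 n : s n 0 = a. Proof. by rewrite /s mul0r addr0. Qed.

(** u is the right end of the cell that contains r, so it approaches r from the right. This is why
    the sums sample right endpoints: right continuity then gives pointwise convergence. *)
Let stepP n r : a < r <= b ->
  exists u, [/\ r <= u, u <= r + h n, u <= b & step n r = f u].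
Proof.
move=> /andP[ar rb].
have ex : exists j, r <= s n j.+1 by exists n; rewrite sE.
have [j rj minj] := ex_minnP ex.
have jn : (j < n.+1)%N by rewrite ltnS; apply: minj; rewrite sE.
have sjr : s n j < r.
  case: j minj {rj jn} => [|j] minj; first by rewrite s0.
  by rewrite ltNge; apply/negP => /minj; rewrite ltnn.
exists (s n j.+1); split => //.
- by rewrite sS lerD2r ltW.
- by rewrite -(sE n) s_le.
rewrite /step (bigD1_seq j) ?iota_uniq ?mem_index_iota//=.
rewrite indicE mem_set/= ?in_itv/= ?sjr// mulr1 big1 ?addr0// => i ij.
rewrite indicE memNset ?mulr0//= in_itv/= => /andP[ir ri].
move: ij; rewrite neq_ltn => /orP[ij|ji].
  by have := le_lt_trans (s_le n ij) sjr; rewrite ltNge ri.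
by have := lt_le_trans ir (le_trans rj (s_le n ji)); rewrite ltxx.
Qed.

Let term_integrable n j :
  leb.-integrable `]a, b] (EFin \o (fun r => f (s n j.+1) * \1_(`]s n j, s n j.+1]) r)).
Proof.
apply: (measurable_bounded_integrable (mu := leb)) => //.
- by rewrite /= lebesgue_measure_itv/=; case: ifPn => // _; rewrite -EFinD ltry.
- apply: measurable_funM => //; exact: measurable_fun_indic.
exists `|f (s n j.+1)|; split; first exact: num_real.
move=> M KM r _ /=; rewrite normrM indicE.
apply: le_trans (ltW KM); rewrite ler_piMr//.
by case: (_ \in _); rewrite ?normr1 ?normr0.
Qed.

Let step_integral n : \int[leb]_(r in `]a, b]) step n r =
  h n * \sum_(0 <= j < n.+1) f (s n j.+1).
Proof.
rewrite /step (Rintegral_sum n.+1 _ (term_integrable n)).2// mulr_sumr.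
apply: eq_big_nat => j /andP[_ jn].
have I1 : leb.-integrable `]a, b] (EFin \o \1_(`]s n j, s n j.+1])).
  apply: (measurable_bounded_integrable (mu := leb)) => //.
  - by rewrite /= lebesgue_measure_itv/=; case: ifPn => // _; rewrite -EFinD ltry.
  exists 1; split; first exact: num_real.
  move=> M KM r _ /=; rewrite indicE; apply: le_trans (ltW KM).
  by case: (_ \in _); rewrite ?normr1 ?normr0.
rewrite RintegralZl// mulrC; congr (_ * _).
rewrite /Rintegral integral_indic// setIidl; last first.
  move=> r; rewrite /= !in_itv/= => /andP[h1 h2].
  rewrite (le_lt_trans _ h1)/=; last by rewrite -(s0 n) s_le.
  by rewrite (le_trans h2)// -(sE n) s_le.
rewrite /= lebesgue_measure_itv/= lte_fin sS ltrDl h0/=.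
by rewrite addrAC subrr add0r.
Qed.

Let step_cvg r : a < r <= b -> (fun n => step n r) @ \oo --> f r.
Proof.
move=> arb; apply/cvgrPdist_le => eps eps0.
have /andP[ar rb] := arb.
move: rb; rewrite le_eqVlt => /predU1P[rb|rb].
  apply: nearW => n; have [u [ru _ ub ->]] := stepP n arb.
  have -> : u = r by apply/eqP; rewrite eq_le ru rb ub.
  by rewrite subrr normr0 ltW.
have arb' : a <= r < b by rewrite (ltW ar) rb.
have [d d0 hd] := f_right arb' eps0.
have db : 0 < d / (b - a) by rewrite divr_gt0// subr_gt0.
near=> n; have [u [ru uh _ ->]] := stepP n arb.
rewrite distrC; apply: hd; rewrite ru (le_lt_trans uh)// ltrD2l /h.
have : n.+1%:R^-1 < d / (b - a).
  by near: n; exact: (near_infty_natSinv_lt (PosNum db)).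
by rewrite ltr_pdivlMr ?subr_gt0// mulrC.
Unshelve. all: by end_near. Qed.

Let step_measurable n : measurable_fun `]a, b] (step n).
Proof.
apply: measurable_sum => j; apply: measurable_funM => //.
Qed.

Lemma right_continuous_measurable : measurable_fun `[a, b] f.
Proof.
apply/measurable_fun_itv_obnd_cbndP.
apply: (measurable_fun_cvg step_measurable) => r; rewrite /= in_itv/=.
exact: step_cvg.
Qed.

Lemma right_riemann_sum :
  (fun n => h n * \sum_(0 <= j < n.+1) f (s n j.+1)) @ \oo -->
  \int[leb]_(r in `[a, b]) f r.
Proof.
have mf : measurable_fun `]a, b] f.
  by apply/measurable_fun_itv_obnd_cbndP; exact: right_continuous_measurable.
have fi : leb.-integrable `]a, b] (EFin \o f).
  have := itv_bounded_integrable right_continuous_measurable fK.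
  by apply: integrableS => // r; rewrite /= !in_itv/= => /andP[/ltW -> ->].
rewrite -Rintegral_itv_obnd_cbnd//.
rewrite (_ : (fun n => _) = fun n => \int[leb]_(r in `]a, b]) step n r); last first.
  by apply/funext => n; rewrite step_integral.
have abfin : (leb `]a, b] < +oo)%E.
  by rewrite /= lebesgue_measure_itv/= lte_fin; case: ifPn => // _; rewrite -EFinD ltry.
apply: (@bounded_convergence _ _ R leb `]a, b] step f K (measurable_itv _) abfin) => //.
move=> n r; rewrite /= in_itv/= => arb.
have [u [ru _ ub ->]] := stepP n arb; apply: fK.
by rewrite ub andbT (le_trans _ ru)//; case/andP: arb => /ltW.
Qed.

End riemann.

End cadlag.

(** * The Markov property with an adapted weight *)

Section staircase.
Context (R : realType).

(** On [0, 1] this is floor((N + 1) y) / (N + 1), written as an average of indicators of superlevel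
    sets so that identities known for events pass to functions. *)
Definition staircase (N : nat) (y : R) : R :=
  N.+1%:R^-1 * \sum_(0 <= i < N.+1) \1_(`[i.+1%:R / N.+1%:R, +oo[) y.

Lemma staircase_dist N y : 0 <= y <= 1 -> `|staircase N y - y| <= N.+1%:R^-1.
Proof.
move=> /andP[y0 y1]; rewrite /staircase.
have N0 : (0 : R) < N.+1%:R by rewrite ltr0n.
pose z := y * N.+1%:R.
have z0 : 0 <= z by rewrite mulr_ge0// ltW.
have zN : z <= N.+1%:R by rewrite -[leRHS]mul1r ler_pM2r.
have E i : \1_(`[i.+1%:R / N.+1%:R, +oo[) y = ((i.+1%:R <= z)%R : bool)%:R :> R.
  rewrite indicE; congr (nat_of_bool _)%:R.
  by apply/idP/idP; rewrite inE/= in_itv/= andbT ler_pdivrMr.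
rewrite (eq_bigr _ (fun i _ => E i)).
suff [h1 h2] : z - 1 <= \sum_(0 <= i < N.+1) ((i.+1%:R <= z)%R : bool)%:R /\
    \sum_(0 <= i < N.+1) ((i.+1%:R <= z)%R : bool)%:R <= z.
  rewrite -[X in `|_ - X|](mulfK (lt0r_neq0 N0)) -/z mulrC -mulrBl normrM.
  rewrite (gtr0_norm (x := N.+1%:R^-1)) ?invr_gt0// ler_piMl ?invr_ge0 ?(ltW N0)//.
  by rewrite ler_norml; apply/andP; split; lra.
move: zN {E}; move: (z) z0 => {}z z0; move: N.+1 => n zn.
elim: n zn => [|n ih] zn.
  by rewrite big_geq//; split=> //; lra.
rewrite big_nat_recr//=.
have [zn'|zn'] := leP z n%:R.
  have [h1 h2] := ih zn'.
  have -> : (n.+1%:R <= z) = false.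
    by apply/negbTE; rewrite -ltNge (le_lt_trans zn')// ltr_nat.
  by rewrite addr0.
have -> : \sum_(0 <= i < n) ((i.+1%:R <= z)%R : bool)%:R = n%:R :> R.
  rewrite (eq_big_nat _ _ (F2 := fun=> 1)); last first.
    by move=> i /andP[_ i_n]; rewrite (le_trans _ (ltW zn')) ?ler_nat.
  by rewrite big_const_nat subn0 iter_addr_0.
move: zn zn'; rewrite -!natr1 => zn zn'.
by have [hz|hz] := leP (n%:R + 1) z; split => //=; lra.
Qed.

Lemma staircase_cvg y : 0 <= y <= 1 -> staircase ^~ y @ \oo --> y.
Proof.
move=> y01; apply/cvgrPdist_le => eps eps0; near=> n.
rewrite distrC (le_trans (staircase_dist n y01))// ltW//.
by near: n; exact: (near_infty_natSinv_lt (PosNum eps0)).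
Unshelve. all: by end_near. Qed.

Lemma staircase_norm N y : `|staircase N y| <= 1.
Proof.
rewrite /staircase normrM ger0_norm ?invr_ge0// mulrC ler_pdivrMr ?ltr0n// mul1r.
rewrite (le_trans (ler_norm_sum _ _ _))//.
apply: (@le_trans _ _ (\sum_(0 <= i < N.+1) 1)).
  by apply: ler_sum => i _; rewrite indicE; case: (_ \in _); rewrite ?normr1 ?normr0.
by rewrite big_const_nat subn0 iter_addr_0.
Qed.

Lemma staircase_measurable N : measurable_fun setT (staircase N).
Proof.
apply: measurable_funM => //; apply: measurable_sum => i.
by apply: measurable_indic; exact: measurable_itv.
Qed.

End staircase.

Lemma Rintegral_sum_eq d (T : measurableType d) (R : realType)
    (P : {finite_measure set T -> \bar R}) (u v : nat -> T -> R) (c : R) n :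
  (forall i, measurable_fun setT (u i)) -> (forall i, measurable_fun setT (v i)) ->
  (forall i x, `|u i x| <= 1) -> (forall i x, `|v i x| <= 1) ->
  (forall i, \int[P]_x u i x = \int[P]_x v i x) ->
  \int[P]_x (c * \sum_(0 <= i < n) u i x) = \int[P]_x (c * \sum_(0 <= i < n) v i x).
Proof.
move=> mu mv u1 v1 uv.
have iu i := finite_bounded_integrable P measurableT (mu i) (fun x _ => u1 i x).
have iv i := finite_bounded_integrable P measurableT (mv i) (fun x _ => v1 i x).
have [su Eu] := Rintegral_sum n measurableT iu.
have [sv Ev] := Rintegral_sum n measurableT iv.
by rewrite !RintegralZl// Eu Ev; congr (_ * _); apply: eq_bigr => i _.
Qed.

Lemma probability_integral_le1 d (T : measurableType d) (R : realType)
    (Q : probability T R) (F : T -> R) :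
  measurable_fun setT F -> (forall x, `|F x| <= 1) -> `|\int[Q]_x F x| <= 1.
Proof.
move=> mF F1.
have := finite_integral_bound Q measurableT mF ler01 (fun x _ => F1 x).
by rewrite mul1r (_ : fine _ = 1)// -[RHS]/(fine 1%E) -(probability_setT Q).
Qed.

Section markov_functional.
Context (R : realType) d (Om : measurableType d) d' (S : measurableType d').
Context (P : probability Om R) (Z Z' : Om -> S) (P' : Om -> probability Om R).
Context (G : set (set Om)).
Hypotheses (mZ : measurable_fun setT Z) (mZ' : measurable_fun setT Z').
Hypothesis mP' : forall B, measurable B ->
  measurable_fun setT (fun w => P' w (Z' @^-1` B)).
Hypothesis mG : forall A, G A -> measurable A.
Hypothesis markov : forall A B, G A -> measurable B ->
  P (A `&` Z @^-1` B) = (\int[P]_(w in A) P' w (Z' @^-1` B))%E.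

Let indic_le1 (T : Type) (A : set T) (x : T) : `|\1_A x : R| <= 1.
Proof. by rewrite indicE; case: (_ \in _); rewrite ?normr1 ?normr0. Qed.

Let mul_le1 (a b : R) : `|a| <= 1 -> `|b| <= 1 -> `|a * b| <= 1.
Proof. by move=> a1 b1; rewrite normrM mulr_ile1. Qed.

Let mpre (W : Om -> S) B : measurable_fun setT W -> measurable B ->
  measurable (W @^-1` B).
Proof. by move=> mW mB; rewrite -[_ @^-1` _]setTI; exact: mW. Qed.

Let kap B w : R := fine (P' w (Z' @^-1` B)).

Let kap_measurable B : measurable B -> measurable_fun setT (kap B).
Proof. by move=> mB; apply: measurableT_comp (mP' mB). Qed.

Let kap_fin B w : measurable B -> P' w (Z' @^-1` B) \is a fin_num.
Proof. by move=> mB; apply: fin_num_measure; exact: mpre. Qed.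

Let kap_le1 B w : measurable B -> `|kap B w| <= 1.
Proof.
move=> mB; rewrite ger0_norm ?fine_ge0// -lee_fin fineK ?kap_fin//.
by apply: probability_le1; exact: mpre.
Qed.

Let atom A B : G A -> measurable B ->
  \int[P]_w (\1_A w * \1_B (Z w)) = \int[P]_w (\1_A w * kap B w).
Proof.
move=> GA mB; have mA := mG GA; have mZB := mpre mZ mB.
rewrite (eq_Rintegral _ (g := \1_(A `&` Z @^-1` B))); last first.
  by move=> w _; rewrite indicI.
rewrite /Rintegral integral_indic ?setIT//; last exact: measurableI.
transitivity (fine (\int[(P : {measure set Om -> \bar R})]_(w in A) P' w (Z' @^-1` B))%E).
  exact: (congr1 fine (markov GA mB)).
rewrite integral_mkcond; congr fine; apply: eq_integral => w _.
rewrite patchE indicE; case: (w \in A); last by rewrite mul0r.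
by rewrite mul1r fineK ?kap_fin.
Qed.

Variable g : S -> R.
Hypotheses (mg : measurable_fun setT g) (g01 : forall z, 0 <= g z <= 1).

Let lev (N i : nat) : set S := g @^-1` `[i.+1%:R / N.+1%:R, +oo[.

Let lev_measurable N i : measurable (lev N i).
Proof. by rewrite -[lev N i]setTI; apply: mg => //; exact: measurable_itv. Qed.

Let stairE N z : staircase N (g z) =
  N.+1%:R^-1 * \sum_(0 <= i < N.+1) \1_(lev N i) z.
Proof. by []. Qed.

Let stair_measurable N (W : Om -> S) : measurable_fun setT W ->
  measurable_fun setT (fun w => staircase N (g (W w))).
Proof.
move=> mW; apply: (measurableT_comp (@staircase_measurable R N)).
exact: measurableT_comp mW.
Qed.

Let mean N w := \int[P' w]_z staircase N (g (Z' z)).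

Let meanE N w : mean N w = N.+1%:R^-1 * \sum_(0 <= i < N.+1) kap (lev N i) w.
Proof.
have ii i : (P' w).-integrable setT (EFin \o \1_(Z' @^-1` lev N i)).
  apply: (finite_bounded_integrable _ measurableT) => [|x _]; last exact: indic_le1.
  by apply: measurable_indic; exact: mpre.
have [si Ei] := Rintegral_sum N.+1 measurableT ii.
rewrite /mean RintegralZl// Ei; congr (_ * _); apply: eq_bigr => i _.
by rewrite /Rintegral integral_indic ?setIT//; exact: mpre.
Qed.

Variable Gr : Om -> R.
Hypotheses (mGr : measurable_fun setT Gr).
Hypothesis GrE : forall w, \int[P' w]_z g (Z' z) = Gr w.

Let mean_measurable N : measurable_fun setT (mean N).
Proof.
rewrite (_ : mean N = fun w => N.+1%:R^-1 * \sum_(0 <= i < N.+1) kap (lev N i) w).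
  by apply: measurable_funM => //; apply: measurable_sum => i; exact: kap_measurable.
by apply/funext => w; exact: meanE.
Qed.

Let Pfin (Q : probability Om R) : (Q setT < +oo)%E.
Proof. by rewrite probability_setT ltry. Qed.

Let mean_le1 N w : `|mean N w| <= 1.
Proof.
apply: probability_integral_le1 (stair_measurable N mZ') _ => x.
exact: staircase_norm.
Qed.

Let mean_cvg w : mean ^~ w @ \oo --> Gr w.
Proof.
rewrite -GrE; apply: (bounded_convergence (K := 1)) => //.
- exact: (Pfin (P' w)).
- by move=> N; exact: stair_measurable.
- exact: measurableT_comp mZ'.
- by move=> z _; apply: staircase_cvg; exact: g01.
- by move=> N z _; exact: staircase_norm.
Qed.

(** A staircase of [g] is an average of indicators, to which the Markov property for events applies;
    bounded convergence then removes the staircase on both sides. *)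
Let markov_indic A : G A ->
  \int[P]_w (\1_A w * g (Z w)) = \int[P]_w (\1_A w * Gr w).
Proof.
move=> GA; have mA : measurable_fun setT (\1_A : Om -> R).
  by apply: measurable_indic; exact: mG.
have E N : \int[P]_w (\1_A w * staircase N (g (Z w))) =
    \int[P]_w (\1_A w * mean N w).
  rewrite (eq_Rintegral _ (g := fun w => N.+1%:R^-1 *
    \sum_(0 <= i < N.+1) \1_A w * \1_(lev N i) (Z w))); last first.
    by move=> w _; rewrite stairE mulrCA mulr_sumr.
  rewrite [RHS](eq_Rintegral _ (g := fun w => N.+1%:R^-1 *
    \sum_(0 <= i < N.+1) \1_A w * kap (lev N i) w)); last first.
    by move=> w _; rewrite meanE mulrCA mulr_sumr.
  apply: Rintegral_sum_eq => [i|i|i w|i w|i].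
  - apply: measurable_funM => //.
    by apply: (@measurable_indic _ _ _ _ (Z @^-1` lev N i)); exact: mpre.
  - by apply: measurable_funM => //; exact: kap_measurable.
  - by apply: mul_le1.
  - by apply: mul_le1 => //; exact: kap_le1.
  - exact: atom.
have h1 : (fun N => \int[P]_w (\1_A w * staircase N (g (Z w)))) @ \oo -->
    \int[P]_w (\1_A w * g (Z w)).
  apply: (bounded_convergence (K := 1)) => //.
  - exact: (Pfin P).
  - by move=> N; apply: measurable_funM => //; exact: stair_measurable.
  - by apply: measurable_funM => //; exact: measurableT_comp mZ.
  - by move=> w _; apply: cvgM; [exact: cvg_cst|exact/staircase_cvg/g01].
  - by move=> N w _; apply: mul_le1 => //; exact: staircase_norm.
have h2 : (fun N => \int[P]_w (\1_A w * mean N w)) @ \oo -->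
    \int[P]_w (\1_A w * Gr w).
  apply: (bounded_convergence (K := 1)) => //.
  - exact: (Pfin P).
  - by move=> N; apply: measurable_funM.
  - by apply: measurable_funM.
  - by move=> w _; apply: cvgM; [exact: cvg_cst|exact: mean_cvg].
  - by move=> N w _; apply: mul_le1.
apply: (cvg_unique (@norm_hausdorff _ _) h1).
by rewrite /= (funext E).
Qed.

(** A second staircase, now in [Y], reduces to [markov_indic] on the superlevel sets of [Y]. *)
Lemma markov_functional (Y : Om -> R) : measurable_fun setT Y ->
  (forall w, 0 <= Y w <= 1) -> (forall r, G (Y @^-1` `[r, +oo[)) ->
  \int[P]_w (Y w * g (Z w)) = \int[P]_w (Y w * Gr w).
Proof.
move=> mY Y01 GY.
have g1 z : `|g z| <= 1 by case/andP: (g01 z) => z0 z1; rewrite ger0_norm.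
have Gr1 w : `|Gr w| <= 1.
  rewrite -GrE; apply: probability_integral_le1 (measurableT_comp mg mZ') _ => x.
  exact: g1.
have mgZ : measurable_fun setT (g \o Z) by exact: measurableT_comp mZ.
pose L N i : set Om := Y @^-1` `[i.+1%:R / N.+1%:R, +oo[.
have mL N i : measurable_fun setT (\1_(L N i) : Om -> R).
  by apply: measurable_indic; apply: mG; exact: GY.
have E N : \int[P]_w (staircase N (Y w) * g (Z w)) =
    \int[P]_w (staircase N (Y w) * Gr w).
  rewrite (eq_Rintegral _ (g := fun w => N.+1%:R^-1 *
    \sum_(0 <= i < N.+1) \1_(L N i) w * g (Z w))); last first.
    by move=> w _; rewrite /staircase -mulrA mulr_suml.
  rewrite [RHS](eq_Rintegral _ (g := fun w => N.+1%:R^-1 *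
    \sum_(0 <= i < N.+1) \1_(L N i) w * Gr w)); last first.
    by move=> w _; rewrite /staircase -mulrA mulr_suml.
  apply: Rintegral_sum_eq => [i|i|i w|i w|i].
  - by apply: measurable_funM.
  - by apply: measurable_funM.
  - by apply: mul_le1.
  - by apply: mul_le1.
  - by apply: markov_indic; exact: GY.
have lim (F : Om -> R) : measurable_fun setT F -> (forall w, `|F w| <= 1) ->
    (fun N => \int[P]_w (staircase N (Y w) * F w)) @ \oo -->
    \int[P]_w (Y w * F w).
  move=> mF F1; apply: (bounded_convergence (K := 1)) => //.
  - exact: (Pfin P).
  - move=> N; apply: measurable_funM => //.
    exact: measurableT_comp (@staircase_measurable R N) mY.
  - by apply: measurable_funM.
  - by move=> w _; apply: cvgM; [exact: staircase_cvg|exact: cvg_cst].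
  - by move=> N w _; apply: mul_le1 => //; exact: staircase_norm.
apply: (cvg_unique (@norm_hausdorff _ _) (lim _ mgZ (fun w => g1 (Z w)))).
by rewrite /= (funext E); exact: lim.
Qed.

End markov_functional.

(** * Integration over events of the augmented filtration *)

Section augmentation.
Context (R : realType) d (Om : measurableType d) (P : probability Om R).

(** The integral of a nonnegative function is a supremum over simple functions below its
    restriction, so monotonicity extends to the nonmeasurable sets that augmentation may bring
    in. *)
Lemma ge0_integral_subset (A B : set Om) (f : Om -> \bar R) :
  (forall w, 0 <= f w)%E -> A `<=` B ->
  (\int[P]_(w in A) f w <= \int[P]_(w in B) f w)%E.
Proof.
move=> f0 AB; rewrite !ge0_integralE//; apply: ereal_sup_le.
move=> _ [h hA <-]; exists h => // w; apply: le_trans (hA w) _.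
rewrite !patchE; case: ifPn => wA; first by rewrite mem_set//; apply: AB; exact: set_mem.
by case: ifPn.
Qed.

(** With [N] inside a measurable null set N', the set [A] is squeezed between B minus N' and B union
    N', whose integrals coincide. *)
Lemma ge0_integral_ae_eq_set (A B N : set Om) (f : Om -> \bar R) :
  measurable_fun setT f -> (forall w, 0 <= f w)%E -> measurable B ->
  P.-negligible N -> A `<=` B `|` N -> B `<=` A `|` N ->
  (\int[P]_(w in A) f w = \int[P]_(w in B) f w)%E.
Proof.
move=> mf f0 mB [N' [mN' N'0 NN']] AB BA.
have mfT D : measurable D -> measurable_fun D f.
  by move=> mD; exact: measurable_funTS.
have E D : measurable D -> (\int[P]_(w in D) f w = \int[P]_(w in D `\` N') f w)%E.
  by move=> mD; apply: (@ge0_negligible_integral _ _ _ P) => //; exact: mfT.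
have EU : (\int[P]_(w in B `|` N') f w = \int[P]_(w in B) f w)%E.
  rewrite (E (B `|` N')); last exact: measurableU.
  rewrite [RHS]E//; congr (integral _ _ _); apply/seteqP; split => w.
    by move=> [[//|//] wN'].
  by move=> [wB wN']; split => //; left.
apply/eqP; rewrite eq_le -{1}EU; apply/andP; split.
  by apply: ge0_integral_subset => // w /AB[wB|/NN' wN]; [left|right].
rewrite (E B mB); apply: ge0_integral_subset => // w [/BA[//|/NN' wN] wN'].
by [].
Qed.

(** The sets with this property form a sigma-algebra that contains the generators of the
    augmentation. *)
Lemma augmented_modify (Fs : R -> set (set Om)) (s : R) :
  sigma_algebra setT (Fs s) -> forall A, augmented_filtration P Fs s A ->
  exists B N, [/\ Fs s B, P.-negligible N, A `<=` B `|` N & B `<=` A `|` N].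
Proof.
move=> [F0 FC FU] A; apply: (smallest_sub (C := sigma_algebra setT)
  (X := [set A | exists B N, [/\ Fs s B, P.-negligible N,
    A `<=` B `|` N & B `<=` A `|` N]])) => {A} [|A [FA|NA]].
- split.
  + by exists set0, set0; split => //; exact: negligible_set0.
  + move=> A [B [N [FB nN AB BA]]]; exists (setT `\` B), N; split => //.
    * exact: FC.
    * by move=> w [_ wA]; have [wB|wB] := pselect (B w);
        [right; case: (BA _ wB)|left].
    * by move=> w [_ wB]; have [wA|wA] := pselect (A w);
        [right; case: (AB _ wA)|left].
  + move=> A /choice[B /choice[N h]].
    exists (\bigcup_k B k), (\bigcup_k N k); split.
    * by apply: FU => n; case: (h n).
    * by apply: negligible_bigcup => n; case: (h n).
    * by move=> w [n _ wA]; case: (h n) => _ _ /(_ w wA)[wB|wN] _; [left|right]; exists n.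
    * by move=> w [n _ wB]; case: (h n) => _ _ _ /(_ w wB)[wA|wN]; [left|right]; exists n.
- exists A, set0; split; [exact: FA|exact: negligible_set0| |];
  by move=> w wA; left.
- by exists set0, A; split => // w; right.
Qed.

End augmentation.

Lemma measurable_sum_nat d (T : measurableType d) (R : realType) (D : set T)
    (f : nat -> T -> R) n :
  (forall j, (j < n)%N -> measurable_fun D (f j)) ->
  measurable_fun D (fun x => \sum_(0 <= j < n) f j x).
Proof.
elim: n => [|n ih] mf.
  by rewrite (_ : (fun x => _) = fun=> 0)//; apply/funext => x; rewrite big_geq.
rewrite (_ : (fun x => _) = fun x => \sum_(0 <= j < n) f j x + f n x).
  by apply: measurable_funD; [apply: ih => j jn; apply: mf; exact: leqW|exact: mf].
by apply/funext => x; rewrite big_nat_recr.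
Qed.

Section filtration.
Context (R : realType) (H : hilbertType R) (e : onb H).
Context d (Om : measurableType d) (X : R -> Om -> hsop e).
Hypothesis X_meas : forall r : R, 0 <= r ->
  measurable_fun setT (X r : Om -> borel (hsop e)).

(* Om with the natural filtration at time s as its sigma-algebra, so that
   adaptedness is measurability. *)
Definition past (s : R) : Type := g_sigma_algebraType
  [set A | exists (r : R) (B : set (borel (hsop e))),
    [/\ 0 <= r <= s, measurable B & A = X r @^-1` B]].
HB.instance Definition _ s := Measurable.on (past s).

Lemma adaptedP s (Y : Om -> R) : measurable_fun setT (Y : past s -> R) <->
  forall B : set R, measurable B -> natural_filtration X s (Y @^-1` B).
Proof.
split=> [mY B mB|h _ B mB].
  by have := mY measurableT B mB; rewrite setTI.
by rewrite setTI; exact: h.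
Qed.

Lemma natural_filtration_sub s s' : s <= s' ->
  natural_filtration X s `<=` natural_filtration X s'.
Proof.
move=> ss'; apply: smallest_sub; first exact: smallest_sigma_algebra.
move=> A [r [B [/andP[r0 rs] mB ->]]]; apply: sub_sigma_algebra.
by exists r, B; split => //; rewrite r0 (le_trans rs).
Qed.

Lemma natural_filtration_measurable s A : natural_filtration X s A -> measurable A.
Proof.
apply: smallest_sub; first exact: sigma_algebra_measurable.
move=> _ [r [B [/andP[r0 _] mB ->]]].
by rewrite -[_ @^-1` _]setTI; exact: (X_meas r0).
Qed.

Lemma adapted_le s s' (Y : Om -> R) : s <= s' ->
  measurable_fun setT (Y : past s -> R) -> measurable_fun setT (Y : past s' -> R).
Proof.
move=> ss' /adaptedP h; apply/adaptedP => B mB.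
exact: natural_filtration_sub ss' _ (h B mB).
Qed.

Lemma adapted_measurable s (Y : Om -> R) :
  measurable_fun setT (Y : past s -> R) -> measurable_fun setT Y.
Proof.
move=> /adaptedP h _ B mB; rewrite setTI.
exact: natural_filtration_measurable (h B mB).
Qed.

Lemma process_adapted r s : 0 <= r <= s ->
  measurable_fun setT (X r : past s -> borel (hsop e)).
Proof.
move=> rs _ B mB; rewrite setTI; apply: sub_sigma_algebra.
by exists r, B.
Qed.

Lemma process_inner_adapted r s v : 0 <= r <= s ->
  measurable_fun setT ((fun w => inner (X r w) v) : past s -> R).
Proof.
by move=> rs; apply: (measurableT_comp (borel_inner_measurable v)); exact: process_adapted.
Qed.

Lemma process_norm_adapted r s : 0 <= r <= s ->
  measurable_fun setT ((fun w => `|X r w|) : past s -> R).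
Proof.
by move=> rs; apply: (measurableT_comp (@borel_norm_measurable _ _)); exact: process_adapted.
Qed.

End filtration.

Section markov_laplace.
Context (R : realType) (H : hilbertType R) (e : onb H).
Context d (Om : measurableType d) (phi : R -> hsop e -> R).
Context (psi : R -> hsop e -> hsop e) (X : R -> Om -> hsop e).
Context (P : hsop e -> probability Om R).
Hypothesis X_affine : affine_process phi psi X P.

(** Conditional form of the transform formula, tested against a bounded adapted weight: the inner
    expectation starts from X_s and is given by the affine formula. *)
Lemma affine_markov_laplace x (s h C : R) v (Y : Om -> R) :
  Hplus x -> 0 <= s -> 0 <= h -> Hplus v ->
  measurable_fun setT (Y : past X s -> R) -> (forall w, 0 <= Y w <= C) ->
  \int[P x]_w (Y w * expR (- inner (X (s + h) w) v)) =
  \int[P x]_w (Y w * expR (- phi h v - inner (X s w) (psi h v))).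
Proof.
move=> xH s0 h0 vH mY YC.
have sh0 : 0 <= s + h by rewrite addr_ge0.
have mX r := X_measurable X_affine r.
have XH r w (r0 : 0 <= r) : Hplus (X r w) := X_Hplus X_affine w r0.
(* The cap keeps [g] in [0, 1] on the whole space; on the cone, where X takes its values, it changes
   nothing. *)
pose g (y : borel (hsop e)) : R := Num.min 1 (expR (- inner y v)).
have gE y : Hplus y -> g y = expR (- inner y v).
  move=> yH; rewrite /g; apply/min_idPr.
  by rewrite -expR0 ler_expR oppr_le0; exact: Hplus_inner_ge0.
have mg : measurable_fun setT g.
  apply: measurable_minr => //.
  apply: (measurableT_comp (@measurable_expR R)); apply: measurable_funN.
  exact: borel_inner_measurable.
have g01 y : 0 <= g y <= 1.
  by rewrite /g le_min ler01 expR_ge0/= ge_min lexx.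
have mGr : measurable_fun setT
    (fun w => expR (- phi h v - inner (X s w) (psi h v))).
  apply: (measurableT_comp (@measurable_expR R)); apply: measurable_funB => //.
  exact: measurableT_comp (borel_inner_measurable _) (mX s s0).
have GrE w : \int[P (X s w)]_z g (X h z) =
    expR (- phi h v - inner (X s w) (psi h v)).
  rewrite (eq_Rintegral _ (g := fun z => expR (- inner (X h z) v))); last first.
    by move=> z _; exact/gE/XH.
  by rewrite /Rintegral (X_laplace X_affine (XH s w s0) h0 vH).
have mP' (B : set (borel (hsop e))) : measurable B ->
    measurable_fun setT (fun w => P (X s w) (X h @^-1` B)).
  move=> mB; apply: (measurable_comp (F := @Hplus R H e : set (borel (hsop e)))
    (f := (fun y => P y (X h @^-1` B)) : borel (hsop e) -> \bar R)
    (g := X s : Om -> borel (hsop e))).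
  - by apply: borel_closed_measurable; exact: Hplus_closed.
  - by move=> _ [w _ <-]; exact: XH.
  - exact: (X_kernel X_affine).
  - exact: mX.
have [C' C'0 YC'] : exists2 C' : R, 0 < C' & forall w, 0 <= Y w / C' <= 1.
  exists (`|C| + 1); first by rewrite ltr_wpDl.
  move=> w; have /andP[h1 h2] := YC w.
  rewrite divr_ge0 ?addr_ge0//= ler_pdivrMr ?ltr_wpDl// mul1r.
  by rewrite (le_trans h2)// (le_trans (ler_norm _))// lerDl.
have mYC : measurable_fun setT ((fun w => Y w / C') : past X s -> R).
  by apply: measurable_funM.
have key : \int[P x]_w (Y w / C' * g (X (s + h) w)) =
    \int[P x]_w (Y w / C' * expR (- phi h v - inner (X s w) (psi h v))).
  have mG A : natural_filtration X s A -> measurable A.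
    exact: natural_filtration_measurable.
  have mk (A : set Om) (B : set (borel (hsop e))) (FA : natural_filtration X s A)
    (mB : measurable B) := X_markov X_affine xH s0 h0 FA mB.
  have lev r : natural_filtration X s ((fun w => Y w / C') @^-1` `[r, +oo[).
    by have /adaptedP := mYC; apply; exact: measurable_itv.
  exact: (markov_functional (mX _ sh0) (mX _ h0) mP' mG mk mg g01 mGr GrE
    (adapted_measurable mX mYC) YC' lev).
have Gr1 w : `|expR (- phi h v - inner (X s w) (psi h v))| <= 1.
  rewrite -GrE; apply: probability_integral_le1 (measurableT_comp mg (mX _ h0)) _.
  by move=> z; have /andP[h1 h2] := g01 (X h z); rewrite ger0_norm.
have mY0 := adapted_measurable mX mYC.
have YC1 w : `|Y w / C'| <= 1.
  by have /andP[h1 h2] := YC' w; rewrite ger0_norm.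
have bound (F : Om -> R) : measurable_fun setT F -> (forall w, `|F w| <= 1) ->
    (P x).-integrable setT (EFin \o (fun w => Y w / C' * F w)).
  move=> mF F1; apply: (finite_bounded_integrable (P x) measurableT (K := 1)).
    by apply: measurable_funM => //; apply: measurable_funM.
  by move=> w _; rewrite normrM mulr_ile1.
have scale (F : Om -> R) : measurable_fun setT F -> (forall w, `|F w| <= 1) ->
    \int[P x]_w (Y w * F w) = C' * \int[P x]_w (Y w / C' * F w).
  move=> mF F1; rewrite -RintegralZl//; last exact: bound.
  by apply: eq_Rintegral => w _; rewrite mulrA mulrCA divff ?mulr1// gt_eqF.
rewrite (scale _ mGr Gr1) -key -scale.
- by apply: eq_Rintegral => w _; rewrite gE//; exact: XH.
- exact: measurableT_comp mg (mX _ sh0).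
- by move=> w; have /andP[h1 h2] := g01 (X (s + h) w); rewrite ger0_norm.
Qed.

End markov_laplace.

(** * Discrete approximation of the martingale *)

(* Since 1 - y^2 <= 2 (1 - y), the loss of expectation of each step is at most
   2 C (e^{-S_k} - e^{-S_{k+1}}), which telescopes. *)
Lemma exp_defect_sum d (Om : measurableType d) (R : realType)
    (P : probability Om R) (u S : nat -> Om -> R) (C : R) n :
  (forall k, measurable_fun setT (u k)) -> (forall k, measurable_fun setT (S k)) ->
  (forall w, S 0%N w = 0) -> (forall k w, S k w <= S k.+1 w) ->
  (forall k w, (k <= n)%N -> 0 <= u k w <= C * expR (- S k w)) ->
  (forall k, (k < n)%N ->
    \int[P]_w u k.+1 w = \int[P]_w (u k w * expR (- (2 * (S k.+1 w - S k w))))) ->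
  0 <= \int[P]_w u 0%N w - \int[P]_w u n w
    <= 2 * C * \int[P]_w (1 - expR (- S n w)).
Proof.
move=> mu mS S0 SS; elim: n => [|n ih] uC uS.
  rewrite subrr lexx/= (eq_Rintegral _ (g := fun=> 0)).
    by rewrite Rintegral_cst// mul0r mulr0.
  by move=> w _; rewrite S0 oppr0 expR0 subrr.
have /andP[ih0 ih1] := ih (fun k w kn => uC k w (leqW kn))
  (fun k kn => uS k (ltnW kn)).
have S_ge0 k w : 0 <= S k w.
  by elim: k => [|k hk]; [rewrite S0|exact: le_trans hk (SS k w)].
have eS1 k w : expR (- S k w) <= 1 by rewrite -expR0 ler_expR oppr_le0.
have meS k : measurable_fun setT (fun w => expR (- S k w)).
  by apply: (measurableT_comp (@measurable_expR R)); exact: measurable_funN.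
have mex k : measurable_fun setT (fun w => expR (- (2 * (S k.+1 w - S k w)))).
  apply: (measurableT_comp (@measurable_expR R)); apply: measurable_funN.
  by apply: measurable_funM => //; apply: measurable_funB.
have C0 : forall w : Om, 0 <= C.
  move=> w; have /andP[h1 h2] := uC 0%N w isT; have := le_trans h1 h2.
  by rewrite S0 oppr0 expR0 mulr1.
have u1 k w : (k <= n.+1)%N -> `|u k w| <= C.
  move=> kn; have /andP[h1 h2] := uC k w kn; rewrite ger0_norm// (le_trans h2)//.
  by rewrite ler_piMr// (C0 w).
have ex1 k w : expR (- (2 * (S k.+1 w - S k w))) <= 1.
  by rewrite -expR0 ler_expR oppr_le0 mulr_ge0// subr_ge0.
have iu k (kn : (k <= n.+1)%N) :=
  finite_bounded_integrable P measurableT (mu k) (fun w _ => u1 k w kn).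
have iv : P.-integrable setT
    (EFin \o (fun w => u n w * expR (- (2 * (S n.+1 w - S n w))))).
  apply: (finite_bounded_integrable P measurableT (K := C)) => [|w _].
    exact: measurable_funM.
  rewrite normrM (ger0_norm (expR_ge0 _)).
  by rewrite (le_trans _ (u1 n w (leqnSn n)))// ler_piMr.
have ie k : P.-integrable setT (EFin \o (fun w => 1 - expR (- S k w))).
  apply: (finite_bounded_integrable P measurableT (K := 1)) => [|w _].
    exact: measurable_funB.
  by rewrite ger0_norm ?subr_ge0// lerBlDr lerDl expR_ge0.
have -> : \int[P]_w u 0%N w - \int[P]_w u n.+1 w =
    (\int[P]_w u 0%N w - \int[P]_w u n w) +
    \int[P]_w (u n w - u n w * expR (- (2 * (S n.+1 w - S n w)))).
  by rewrite RintegralB ?(uS n (ltnSn n)) ?addrA ?subrK//; exact: iu.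
have -> : \int[P]_w (1 - expR (- S n.+1 w)) =
    \int[P]_w (1 - expR (- S n w)) +
    \int[P]_w ((1 - expR (- S n.+1 w)) - (1 - expR (- S n w))).
  by rewrite [X in _ = _ + X]RintegralB// addrC subrK.
have i1 : P.-integrable setT (EFin \o (fun w =>
    u n w - u n w * expR (- (2 * (S n.+1 w - S n w))))).
  exact: (integrableB measurableT (iu n (leqnSn n)) iv).
have i2 : P.-integrable setT (EFin \o (fun w =>
    (1 - expR (- S n.+1 w)) - (1 - expR (- S n w)))).
  exact: (integrableB measurableT (ie n.+1) (ie n)).
rewrite [2 * C * _]mulrDr.
apply/andP; split.
  rewrite addr_ge0//; apply: Rintegral_ge0 => w _.
  have /andP[h1 _] := uC n w (leqnSn n).
  by rewrite subr_ge0 ler_piMr.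
apply: lerD => //; rewrite -RintegralZl//; apply: le_Rintegral => //.
  exact: (@integrableZl _ _ R P setT measurableT (2 * C)%R _ i2).
move=> w _; have /andP[h1 h2] := uC n w (leqnSn n).
pose y := expR (- (S n.+1 w - S n w)).
have y0 : 0 <= y by exact: expR_ge0.
have y1 : y <= 1 by rewrite -expR0 ler_expR oppr_le0 subr_ge0.
have -> : expR (- (2 * (S n.+1 w - S n w))) = y * y.
  by rewrite -expRD; congr expR; ring.
have -> : expR (- S n.+1 w) = expR (- S n w) * y.
  by rewrite -expRD; congr expR; ring.
move: (expR (- S n w)) (expR_ge0 (- S n w)) h2 (C0 w) => E E0 h2 {}C0.
have hy : 0 <= 1 - y * y <= 2 * (1 - y) by apply/andP; split; nra.
case/andP: hy => hy1 hy2.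
apply: (@le_trans _ _ (C * E * (2 * (1 - y)))).
  rewrite (_ : _ - _ = u n w * (1 - y * y)); last by ring.
  by apply: ler_pM.
by rewrite le_eqVlt; apply/orP; left; apply/eqP; ring.
Qed.

(** * Riemann sums of <X_r, g(t - r)> along a path *)

Section inner_path.
Context (R : realType) (E : innerType R) (x g : R -> E) (t : R).
Hypotheses (x_cadlag : cadlag x) (g_cont : continuous g).
Let f (r : R) := inner (x r) (g (t - r)).

Lemma inner_path_bounded : exists2 K, 0 <= K &
  forall r : R, 0 <= r <= t -> `|f r| <= K.
Proof.
have [K K0 hK] := cadlag_bounded t x_cadlag.
have [L L0 hL] := continuous_bounded 0 t g_cont.
exists (K * L); first by rewrite mulr_ge0.
move=> r /andP[r0 rt]; apply: le_trans (cauchy_schwarz _ _) _.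
by apply: ler_pM => //; [apply: hK; rewrite r0|apply: hL; apply/andP; split; lra].
Qed.

Lemma inner_path_right r : 0 <= r -> forall eps : R, 0 < eps ->
  exists2 d : R, 0 < d & forall s : R, r <= s < r + d -> `|f s - f r| <= eps.
Proof.
move=> r0 eps eps0.
have xr : x @ r^'+ --> x r by exact: x_cadlag.1.
have gr : (fun s => g (t - s)) @ r^'+ --> g (t - r).
  apply: cvg_at_right_filter.
  have c1 : (fun s : R => t - s) @ r --> t - r by apply: cvgB; [exact: cvg_cst|exact: cvg_id].
  exact: (cvg_comp _ _ c1 (@g_cont (t - r))).
have := inner_cvg (FF := at_right_proper_filter r) xr gr.
move=> /cvgrPdist_le/(_ _ eps0); rewrite near_withinE => /nbhs_ballP[d /= d0 hd].
exists d => // s /andP[]; rewrite le_eqVlt => /predU1P[<- _|rs sd].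
  by rewrite subrr normr0 ltW.
rewrite distrC; apply: hd => //.
by rewrite /ball/= ltr_distlC; apply/andP; split; lra.
Qed.

Lemma inner_path_integrable (a b : R) : 0 <= a -> a < b -> b <= t ->
  lebesgue_measure.-integrable `[a, b] (EFin \o f).
Proof.
move=> a0 ab bt.
have [K K0 hK] := inner_path_bounded.
apply: (itv_bounded_integrable (K := K)) => [|r /andP[ar rb]].
  apply: (right_continuous_measurable ab) => r /andP[ar _].
  by apply: inner_path_right; exact: le_trans ar.
by apply: hK; rewrite (le_trans a0)//= (le_trans rb).
Qed.

Lemma inner_path_riemann (a b : R) : 0 <= a -> a < b -> b <= t ->
  (fun n => (b - a) / n.+1%:R *
    \sum_(0 <= j < n.+1) f (a + j.+1%:R * ((b - a) / n.+1%:R))) @ \oo -->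
  \int[lebesgue_measure]_(r in `[a, b]) f r.
Proof.
move=> a0 ab bt; have [K K0 hK] := inner_path_bounded.
apply: (right_riemann_sum ab (K := K)) => [r /andP[ar rb]|r /andP[ar _]].
  by apply: hK; rewrite (le_trans a0)//= (le_trans rb).
by apply: inner_path_right; exact: le_trans ar.
Qed.

End inner_path.

Section affine_martingale.
Context (R : realType) (H : hilbertType R) (e : onb H).
Context d (Om : measurableType d) (phi : R -> hsop e -> R).
Context (psi : R -> hsop e -> hsop e) (X : R -> Om -> hsop e).
Context (P : hsop e -> probability Om R).
Hypothesis X_affine : affine_process phi psi X P.
Context (t : R) (g c : R -> hsop e) (Phi : R -> R) (K : R).
Hypotheses (g_cont : continuous g) (g_Hplus : forall s, Hplus (g s)).
Hypothesis c_Hplus : forall s : R, 0 <= s -> Hplus (c s).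
Hypothesis Phi_le : forall s : R, 0 <= s <= t -> `|Phi s| <= K.

Let I (s : R) w := \int[lebesgue_measure]_(r in `[0, s]) inner (X r w) (g (t - r)).
Let M (s : R) w :=
  expR (- (2^-1 * I s w)) * expR (- Phi (t - s) - inner (X s w) (c (t - s))).

Let mX r := X_measurable X_affine (t := r).
Let XH r w (r0 : 0 <= r) : Hplus (X r w) := X_Hplus X_affine w r0.
Let Xg r w s : 0 <= r -> 0 <= inner (X r w) (g s).
Proof. by move=> r0; apply: Hplus_inner_ge0 => //; exact: XH. Qed.

Let I_ge0 s w : 0 <= I s w.
Proof. by apply: Rintegral_ge0 => r; rewrite /= in_itv/= => /andP[r0 _]; exact: Xg. Qed.

(** The Riemann sums sample X only at times in [0, s], so their pointwise limit is measurable for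
    the past at s. The time s = 0 is apart because the grid needs positive length. *)
Let I_adapted s : 0 <= s <= t -> measurable_fun setT (I s : past X s -> R).
Proof.
move=> /andP[]; rewrite le_eqVlt => /predU1P[<- _|s0 st].
  rewrite (_ : I 0 = fun=> 0); first exact: measurable_cst.
  by apply/funext => w; rewrite /I set_itv1 Rintegral_set1.
pose h n w := (s - 0) / n.+1%:R * \sum_(0 <= j < n.+1)
  inner (X (0 + j.+1%:R * ((s - 0) / n.+1%:R)) w)
        (g (t - (0 + j.+1%:R * ((s - 0) / n.+1%:R)))).
apply: (@measurable_fun_cvg _ (past X s) R setT (h : nat -> past X s -> R)).
  move=> n; apply: measurable_funM => //.
  apply: measurable_sum_nat => j jn; apply: process_inner_adapted.
  rewrite add0r subr0 mulr_ge0 ?divr_ge0 ?(ltW s0)//=.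
  by rewrite mulrCA ler_piMr ?(ltW s0)// ler_pdivrMr// mul1r ler_nat.
move=> w _; rewrite /h.
exact: (inner_path_riemann (X_cadlag X_affine w) g_cont (lexx 0) s0 st).
Qed.

Let expI_adapted s : 0 <= s <= t ->
  measurable_fun setT ((fun w => expR (- (2^-1 * I s w))) : past X s -> R).
Proof.
move=> st; apply: (measurableT_comp (@measurable_expR R)); apply: measurable_funN.
by apply: measurable_funM => //; exact: I_adapted.
Qed.

Let expI_le1 s w : expR (- (2^-1 * I s w)) <= 1.
Proof. by rewrite -expR0 ler_expR oppr_le0 mulr_ge0. Qed.

Let M_adapted s : 0 <= s <= t -> measurable_fun setT (M s : past X s -> R).
Proof.
move=> /andP[s0 st]; apply: measurable_funM; first by apply: expI_adapted; rewrite s0.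
apply: (measurableT_comp (@measurable_expR R)); apply: measurable_funB => //.
by apply: process_inner_adapted; rewrite s0 lexx.
Qed.

Let M_bound s w : 0 <= s <= t -> 0 <= M s w <= expR K.
Proof.
move=> /andP[s0 st]; rewrite mulr_ge0 ?expR_ge0//=.
rewrite -[leRHS]mul1r; apply: ler_pM; rewrite ?expR_ge0// ler_expR.
have ts : 0 <= t - s <= t by apply/andP; split; lra.
have := Phi_le ts; rewrite ler_norml => /andP[h1 _].
have := Hplus_inner_ge0 (XH w s0) (c_Hplus (proj1 (andP ts))) => h2.
lra.
Qed.

Let approx (eps h : R) := forall tau : R, 0 <= tau -> tau + h <= t ->
  `|c (tau + h) - psi h (c tau) - (2^-1 * h) *: g (tau + h)| <= eps * h /\
  `|Phi (tau + h) - Phi tau - phi h (c tau)| <= eps * h.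

Section grid.
Context (s s' : R) (n : nat) (eps : R) (x : hsop e) (A : set Om).
Hypotheses (s_ge0 : 0 <= s) (ss' : s < s') (s't : s' <= t) (xH : Hplus x).
Hypotheses (eps0 : 0 <= eps) (eps1 : eps <= 1).
Hypothesis FA : natural_filtration X s A.
Let h := (s' - s) / n.+1%:R.
Hypothesis step : approx eps h.

Definition grid_pt (j : nat) : R := s + j%:R * h.
Let tp := grid_pt.
(* Of the two copies of eps h |X|, one makes the term at least the negligible
   -eps h; the other one is kept as the exponential weight of [grid_weight]. *)
Definition grid_term (j : nat) (w : Om) : R :=
  inner (X (tp j) w) (c (t - tp j) - psi h (c (t - tp j.+1)))
  + (Phi (t - tp j) - Phi (t - tp j.+1) - phi h (c (t - tp j.+1)))
  + 2 * (eps * h * `|X (tp j) w|).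
Definition grid_weight (k : nat) (w : Om) : R :=
  \sum_(0 <= j < k) (eps * h * `|X (tp j) w|).
(** For k = 0 this is exactly 1_A M_s: the integral up to s is kept and only the part after s is
    discretised. The indicator carries the event against which the martingale property is tested. *)
Definition grid_density (k : nat) (w : Om) : R :=
  \1_A w * (expR (- (2^-1 * I s w)) *
    expR (- (\sum_(0 <= j < k) grid_term j w) - Phi (t - tp k)
          - inner (X (tp k) w) (c (t - tp k)))).

Let h_gt0 : 0 < h. Proof. by rewrite divr_gt0// subr_gt0. Qed.
Let tpS j : tp j.+1 = tp j + h.
Proof. by rewrite /tp /grid_pt -natr1 mulrDl mul1r addrA. Qed.
Let tp_end : tp n.+1 = s'.
Proof. by rewrite /tp /grid_pt /h mulrC divfK ?pnatr_eq0// addrC subrK. Qed.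
Let tp_ge j : s <= tp j.
Proof. by rewrite lerDl mulr_ge0// ltW. Qed.
Let tp_mono i j : (i <= j)%N -> tp i <= tp j.
Proof. by move=> ij; rewrite lerD2l ler_pM2r// ler_nat. Qed.
Let tp0 j : 0 <= tp j. Proof. exact: le_trans (tp_ge j). Qed.
Let tp_t j : (j <= n.+1)%N -> tp j <= t.
Proof. by move=> /tp_mono; rewrite tp_end => /le_trans; apply. Qed.

(** The Riccati errors cost eps h |X| and eps h; together with the two damping copies this explains
    the factor 3. Below, <X, g> >= 0 and one damping copy absorbs the error, which leaves the other
    copy. *)
Let gap j w : (j <= n)%N ->
  `|grid_term j w - 2^-1 * h * inner (X (tp j) w) (g (t - tp j))|
  <= 3 * (eps * h * `|X (tp j) w|) + eps * h /\
  eps * h * `|X (tp j) w| - eps * h <= grid_term j w.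
Proof.
move=> jn.
have tau0 : 0 <= t - tp j.+1 by rewrite subr_ge0 tp_t.
(* Riccati time runs backwards: step j of the grid is the Riccati step from t - s_{j+1} to t -
   s_j. *)
have tauh : t - tp j.+1 + h = t - tp j by rewrite tpS; lra.
have [|e1 e2] := step tau0; first by rewrite tauh; have := tp0 j; lra.
rewrite tauh in e1 e2; rewrite /grid_term.
have := cauchy_schwarz (X (tp j) w)
  (c (t - tp j) - psi h (c (t - tp j.+1)) - (2^-1 * h) *: g (t - tp j)).
rewrite innerBr innerZr => e3.
have e4 := le_trans e3 (ler_wpM2l (normr_ge0 _) e1).
have := Xg w (t - tp j) (tp0 j).
move: (inner _ (g _)) (inner _ (_ - _)) e4 {e3} => q1 q2 e4 q1_ge0.
move: (Phi _ - _ - _) e2 (`|X _ _|) (normr_ge0 (X (tp j) w)) e4 => q3 e2 q4 q4_ge0 e4.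
move: e2 e4; rewrite !ler_norml (mulrC q4) => /andP[f1 f2] /andP[f3 f4].
have hq : 0 <= 2^-1 * h * q1 by rewrite mulr_ge0// mulr_ge0// ltW.
have heq : 0 <= eps * h * q4 by rewrite mulr_ge0// mulr_ge0// ltW.
have heps : 0 <= eps * h by rewrite mulr_ge0// ltW.
by split; [apply/andP; split|]; lra.
Qed.

Let weight_ge0 j w : 0 <= eps * h * `|X (tp j) w|.
Proof. by rewrite mulr_ge0// mulr_ge0// ltW. Qed.

(** The errors eps h add up to at most s' - s since eps <= 1; this is the origin of the constant
    [expR (K + (s' - s))]. *)
Let sum_term_ge k w : (k <= n.+1)%N ->
  grid_weight k w - (s' - s) <= \sum_(0 <= j < k) grid_term j w.
Proof.
move=> kn; apply: (@le_trans _ _ (\sum_(0 <= j < k) (eps * h * `|X (tp j) w| - eps * h))).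
  rewrite sumrB lerD2l lerN2 big_const_nat subn0 iter_addr_0 -mulr_natr.
  have hn : h * k%:R <= s' - s.
    by have := tp_mono kn; rewrite tp_end /tp /grid_pt; lra.
  rewrite -mulrA; apply: le_trans hn; rewrite ler_piMl// mulr_ge0// ltW//.
rewrite big_nat [leRHS]big_nat; apply: ler_sum => j /= jk.
by apply: (gap w _).2; rewrite -ltnS (leq_trans jk kn).
Qed.

Let Phi_ge (s1 : R) : 0 <= s1 <= t -> - Phi (t - s1) <= K.
Proof.
move=> /andP[h1 h2]; have ts : 0 <= t - s1 <= t by apply/andP; split; lra.
by have := Phi_le ts; rewrite ler_norml => /andP[? _]; lra.
Qed.

Let term_measurable s1 j : (0 <= tp j <= s1) ->
  measurable_fun setT (grid_term j : past X s1 -> R).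
Proof.
move=> js; apply: measurable_funD; last first.
  by apply: measurable_funM => //; apply: measurable_funM => //; exact: process_norm_adapted.
by apply: measurable_funD => //; exact: process_inner_adapted.
Qed.

(** [grid_density k.+1] without its factor in X at [tp k.+1]. Term k samples X at [tp k] only, so
    this weight is known at [tp k] and the transform formula applies to it. *)
Let prefix k w := \1_A w * (expR (- (2^-1 * I s w)) *
  expR (- (\sum_(0 <= j < k.+1) grid_term j w) - Phi (t - tp k.+1))).

Let indic_adapted s1 : s <= s1 -> measurable_fun setT (\1_A : past X s1 -> R).
Proof.
by move=> ss1; apply: measurable_indic; exact: natural_filtration_sub FA.
Qed.

Let prefix_adapted k : measurable_fun setT (prefix k : past X (tp k) -> R).
Proof.
apply: measurable_funM; first by apply: indic_adapted; exact: tp_ge.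
apply: measurable_funM.
  apply: (adapted_le (tp_ge k)); apply: expI_adapted.
  by rewrite s_ge0/= (le_trans (ltW ss')).
apply: (measurableT_comp (@measurable_expR R)); apply: measurable_funB => //.
apply: measurable_funN; apply: measurable_sum_nat => j jk.
by apply: term_measurable; rewrite tp0 tp_mono.
Qed.

Let prefix_bound k w : (k < n.+1)%N -> 0 <= prefix k w <= expR (K + (s' - s)).
Proof.
move=> kn; rewrite mulr_ge0 ?mulr_ge0 ?expR_ge0//=.
have i1 : (\1_A w : R) <= 1 by rewrite indicE; case: (_ \in _).
rewrite -[leRHS]mul1r; apply: ler_pM; rewrite ?mulr_ge0 ?expR_ge0//.
rewrite -[leRHS]mul1r; apply: ler_pM; rewrite ?expR_ge0// ler_expR.
have := @sum_term_ge k.+1 w kn; have := @Phi_ge (tp k.+1); rewrite tp0 tp_t// => /(_ isT).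
have : 0 <= grid_weight k.+1 w by apply: sumr_ge0 => j _; exact: weight_ge0.
lra.
Qed.

Lemma grid_density_measurable k : measurable_fun setT (grid_density k).
Proof.
apply: measurable_funM; first by apply: (adapted_measurable mX (indic_adapted (lexx s))).
apply: measurable_funM.
  apply: (adapted_measurable mX (s := s)); apply: expI_adapted.
  by rewrite s_ge0/= (le_trans (ltW ss')).
apply: (measurableT_comp (@measurable_expR R)); apply: measurable_funB; last first.
  by apply: (adapted_measurable mX (s := tp k)); apply: process_inner_adapted;
    rewrite tp0 lexx.
apply: measurable_funB => //; apply: measurable_funN.
apply: measurable_sum_nat => j jk.
by apply: (adapted_measurable mX (s := tp j)); apply: term_measurable; rewrite tp0 lexx.
Qed.

Lemma grid_weight_measurable k : measurable_fun setT (grid_weight k).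
Proof.
apply: measurable_sum_nat => j jk; apply: measurable_funM => //.
by apply: (adapted_measurable mX (s := tp j)); apply: process_norm_adapted; rewrite tp0 lexx.
Qed.

Lemma grid_density_bound k w : (k <= n.+1)%N ->
  0 <= grid_density k w <= expR (K + (s' - s)) * expR (- grid_weight k w).
Proof.
move=> kn; rewrite mulr_ge0 ?mulr_ge0 ?expR_ge0//= -expRD.
have i1 : (\1_A w : R) <= 1 by rewrite indicE; case: (_ \in _).
rewrite -[leRHS]mul1r; apply: ler_pM; rewrite ?mulr_ge0 ?expR_ge0//.
rewrite -[leRHS]mul1r; apply: ler_pM; rewrite ?expR_ge0// ler_expR.
have := @sum_term_ge k w kn; have := @Phi_ge (tp k); rewrite tp0 tp_t// => /(_ isT).
have : 0 <= inner (X (tp k) w) (c (t - tp k)).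
  by apply: Hplus_inner_ge0; [exact: XH|apply: c_Hplus; rewrite subr_ge0 tp_t].
lra.
Qed.

(** Term k is designed to undo what the transform formula produces at [tp k]. Everything cancels
    except its damping, which is twice the increment of [grid_weight]. *)
Let density_step k : (k < n.+1)%N ->
  \int[P x]_w grid_density k.+1 w =
  \int[P x]_w (grid_density k w * expR (- (2 * (grid_weight k.+1 w - grid_weight k w)))).
Proof.
move=> kn; have vH : Hplus (c (t - tp k.+1)) by apply: c_Hplus; rewrite subr_ge0 tp_t.
have := affine_markov_laplace X_affine xH (tp0 k) (ltW h_gt0) vH (@prefix_adapted k)
  (fun w => prefix_bound w kn).
rewrite -tpS => E.
rewrite (eq_Rintegral _ (g := fun w =>
  prefix k w * expR (- inner (X (tp k.+1) w) (c (t - tp k.+1))))); last first.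
  by move=> w _; rewrite /grid_density /prefix -!mulrA -!expRD; congr (_ * expR _); ring.
rewrite E; apply: eq_Rintegral => w _.
rewrite /grid_density /prefix -!mulrA -!expRD; congr (_ * expR _).
rewrite /grid_weight !big_nat_recr//= /grid_term innerBr.
by rewrite /tp; ring.
Qed.

Lemma grid_defect :
  0 <= \int[P x]_w grid_density 0 w - \int[P x]_w grid_density n.+1 w
    <= 2 * expR (K + (s' - s)) * \int[P x]_w (1 - expR (- grid_weight n.+1 w)).
Proof.
apply: (@exp_defect_sum _ _ _ (P x) grid_density grid_weight _ n.+1) => //.
- by move=> k; apply: grid_density_measurable.
- by move=> k; apply: grid_weight_measurable.
- by move=> w; rewrite /grid_weight big_geq.
- by move=> k w; rewrite /grid_weight big_nat_recr//= lerDl; exact: weight_ge0.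
- by move=> k w; exact: grid_density_bound.
Qed.

Lemma grid_weight_ge0 k w : 0 <= grid_weight k w.
Proof. by apply: sumr_ge0 => j _; exact: weight_ge0. Qed.

Lemma grid_weight_le w L : (forall r : R, 0 <= r <= t -> `|X r w| <= L) ->
  grid_weight n.+1 w <= eps * ((s' - s) * L).
Proof.
move=> XL; apply: (@le_trans _ _ (\sum_(0 <= j < n.+1) (eps * h * L))).
  rewrite /grid_weight big_nat [leRHS]big_nat; apply: ler_sum => j /= jn.
  apply: ler_wpM2l; first by rewrite mulr_ge0// ltW.
  by apply: XL; rewrite tp0 tp_t// ltnW.
rewrite big_const_nat subn0 iter_addr_0 -mulr_natr.
have -> : s' - s = h * n.+1%:R by rewrite /h divfK// pnatr_eq0.
by rewrite le_eqVlt; apply/orP; left; apply/eqP; ring.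
Qed.

Lemma grid_term_sum w L :
  (forall r : R, 0 <= r <= t -> `|inner (X r w) (g (t - r))| <= L) ->
  `|\sum_(0 <= j < n.+1) grid_term j w - 2^-1 * (h * \sum_(0 <= j < n.+1)
      inner (X (s + j.+1%:R * h) w) (g (t - (s + j.+1%:R * h))))|
  <= 3 * grid_weight n.+1 w + eps * (s' - s) + h * L.
Proof.
move=> fL; pose f j := inner (X (tp j) w) (g (t - tp j)).
rewrite -[X in h * X]/(\sum_(0 <= j < n.+1) f j.+1).
have e1 : `|\sum_(0 <= j < n.+1) grid_term j w
    - 2^-1 * h * \sum_(0 <= j < n.+1) f j| <= 3 * grid_weight n.+1 w + eps * (s' - s).
  rewrite mulr_sumr -sumrB; apply: le_trans (ler_norm_sum _ _ _) _.
  apply: (@le_trans _ _ (\sum_(0 <= j < n.+1)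
    (3 * (eps * h * `|X (tp j) w|) + eps * h))).
    rewrite big_nat [leRHS]big_nat; apply: ler_sum => j /= jn.
    by apply: (gap w _).1; rewrite -ltnS.
  rewrite big_split/= -mulr_sumr lerD2l big_const_nat subn0 iter_addr_0 -mulr_natr.
  by rewrite -mulrA /h divfK ?pnatr_eq0.
(* The terms sample left endpoints, the Riemann sum right ones. The shift costs f(n+1) - f(0), at
   most 2 L in size, hence h L after the factor h / 2. *)
have e2 : \sum_(0 <= j < n.+1) f j.+1 - \sum_(0 <= j < n.+1) f j = f n.+1 - f 0%N.
  by rewrite -sumrB telescope_sumr.
have f0 : `|f 0%N| <= L by apply: fL; rewrite tp0 tp_t.
have fn : `|f n.+1| <= L by apply: fL; rewrite tp0 tp_t.
move: e1 e2 f0 fn; move: (\sum_(0 <= j < n.+1) f j) (\sum_(0 <= j < n.+1) f j.+1)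
  (\sum_(0 <= j < n.+1) grid_term j w) (f 0%N) (f n.+1) => q1 q2 q3 q4 q5.
rewrite !ler_norml => /andP[a1 a2] e2 /andP[a3 a4] /andP[a5 a6].
have -> : q2 = q1 + (q5 - q4) by rewrite -e2 addrC subrK.
have : h * (q5 - q4) <= h * (2 * L) by apply: ler_wpM2l; [exact: ltW|lra].
have : h * - (2 * L) <= h * (q5 - q4) by apply: ler_wpM2l; [exact: ltW|lra].
rewrite mulrN (mulrCA h 2 L) => h1 h2.
have -> : q3 - 2^-1 * (h * (q1 + (q5 - q4))) =
  (q3 - 2^-1 * h * q1) - 2^-1 * (h * (q5 - q4)) by ring.
by move: (h * L) (h * (q5 - q4)) h1 h2 => r1 r2 h1 h2; apply/andP; split; lra.
Qed.

End grid.
Hypothesis riccati_approx : forall eps : R, 0 < eps -> exists2 d0 : R, 0 < d0 &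
  forall tau h : R, 0 <= tau -> 0 <= h <= d0 -> tau + h <= t ->
  `|c (tau + h) - psi h (c tau) - (2^-1 * h) *: g (tau + h)| <= eps * h /\
  `|Phi (tau + h) - Phi tau - phi h (c tau)| <= eps * h.

(** Level m works with eps = 1 / (m + 1) and a mesh fine enough for the one-step estimate;
    [m <= N m] also drives the mesh to 0. *)
Let grid_choice (L : R) : 0 < L -> exists N : nat -> nat, forall m, (m <= N m)%N /\
  approx m.+1%:R^-1 (L / (N m).+1%:R).
Proof.
move=> L0; have ex m : exists n, (m <= n)%N /\ approx m.+1%:R^-1 (L / n.+1%:R).
  have m0 : (0 : R) < m.+1%:R^-1 by rewrite invr_gt0.
  have [d0 d00 hd] := riccati_approx m0.
  have dL : 0 < d0 / L by rewrite divr_gt0.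
  have [n [mn nd]] : exists n, (m <= n)%N /\ n.+1%:R^-1 < d0 / L.
    near \oo => n; exists n; split; near: n; first exact: nbhs_infty_ge.
    exact: (near_infty_natSinv_lt (PosNum dL)).
  exists n; split => // tau tau0 taut; apply: hd => //.
  rewrite divr_ge0 ?(ltW L0)//= mulrC ltW//.
  by rewrite -ltr_pdivlMr.
by have [N hN] := choice ex; exists N.
Unshelve. all: by end_near. Qed.

Section limit.
Context (s s' : R) (x : hsop e) (A : set Om).
Hypotheses (s_ge0 : 0 <= s) (ss' : s < s') (s't : s' <= t) (xH : Hplus x).
Hypothesis FA : natural_filtration X s A.
Variable N : nat -> nat.
Hypothesis N_ge : forall m, (m <= N m)%N.
Hypothesis N_approx : forall m, approx m.+1%:R^-1 ((s' - s) / (N m).+1%:R).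
Let eps (m : nat) : R := m.+1%:R^-1.
Let U m w := grid_density s s' (N m) (eps m) A (N m).+1 w.
Let W m w := grid_weight s s' (N m) (eps m) (N m).+1 w.

Let eps_ge0 m : 0 <= eps m. Proof. by rewrite invr_ge0. Qed.
Let eps_le1 m : eps m <= 1. Proof. by rewrite invf_le1 ?ler1n. Qed.

Let small (f : nat -> R) (C : R) : (forall m, `|f m| <= eps m * C) -> f @ \oo --> 0.
Proof.
move=> fC; apply/cvgrPdist_le => eta eta0.
have C1 : 0 < eta / (`|C| + 1) by rewrite divr_gt0// ltr_wpDl.
near=> m.
rewrite sub0r normrN (le_trans (fC m))//.
apply: (@le_trans _ _ (eps m * (`|C| + 1))).
  by rewrite ler_wpM2l// (le_trans (ler_norm _))// lerDl.
rewrite -ler_pdivlMr ?ltr_wpDl//; apply: ltW; near: m.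
exact: (near_infty_natSinv_lt (PosNum C1)).
Unshelve. all: by end_near. Qed.

Let W_ge0 m w : 0 <= W m w.
Proof. exact: grid_weight_ge0. Qed.

Let W_small w : exists C, forall m, `|W m w| <= eps m * C.
Proof.
have [L L0 hL] := cadlag_bounded t (X_cadlag X_affine w).
exists ((s' - s) * L) => m; rewrite ger0_norm//.
exact: grid_weight_le.
Qed.

Let exponent_cvg w : (fun m => \sum_(0 <= j < (N m).+1) grid_term s s' (N m) (eps m) j w)
  @ \oo --> 2^-1 * \int[lebesgue_measure]_(r in `[s, s']) inner (X r w) (g (t - r)).
Proof.
pose Rs n := (s' - s) / n.+1%:R * \sum_(0 <= j < n.+1)
  inner (X (s + j.+1%:R * ((s' - s) / n.+1%:R)) w)
        (g (t - (s + j.+1%:R * ((s' - s) / n.+1%:R)))).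
have RN : (fun m => 2^-1 * Rs (N m)) @ \oo -->
    2^-1 * \int[lebesgue_measure]_(r in `[s, s']) inner (X r w) (g (t - r)).
  apply: cvgM; first exact: cvg_cst.
  have NN : N @ \oo --> \oo.
    move=> B [n _ nB]; exists n => // m /= nm; apply: nB => /=.
    exact: leq_trans nm (N_ge m).
  apply: (cvg_comp _ _ NN).
  exact: (inner_path_riemann (X_cadlag X_affine w) g_cont s_ge0 ss' s't).
have [L L0 hL] := inner_path_bounded t (X_cadlag X_affine w) g_cont.
have [C hC] := W_small w.
have rem : (fun m => \sum_(0 <= j < (N m).+1) grid_term s s' (N m) (eps m) j w
    - 2^-1 * Rs (N m)) @ \oo --> 0.
  (* The summands account for the weights, for the errors eps h, and for the endpoint shift, whose
     mesh is at most eps (s' - s) since m <= N m. *)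
  apply: (small (C := 3 * C + (s' - s) + (s' - s) * L)) => m.
  have h0 := grid_term_sum s_ge0 ss' s't (eps_ge0 m) (N_approx (m := m)) hL.
  apply: (le_trans h0).
  have h1 : W m w <= eps m * C by apply: le_trans (hC m); exact: ler_norm.
  have h2 : (s' - s) / (N m).+1%:R <= eps m * (s' - s).
    rewrite mulrC ler_wpM2r ?subr_ge0 ?(ltW ss')//.
    by rewrite lef_pV2 ?posrE ?ltr0n// ler_nat ltnS.
  have h3 := ler_wpM2r L0 h2.
  by move: h1 h3; rewrite /W; move: (grid_weight _ _ _ _ _ _) (_ / _ * L) => q1 q2; lra.
rewrite -[X in _ --> X]add0r (_ : (fun m => _) = fun m =>
  (\sum_(0 <= j < (N m).+1) grid_term s s' (N m) (eps m) j w - 2^-1 * Rs (N m))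
  + 2^-1 * Rs (N m)); last by apply/funext => m; rewrite subrK.
exact: cvgD.
Qed.

Let I_split w : I s' w =
  I s w + \int[lebesgue_measure]_(r in `[s, s']) inner (X r w) (g (t - r)).
Proof.
apply: Rintegral_chasles => //; first exact: ltW.
apply: (inner_path_integrable (X_cadlag X_affine w) g_cont (lexx 0) _ s't).
exact: le_lt_trans ss'.
Qed.

Let density_cvg w : U ^~ w @ \oo --> \1_A w * M s' w.
Proof.
have pe m : grid_pt s s' (N m) (N m).+1 = s'.
  by rewrite /grid_pt mulrC divfK ?pnatr_eq0// addrC subrK.
rewrite /U /grid_density; under eq_fun do rewrite pe.
rewrite /M I_split -expRD.
have -> : \1_A w * expR (- (2^-1 * (I s w +
    \int[lebesgue_measure]_(r in `[s, s']) inner (X r w) (g (t - r))))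
    + (- Phi (t - s') - inner (X s' w) (c (t - s')))) =
  \1_A w * (expR (- (2^-1 * I s w)) * expR (- (2^-1 *
    \int[lebesgue_measure]_(r in `[s, s']) inner (X r w) (g (t - r)))
    - Phi (t - s') - inner (X s' w) (c (t - s')))).
  by rewrite -expRD; congr (_ * expR _); ring.
apply: cvgM; first exact: cvg_cst.
apply: cvgM; first exact: cvg_cst.
apply: continuous_cvg; first exact: continuous_expR.
apply: cvgB; last exact: cvg_cst.
apply: cvgB; last exact: cvg_cst.
by apply: cvgN; exact: exponent_cvg.
Qed.

(** Each path is bounded on [0, t], so the weights tend to 0 pathwise and the bound of [grid_defect]
    vanishes. The initial expectation does not depend on m, hence it equals the limit of the final
    ones. *)
Lemma affine_martingale_limit :
  \int[P x]_w (\1_A w * M s w) = \int[P x]_w (\1_A w * M s' w).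
Proof.
have Pfin : (P x setT < +oo)%E by rewrite probability_setT ltry.
have mA : measurable_fun setT (\1_A : Om -> R).
  by apply: measurable_indic; exact: natural_filtration_measurable FA.
have mU m : measurable_fun setT (U m).
  exact: grid_density_measurable.
have mM : measurable_fun setT (fun w => \1_A w * M s' w).
  apply: measurable_funM => //; apply: (adapted_measurable mX (s := s')).
  by apply: M_adapted; rewrite s't (le_trans s_ge0)// ltW.
have start m w : grid_density s s' (N m) (eps m) A 0 w = \1_A w * M s w.
  have p0 : grid_pt s s' (N m) 0 = s by rewrite /grid_pt mul0r addr0.
  rewrite /grid_density p0 (big_geq (leqnn 0)); congr (_ * (_ * expR _)).
  by rewrite oppr0 sub0r.
have U_lim : (fun m => \int[P x]_w U m w) @ \oo --> \int[P x]_w (\1_A w * M s' w).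
  apply: (bounded_convergence (K := expR (K + (s' - s)))) => //.
  - move=> m w _; have /andP[h1 h2] := grid_density_bound A s_ge0 ss' s't
      (eps_ge0 m) (eps_le1 m) (N_approx (m := m)) w (leqnn _).
    rewrite ger0_norm//; apply: (le_trans h2); rewrite ler_piMr ?expR_ge0//.
    by rewrite -expR0 ler_expR oppr_le0 W_ge0.
have W_lim : (fun m => \int[P x]_w (1 - expR (- W m w))) @ \oo --> (0 : R).
  rewrite (_ : 0 = \int[P x]_w (1 - expR (- 0))); last first.
    by rewrite oppr0 expR0 subrr Rintegral_cst// mul0r.
  apply: (bounded_convergence (K := 1)) => //.
  - move=> m; apply: measurable_funB => //.
    apply: (measurableT_comp (@measurable_expR R)); apply: measurable_funN.
    exact: grid_weight_measurable.
  - move=> w _; apply: cvgB; first exact: cvg_cst.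
    apply: continuous_cvg; first exact: continuous_expR.
    by apply: cvgN; have [C hC] := W_small w; exact: small hC.
  - move=> m w _; rewrite ger0_norm ?subr_ge0; last first.
      by rewrite -expR0 ler_expR oppr_le0 W_ge0.
    by rewrite lerBlDr lerDl expR_ge0.
have def m := grid_defect s_ge0 ss' s't xH (eps_ge0 m) (eps_le1 m) FA (N_approx (m := m)).
have D0 m : \int[P x]_w grid_density s s' (N m) (eps m) A 0 w =
    \int[P x]_w (\1_A w * M s w) := eq_Rintegral _ (fun w _ => start m w).
have c0 : (fun m => \int[P x]_w grid_density s s' (N m) (eps m) A 0 w) @ \oo -->
    \int[P x]_w (\1_A w * M s w).
  by rewrite (funext D0); exact: cvg_cst.
apply/eqP; rewrite -subr_eq0; apply/eqP.
apply: (cvg_unique (@norm_hausdorff _ _) (cvgB c0 U_lim)).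
apply: (@squeeze_cvgr _ _ _ _ (fun=> 0) (fun m =>
  2 * expR (K + (s' - s)) * \int[P x]_w (1 - expR (- W m w)))).
- by apply: nearW => m; exact: def.
- exact: cvg_cst.
- by rewrite -(mulr0 (2 * expR (K + (s' - s)))); apply: cvgM; [exact: cvg_cst|exact: W_lim].
Qed.

End limit.
Lemma affine_exponential_martingale x : Hplus x ->
  martingale_on (P x) (augmented_filtration (P x) (natural_filtration X)) t M.
Proof.
move=> xH.
have mM s : 0 <= s <= t -> measurable_fun setT (M s).
  by move=> st; apply: (adapted_measurable mX (s := s)); exact: M_adapted.
split.
- move=> s st B mB; apply: sub_sigma_algebra; left.
  by have /adaptedP := @M_adapted s st; apply.
- move=> s st; have : (P x).-integrable setT (EFin \o M s).
    apply: (finite_bounded_integrable (P x) measurableT (K := expR K)).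
      exact: mM.
    by move=> w _; have /andP[h1 h2] := @M_bound s w st; rewrite ger0_norm.
  by move=> /integrableP[_].
move=> s s' s0; rewrite le_eqVlt => /predU1P[<- //|ss' s't A FA].
have st : 0 <= s <= t by rewrite s0 (le_trans (ltW ss')).
have s't' : 0 <= s' <= t by rewrite s't (le_trans s0)// ltW.
(* An event of the augmented filtration is traded for one of the natural filtration; since M is
   nonnegative, its integrals over both agree even if [A] is not measurable. *)
have [B [N' [FB nN AB BA]]] := augmented_modify (smallest_sigma_algebra _ _) FA.
have mB : measurable B by exact: natural_filtration_measurable FB.
have E r : 0 <= r <= t ->
    (\int[P x]_(w in A) (M r w)%:E = \int[P x]_(w in B) (M r w)%:E)%E.
  move=> rt; apply: (ge0_integral_ae_eq_set (N := N')) => //.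
    by apply/measurable_EFinP; exact: mM.
  by move=> w; rewrite lee_fin; have /andP[] := @M_bound r w rt.
have E2 r : 0 <= r <= t -> (\int[P x]_(w in B) (M r w)%:E =
    (\int[P x]_w (\1_B w * M r w))%:E)%E.
  move=> rt; rewrite integral_mkcond /Rintegral fineK.
    apply: eq_integral => w _; rewrite patchE indicE.
    by case: (w \in B); rewrite ?mul1r ?mul0r.
  apply: integrable_fin_num => //.
  apply: (finite_bounded_integrable (P x) measurableT (K := expR K)).
    by apply: measurable_funM; [exact: measurable_indic|exact: mM].
  move=> w _; have /andP[h1 h2] := @M_bound r w rt.
  rewrite normrM (ger0_norm h1) (le_trans _ h2)// ler_piMl//.
  by rewrite indicE; case: (_ \in _); rewrite ?normr1 ?normr0.
apply: (etrans (E s' s't')); apply: (etrans (E2 s' s't')).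
apply: esym; apply: (etrans (E s st)); apply: (etrans (E2 s st)).
apply: (congr1 EFin).
have L0 : 0 < s' - s by rewrite subr_gt0.
have [N hN] := grid_choice L0.
apply: (affine_martingale_limit s0 ss' s't xH FB (N := N)) => m.
  by case: (hN m).
by case: (hN m).
Qed.

End affine_martingale.

(** * From the joint Riccati equations to the exponential martingale *)

Lemma is_bochner_eq (R : realType) (E : innerType R) (D : set R) (g g' : R -> E)
    (r : E) : (forall s, D s -> g s = g' s) ->
  is_bochner D g r -> is_bochner D g' r.
Proof.
move=> gg' [mg ig Eg]; split.
- by apply: eq_measurable_fun mg => s /set_mem/gg'.
- by move: ig; congr (_ < _)%E; apply: eq_integral => s /set_mem/gg' ->.
- by move=> h; rewrite Eg; apply: eq_Rintegral => s /set_mem/gg' ->.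
Qed.

Lemma is_bochner_set1 (R : realType) (E : innerType R) (a : R) (g : R -> E) (r : E) :
  is_bochner `[a, a] g r -> r = 0.
Proof.
move=> [_ _ /(_ r)]; rewrite set_itv1 Rintegral_set1 innerxx => /eqP.
by rewrite sqrf_eq0 normr_eq0 => /eqP.
Qed.

Lemma eq_martingale_on d (Om : measurableType d) (R : realType)
    (P : probability Om R) (F : R -> set (set Om)) (t : R) (M M' : R -> Om -> R) :
  (forall s : R, 0 <= s <= t -> M s = M' s) ->
  martingale_on P F t M -> martingale_on P F t M'.
Proof.
move=> MM' [h1 h2 h3]; split.
- by move=> s st; rewrite -MM'//; exact: h1.
- by move=> s st; rewrite -MM'//; exact: h2.
- move=> s s' s0 ss' s't A FA; rewrite -!MM' ?s0 ?(le_trans ss')//.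
    exact: h3.
  by rewrite s't (le_trans s0).
Qed.

Lemma ctensor2_imaginary (R : realType) (H : innerType R) (e : onb H) (y : H) :
  (ctensor2 e (0, y)).1 = - tensor2 e y.
Proof.
rewrite /ctensor2/= (_ : tensor2 e 0 = 0) ?sub0r//.
by apply/val_inj/funext => h; rewrite /= /tensor scaler0.
Qed.

Theorem proposition3p4 (R : realType) (V H Vd : hilbertType R)
  (G : gelfand_triple V H Vd) (e : onb H) (f : onb Vd) (p : params G e)
  (p_admissible : admissible f p) (p_C : assumptionC f p)
  (T : R -> hsop e -> hsop e) (T_semigroup : mode_semigroup (lam p) T)
  (phi : R -> hsop e -> R) (psi : R -> hsop e -> hsop e)
  (phi_psi : forall u, Hplus u ->
     riccati_solution p T u (phi ^~ u) (psi ^~ u))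
  (d : measure_display) (Om : measurableType d)
  (X : R -> Om -> hsop e) (P : hsop e -> probability Om R)
  (X_affine : affine_process phi psi X P)
  (S Sadj : R -> H -> H) (S_semigroup : C0_semigroup S)
  (S_adjoint : adjoint_family S Sadj)
  (t : R) (t_gt0 : 0 < t) (u : (H * H) * hsop e)
  (u1_imaginary : imaginary u.1) (u2_Hplus : Hplus u.2)
  (Phi : R -> R) (psi1 : R -> H * H) (psi2 : R -> hsop e)
  (joint_sol : joint_riccati_solution p T Sadj u Phi psi1 psi2)
  (x : hsop e) (x_Hplus : Hplus x) :
  martingale_on (P x) (augmented_filtration (P x) (natural_filtration X)) t
    (fun s w =>
       expR (2^-1 * \int[lebesgue_measure]_(r in `[0, s])
                      inner (X r w) (ctensor2 e (psi1 (t - r))).1)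
       * expR (- Phi (t - s) - inner (X s w) (psi2 (t - s)))).
Proof.
have [psi1E [c_cont c_C c_mild] PhiE] := joint_sol.
have [T_C0 _] := T_semigroup.
(* psi_1(s) is i times the adjoint orbit of the imaginary part of u_1, so its complex square is
   minus this positive tensor; clamping at 0 makes [g] continuous on R. *)
pose g s := tensor2 e (Sadj (Num.max 0 s) u.1.2).
have g_cont : continuous g.
  by move=> s; apply: tensor2_cvg; exact: (adjoint_continuous S_semigroup S_adjoint).
have g_H s : Hplus (g s) by exact: Hplus_tensor2.
have gE s : 0 <= s -> (ctensor2 e (psi1 s)).1 = - g s.
  move=> s0; rewrite psi1E// u1_imaginary /g max_r//.
  have -> : Sadj s 0 = 0 by have := adjoint_linear S_adjoint s0 (-1) 0 0;
    rewrite scaler0 add0r scaleN1r addNr.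
  exact: ctensor2_imaginary.
have c0 : psi2 0 = u.2.
  have /is_bochner_set1/eqP := c_mild 0 (lexx 0).
  by rewrite subr_eq0 => /eqP ->; case: T_C0.
(* Two signs cancel: -1/2 times the square of psi_1 is + g / 2, so psi_2 follows the original
   Riccati equation with a positive source. *)
have c_mild' s : 0 <= s -> is_bochner `[0, s]
    (fun r => T (s - r) (riccatiR p (psi2 r) + 2^-1 *: g r)) (psi2 s - T s (psi2 0)).
  move=> s0; rewrite c0; apply: is_bochner_eq (c_mild s s0) => r.
  rewrite /= in_itv/= => /andP[r0 _].
  by rewrite /joint_riccatiR gE// scalerN opprK.
have N_lip := riccatiR_lipschitz p_admissible.
have F_lip := riccatiF_lipschitz p_admissible.
have psi_cont w : Hplus w -> {within `[0, +oo[, continuous (psi ^~ w)}.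
  by move=> /phi_psi[[]].
have psi_C w s : Hplus w -> 0 <= s -> Hplus (psi s w).
  by move=> /phi_psi[[_ h _] _]; exact: h.
have psi_mild w s : Hplus w -> 0 <= s ->
  is_bochner `[0, s] (fun r => T (s - r) (riccatiR p (psi r w))) (psi s w - T s w).
  by move=> /phi_psi[[_ _ h] _]; exact: h.
have phiE w s : Hplus w -> 0 <= s ->
    phi s w = \int[lebesgue_measure]_(r in `[0, s]) riccatiF p (psi r w).
  by move=> /phi_psi[_ h]; exact: h.
have approx := riccati_step T_C0 (Hplus_zero e) N_lip F_lip psi_cont psi_C psi_mild
  phiE t g_cont c_cont c_C c_mild' PhiE.
have [K PhiK] : exists K, forall s : R, 0 <= s <= t -> `|Phi s| <= K.
  (* Phi is the integral of F along the continuous curve psi_2, on which F is bounded over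
     [0, t]. *)
  pose Fc (r : R) : R := riccatiF p (psi2 (Num.max 0 r)).
  have Fc_cont : continuous Fc.
    apply: (loc_lipschitz_continuous (C := @Hplus R H e) (N := riccatiF p : _ -> R^o)
      (c := fun r => psi2 (Num.max 0 r)) F_lip); last exact: clamp_continuous.
    by move=> r; apply: c_C; rewrite le_max lexx.
  have [K K0 FK] := continuous_bounded 0 t Fc_cont.
  exists (K * t) => s /andP[s0 st]; rewrite PhiE//.
  have -> : \int[lebesgue_measure]_(r in `[0, s]) riccatiF p (psi2 r) =
      \int[lebesgue_measure]_(r in `[0, s]) Fc r.
    apply: eq_Rintegral => r; rewrite inE/= in_itv/= => /andP[r0 _].
    by rewrite /Fc max_r.
  apply: le_trans (Rintegral_bound s0 (continuous_integrable 0 s Fc_cont) _) _.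
    by move=> r /andP[r0 rs]; apply: FK; rewrite r0 (le_trans rs).
  by rewrite subr0 ler_wpM2l.
have := affine_exponential_martingale X_affine g_cont g_H c_C PhiK approx x_Hplus.
apply: eq_martingale_on => s /andP[s0 st]; apply/funext => w.
congr (expR _ * _); rewrite -mulrN; congr (_ * _).
move: s0; rewrite le_eqVlt => /predU1P[<-|s0].
  by rewrite set_itv1 !Rintegral_set1 oppr0.
have fi := inner_path_integrable (X_cadlag X_affine w) g_cont (lexx 0) s0 st.
rewrite -mulN1r -(RintegralZl (-1) _ fi)//; apply: eq_Rintegral => r.
rewrite inE/= in_itv/= => /andP[r0 rs].
rewrite mulN1r -innerNr -gE//.
by rewrite subr_ge0 (le_trans rs).
Qed.
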